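(* (Direct part.) If $M(f_1,\ldots,f_6)$ is a non-Sasakian (that is, $f_1-f_3\neq1$), contact metric generalized $(\kappa,\mu)$-space form of dimension greater than or equal to $5$, then $M$ has constant $\phi$-sectional curvature $c=2f_6-1>-3$ and $$f_1=\frac{f_6+1}{2},\quad f_2=\frac{f_6-1}{2},\quad f_3=\frac{3f_6+1}{2},\quad f_4=1,\quad f_5=\frac12,\quad f_6=\text{constant}>-1,$$ $$\kappa=-f_6<1,\qquad \mu=1-f_6<2,$$ where $\kappa=f_1-f_3$ and $\mu=f_4-f_6$. Hence $M$ is a $(-f_6,1-f_6)$-space with constant $\phi$-sectional curvature $c=2f_6-1>-3$. (Converse part.) Conversely, let $M$ be a $(-f_6,1-f_6)$-space of dimension greater than or equal to $5$ and constant $\phi$-sectional curvature $c=2f_6-1>-3$. Then $M$ is a non-Sasakian, contact metric generalized $(\kappa,\mu)$-space form $M(f_1,\ldots,f_6)$ with constant functions $f_1,\ldots,f_6$ satisfying $$f_1=\frac{f_6+1}{2},\quad f_2=\frac{f_6-1}{2},\quad f_3=\frac{3f_6+1}{2},\quad f_4=1,\quad f_5=\frac12,\quad f_6=\text{constant}>-1,$$ $$\kappa=-f_6<1,\qquad \mu=1-f_6<2.$$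
   Context: All functions and tensors are smooth. An almost contact metric manifold $(M^{2n+1},\phi,\xi,\eta,g)$ is a Riemannian manifold $(M,g)$ with a $(1,1)$-tensor field $\phi$, a vector field $\xi$ and a 1-form $\eta$ with $\eta(\xi)=1$, $\phi^2X=-X+\eta(X)\xi$, $g(\phi X,\phi Y)=g(X,Y)-\eta(X)\eta(Y)$. It is a contact metric manifold if $d\eta(X,Y)=g(X,\phi Y)$, with the convention $2\,d\eta(X,Y)=X\eta(Y)-Y\eta(X)-\eta([X,Y])$. It is Sasakian if $(\nabla_X\phi)Y=g(X,Y)\xi-\eta(Y)X$ for all $X,Y$. Put $h=\tfrac12 L_\xi\phi$ ($L$ the Lie derivative). The curvature is $R(X,Y)Z=\nabla_X\nabla_YZ-\nabla_Y\nabla_XZ-\nabla_{[X,Y]}Z$ and $R(X,Y,Z,W)=g(R(X,Y)Z,W)$. The $\phi$-sectional curvature of the plane spanned by a unit vector $X\perp\xi$ and $\phi X$ is $K(X,\phi X)=R(X,\phi X,\phi X,X)$. An almost contact metric manifold is a generalized $(\kappa,\mu)$-space form, denoted $M(f_1,\ldots,f_6)$, if there are functions $f_1,\ldots,f_6$ on $M$ with $R=\sum_{i=1}^6 f_iR_i$, where $R_1(X,Y)Z=g(Y,Z)X-g(X,Z)Y$; $R_2(X,Y)Z=g(X,\phi Z)\phi Y-g(Y,\phi Z)\phi X+2g(X,\phi Y)\phi Z$; $R_3(X,Y)Z=\eta(X)\eta(Z)Y-\eta(Y)\eta(Z)X+g(X,Z)\eta(Y)\xi-g(Y,Z)\eta(X)\xi$;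 $R_4(X,Y)Z=g(Y,Z)hX-g(X,Z)hY+g(hY,Z)X-g(hX,Z)Y$; $R_5(X,Y)Z=g(hY,Z)hX-g(hX,Z)hY+g(\phi hX,Z)\phi hY-g(\phi hY,Z)\phi hX$; $R_6(X,Y)Z=\eta(X)\eta(Z)hY-\eta(Y)\eta(Z)hX+g(hX,Z)\eta(Y)\xi-g(hY,Z)\eta(X)\xi$. For constants $\kappa,\mu$, a $(\kappa,\mu)$-space is a contact metric manifold with $R(X,Y)\xi=\kappa\{\eta(Y)X-\eta(X)Y\}+\mu\{\eta(Y)hX-\eta(X)hY\}$ for all $X,Y$. *)

(* Defs.v *)
From HB Require Import structures.
From mathcomp Require Import all_boot all_order all_algebra.
From mathcomp Require Import all_classical all_reals all_analysis.
From mathcomp Require Import lra.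

Set Implicit Arguments.
Unset Strict Implicit.
Unset Printing Implicit Defensive.

Import Order.TTheory GRing.Theory Num.Theory.
Import numFieldNormedType.Exports.

Local Open Scope classical_set_scope.
Local Open Scope ring_scope.

(* Analysis over an abstract [R : realType].  A manifold is given by an atlas
   with values in ['rV[R]_m.+1]; a tensor field is given by its components in every
   chart of the atlas, subject to the usual transformation law.  Tangent vectors
   are rows, so a (1,1)-tensor acts by right multiplication and a 1-form is a
   column. *)

(* C^oo on an open set W: all iterated directional derivatives are Frechet
   differentiable (hence continuous) at every point of W. *)
Definition smooth_on (R : realType) (m : nat) (V : normedModType R)
    (W : set 'rV[R]_m.+1) (f : 'rV[R]_m.+1 -> V) : Prop :=
  forall (vs : seq 'rV[R]_m.+1) (x : 'rV[R]_m.+1), W x ->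
    differentiable (foldr (fun v F => fun y => 'D_v F y) f vs) x.

Record chart (R : realType) (m : nat) (T : topologicalType) := Chart {
  dom : set T;
  coord : T -> 'rV[R]_m.+1;
  param : 'rV[R]_m.+1 -> T;
  dom_open : open dom;
  cod_open : open (coord @` dom);
  coordK : {in dom, cancel coord param};
  coord_cont : {within dom, continuous coord};
  param_cont : {within coord @` dom, continuous param} }.

Definition cod (R : realType) (m : nat) (T : topologicalType)
  (c : chart R m T) : set 'rV[R]_m.+1 := coord c @` dom c.

Definition transition (R : realType) (m : nat) (T : topologicalType)
  (c d : chart R m T) : 'rV[R]_m.+1 -> 'rV[R]_m.+1 := coord d \o param c.

Definition overlap (R : realType) (m : nat) (T : topologicalType)
  (c d : chart R m T) : set 'rV[R]_m.+1 := coord c @` (dom c `&` dom d).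

(* [manifold R m] is the type of nonempty connected smooth manifolds (Hausdorff,
   second countable, without boundary) of dimension m.+1. *)
Record manifold (R : realType) (m : nat) := Manifold {
  points :> topologicalType;
  chart_index : Type;
  charts : chart_index -> chart R m points;
  points_nonempty : [set: points] !=set0;
  points_connected : connected [set: points];
  points_hausdorff : hausdorff_space points;
  points_second_countable : @second_countable points;
  charts_cover : forall p : points, exists i, dom (charts i) p;
  charts_compatible : forall i j,
    smooth_on (overlap (charts i) (charts j))
              (transition (charts i) (charts j)) }.

Definition smooth_function (R : realType) (m : nat) (M : manifold R m)
    (f : M -> R) : Prop :=
  forall i, smooth_on (cod (charts i)) (f \o param (charts i) : _ -> R^o).

Section Coordinates.
Variables (R : realType) (m : nat).
Local Notation vec := 'rV[R]_m.+1.
Local Notation field := (vec -> vec).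

Definition bracket (X Y : field) : field :=
  fun x => 'D_(X x) Y x - 'D_(Y x) X x.

Definition inner (G : vec -> 'M[R]_m.+1) (x u v : vec) : R :=
  (u *m G x *m v^T) 0 0.

(* The Christoffel symbols of G contracted with u and v:
   2 G(Gamma(u,v), e_k) =
     (D_u G)(v, e_k) + (D_v G)(u, e_k) - (D_{e_k} G)(u, v). *)
Definition christoffel (G : vec -> 'M[R]_m.+1) (x u v : vec) : vec :=
  2^-1 *: ((v *m 'D_u G x + u *m 'D_v G x
            - \row_k (u *m 'D_(delta_mx 0 k) G x *m v^T) 0 0) *m invmx (G x)).

(* The Levi-Civita connection of G: lemmas [nabla_torsion_free] and
   [nabla_metric] below are its two characteristic properties. *)
Definition nabla (G : vec -> 'M[R]_m.+1) (X Y : field) : field :=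
  fun x => 'D_(X x) Y x + christoffel G x (X x) (Y x).

Lemma is_derive_mulmx (p q r : nat) (A : vec -> 'M[R]_(p.+1, q.+1))
    (B : vec -> 'M[R]_(q.+1, r.+1)) (x v : vec) :
  derivable A x v -> derivable B x v ->
  is_derive x v (fun y => A y *m B y) ('D_v A x *m B x + A x *m 'D_v B x).
Proof.
move=> dA dB.
have dAij i j : derivable (fun y => A y i j) x v by move: i j; apply/derivable_mxP.
have dBij i j : derivable (fun y => B y i j) x v by move: i j; apply/derivable_mxP.
have E i j : (fun y => (A y *m B y) i j) =
    \sum_(k < q.+1) ((fun y => A y i k : R) * (fun y => B y k j : R)).
  by apply/funext => y; rewrite mxE fct_sumE.
have dAB : derivable (fun y => A y *m B y) x v.
  apply/derivable_mxP => i j; rewrite E; apply: derivable_sum => k.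
  exact: derivableM.
apply: DeriveDef => //; rewrite derive_mx//; apply/matrixP => i j.
rewrite mxE E derive_sum; last by move=> k; exact: derivableM.
rewrite !mxE -big_split /=; apply: eq_bigr => k _ /=.
rewrite deriveM// addrC !derive_mx// !mxE.
by congr (_ + _); rewrite mulrC.
Qed.

Lemma is_derive_trmx (p q : nat) (A : vec -> 'M[R]_(p.+1, q.+1)) (x v : vec) :
  derivable A x v -> is_derive x v (fun y => (A y)^T) ('D_v A x)^T.
Proof.
move=> dA.
have dAt : derivable (fun y => (A y)^T) x v.
  apply/derivable_mxP => i j.
  have -> : (fun y => (A y)^T i j) = (fun y => A y j i).
    by apply/funext => y; rewrite mxE.
  by move: dA => /derivable_mxP; apply.
apply: DeriveDef => //; rewrite !derive_mx//; apply/matrixP => i j.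
by rewrite !mxE; congr ('D_v _ x); apply/funext => y; rewrite mxE.
Qed.

Lemma derive_sym (G : vec -> 'M[R]_m.+1) (x v : vec) :
  (\forall y \near x, (G y)^T = G y) -> derivable G x v ->
  ('D_v G x)^T = 'D_v G x.
Proof.
move=> sG dG; have [_ <-] := is_derive_trmx dG.
exact: near_eq_derive.
Qed.

Lemma form_trmx (D : 'M[R]_m.+1) (u v : vec) :
  (u *m D *m v^T) 0 0 = (v *m D^T *m u^T) 0 0.
Proof.
have -> : v *m D^T *m u^T = (u *m D *m v^T)^T by rewrite !trmx_mul trmxK mulmxA.
by rewrite [RHS]mxE.
Qed.

Lemma christoffel_sym (G : vec -> 'M[R]_m.+1) (x u v : vec) :
  (\forall y \near x, (G y)^T = G y) -> differentiable G x ->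
  christoffel G x u v = christoffel G x v u.
Proof.
move=> sG dG; rewrite /christoffel.
have aux (p q r s : vec) (k : R) (B : 'M[R]_m.+1) :
    r = s -> k *: ((p + q - r) *m B) = k *: ((q + p - s) *m B).
  by move=> ->; rewrite [p + q]addrC.
apply: aux.
apply/rowP => k; rewrite mxE [RHS]mxE.
have dk : derivable G x (delta_mx 0 k) by exact: diff_derivable.
by rewrite form_trmx derive_sym.
Qed.

Lemma nabla_torsion_free (G : vec -> 'M[R]_m.+1) (X Y : vec -> vec) (x : vec) :
  (\forall y \near x, (G y)^T = G y) -> differentiable G x ->
  nabla G X Y x - nabla G Y X x = bracket X Y x.
Proof.
move=> sG dG; rewrite /nabla /bracket christoffel_sym//.
have aux (p q r : vec) : p + r - (q + r) = p - q.
  by rewrite opprD addrACA subrr addr0.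
exact: aux.
Qed.

Lemma inner_christoffel (G : vec -> 'M[R]_m.+1) (x u v w : vec) :
  (G x)^T = G x -> differentiable G x -> G x \in unitmx ->
  inner G x (christoffel G x u v) w =
    2^-1 * ((v *m 'D_u G x *m w^T) 0 0 + (u *m 'D_v G x *m w^T) 0 0
            - (u *m 'D_w G x *m v^T) 0 0).
Proof.
move=> sG dG uG; rewrite /inner /christoffel -!scalemxAl mulmxKV// mxE; congr (_ * _).
rewrite mulmxBl mulmxDl [LHS]mxE [X in X + _ = _]mxE; congr (_ + _).
rewrite [LHS]mxE; congr (- _).
transitivity ((u *m (\sum_k w 0 k *: 'D_(delta_mx 0 k) G x) *m v^T) 0 0).
  rewrite mulmx_sumr mulmx_suml summxE [LHS]mxE; apply: eq_bigr => k _.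
  by rewrite [X in X * _]mxE [X in _ * X]mxE -scalemxAr -scalemxAl [RHS]mxE mulrC.
congr ((_ *m _ *m _) 0 0).
rewrite [in RHS](row_sum_delta w) deriveE// linear_sum.
by apply: eq_bigr => k _; rewrite linearZ deriveE.
Qed.

Lemma nabla_metric (G : vec -> 'M[R]_m.+1) (X Y Z : vec -> vec) (x : vec) :
  (\forall y \near x, (G y)^T = G y) -> differentiable G x ->
  G x \in unitmx -> differentiable Y x -> differentiable Z x ->
  'D_(X x) (fun y => inner G y (Y y) (Z y) : R^o) x
  = inner G x (nabla G X Y x) (Z x) + inner G x (Y x) (nabla G X Z x).
Proof.
have aux (L I1 I2 a a' b c d e g1 g2 : R) :
    L = b + a + c -> I1 = b + g1 -> I2 = c + g2 ->
    g1 = 2^-1 * (a + d - e) -> g2 = 2^-1 * (a' + e - d) -> a' = a ->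
    L = I1 + I2.
  by move=> -> -> -> -> -> ->; lra.
move=> sG dG uG dY dZ.
have sGx : (G x)^T = G x by exact: nbhs_singleton sG.
have iC u v : inner G x u v = inner G x v u.
  by rewrite /inner form_trmx sGx.
have iD u v w : inner G x (u + v) w = inner G x u w + inner G x v w.
  by rewrite /inner !mulmxDl mxE.
rewrite /nabla.
set w := X x.
have dGw v : derivable G x v by exact: diff_derivable.
have dYw : derivable Y x w by exact: diff_derivable.
have dZw : derivable Z x w by exact: diff_derivable.
have [dYG eYG] := is_derive_mulmx dYw (dGw w).
have [dZt eZt] := is_derive_trmx dZw.
have [dF eF] := is_derive_mulmx dYG dZt.
have E1 : 'D_w (fun y => inner G y (Y y) (Z y) : R^o) x =
    ('D_w (fun y => Y y *m G y *m (Z y)^T) x) 0 0.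
  by rewrite derive_mx// mxE.
have E2 : 'D_w (fun y => Y y *m G y *m (Z y)^T) x =
    ('D_w Y x *m G x) *m (Z x)^T + (Y x *m 'D_w G x) *m (Z x)^T
    + Y x *m G x *m ('D_w Z x)^T.
  by rewrite eF eYG eZt mulmxDl.
have E3 (P Q S : 'M[R]_1) : (P + Q + S) 0 0 = P 0 0 + Q 0 0 + S 0 0.
  by rewrite !mxE.
have Dsym : (Z x *m 'D_w G x *m (Y x)^T) 0 0 = (Y x *m 'D_w G x *m (Z x)^T) 0 0.
  by rewrite form_trmx derive_sym.
have N1 := inner_christoffel w (Y x) (Z x) sGx dG uG.
have N2 := inner_christoffel w (Z x) (Y x) sGx dG uG.
have F1 := iD ('D_w Y x) (christoffel G x w (Y x)) (Z x).
have F2 := iC (Y x) ('D_w Z x + christoffel G x w (Z x)).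
have F3 := iD ('D_w Z x) (christoffel G x w (Z x)) (Y x).
have F4 := iC ('D_w Z x) (Y x).
have EL := etrans E1 (etrans (congr1 (fun P : 'M[R]_1 => P 0 0) E2) (E3 _ _ _)).
have F5 := etrans F2 (etrans F3 (congr1 (fun t => t + _) F4)).
exact: aux EL F1 F5 N1 N2 Dsym.
Qed.

Definition curv (G : vec -> 'M[R]_m.+1) (X Y Z : field) : field :=
  fun x => nabla G X (nabla G Y Z) x - nabla G Y (nabla G X Z) x
           - nabla G (bracket X Y) Z x.

(* Components, in one chart, of the tensors phi, xi, eta, g. *)
Record acm_components := ACMComponents {
  phi : vec -> 'M[R]_m.+1;
  xi : vec -> vec;
  eta : vec -> 'cV[R]_m.+1;
  met : vec -> 'M[R]_m.+1 }.

Variable A : acm_components.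

Definition etaV (x u : vec) : R := (u *m eta A x) 0 0.
Definition metV (x u v : vec) : R := inner (met A) x u v.

Definition phiF (X : field) : field := fun x => X x *m phi A x.

(* h = (1/2) L_xi phi, where (L_xi phi) X = [xi, phi X] - phi [xi, X]. *)
Definition hF (X : field) : field :=
  fun x => 2^-1 *: (bracket (xi A) (phiF X) x - phiF (bracket (xi A) X) x).

Record acm_axioms (W : set vec) : Prop := ACMAxioms {
  phi_smooth : smooth_on W (phi A);
  xi_smooth : smooth_on W (xi A);
  eta_smooth : smooth_on W (eta A);
  met_smooth : smooth_on W (met A);
  met_sym : forall x u v, W x -> metV x u v = metV x v u;
  met_pos : forall x u, W x -> u != 0 -> 0 < metV x u u;
  eta_xi : forall x, W x -> etaV x (xi A x) = 1;
  phi_phi : forall x u, W x ->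
    u *m phi A x *m phi A x = - u + etaV x u *: xi A x;
  met_phi : forall x u v, W x ->
    metV x (u *m phi A x) (v *m phi A x) = metV x u v - etaV x u * etaV x v }.

Definition deta (X Y : field) (x : vec) : R :=
  2^-1 * ('D_(X x) (fun y => etaV y (Y y) : R^o) x
          - 'D_(Y x) (fun y => etaV y (X y) : R^o) x
          - etaV x (bracket X Y x)).

Definition R1 (X Y Z : field) : field := fun x =>
  metV x (Y x) (Z x) *: X x - metV x (X x) (Z x) *: Y x.

Definition R2 (X Y Z : field) : field := fun x =>
  metV x (X x) (phiF Z x) *: phiF Y x - metV x (Y x) (phiF Z x) *: phiF X x
  + (2 * metV x (X x) (phiF Y x)) *: phiF Z x.

Definition R3 (X Y Z : field) : field := fun x =>
  (etaV x (X x) * etaV x (Z x)) *: Y x - (etaV x (Y x) * etaV x (Z x)) *: X x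
  + (metV x (X x) (Z x) * etaV x (Y x)) *: xi A x
  - (metV x (Y x) (Z x) * etaV x (X x)) *: xi A x.

Definition R4 (X Y Z : field) : field := fun x =>
  metV x (Y x) (Z x) *: hF X x - metV x (X x) (Z x) *: hF Y x
  + metV x (hF Y x) (Z x) *: X x - metV x (hF X x) (Z x) *: Y x.

Definition R5 (X Y Z : field) : field := fun x =>
  metV x (hF Y x) (Z x) *: hF X x - metV x (hF X x) (Z x) *: hF Y x
  + metV x (phiF (hF X) x) (Z x) *: phiF (hF Y) x
  - metV x (phiF (hF Y) x) (Z x) *: phiF (hF X) x.

Definition R6 (X Y Z : field) : field := fun x =>
  (etaV x (X x) * etaV x (Z x)) *: hF Y x - (etaV x (Y x) * etaV x (Z x)) *: hF X x
  + (metV x (hF X x) (Z x) * etaV x (Y x)) *: xi A x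
  - (metV x (hF Y x) (Z x) * etaV x (X x)) *: xi A x.

End Coordinates.

(* In the transformation laws, ['D_u tau x] is the image of the vector u under
   the differential at x of the change of coordinates tau. *)
Record acm_structure (R : realType) (m : nat) (M : manifold R m) :=
  ACMStructure {
  comps :> chart_index M -> acm_components R m;
  comps_acm : forall i, acm_axioms (comps i) (cod (charts i));
  phi_change : forall i j x u, overlap (charts i) (charts j) x ->
    let tau := transition (charts i) (charts j) in
    'D_u tau x *m phi (comps j) (tau x) = 'D_(u *m phi (comps i) x) tau x;
  xi_change : forall i j x, overlap (charts i) (charts j) x ->
    let tau := transition (charts i) (charts j) in
    xi (comps j) (tau x) = 'D_(xi (comps i) x) tau x;
  eta_change : forall i j x u, overlap (charts i) (charts j) x ->
    let tau := transition (charts i) (charts j) in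
    etaV (comps j) (tau x) ('D_u tau x) = etaV (comps i) x u;
  met_change : forall i j x u v, overlap (charts i) (charts j) x ->
    let tau := transition (charts i) (charts j) in
    metV (comps j) (tau x) ('D_u tau x) ('D_v tau x) = metV (comps i) x u v }.

(* All the identities below are tensorial, hence local: it is equivalent to
   require them for global vector fields or, as here, for the vector fields
   defined on each coordinate domain. *)
Section Conditions.
Variables (R : realType) (m : nat) (M : manifold R m) (A : acm_structure M).
Local Notation vec := 'rV[R]_m.+1.

Definition contact_metric : Prop :=
  forall i (X Y : vec -> vec) x,
    smooth_on (cod (charts i)) X -> smooth_on (cod (charts i)) Y ->
    cod (charts i) x ->
    deta (A i) X Y x = metV (A i) x (X x) (phiF (A i) Y x).

Definition sasakian : Prop :=
  forall i (X Y : vec -> vec) x,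
    smooth_on (cod (charts i)) X -> smooth_on (cod (charts i)) Y ->
    cod (charts i) x ->
    nabla (met (A i)) X (phiF (A i) Y) x - phiF (A i) (nabla (met (A i)) X Y) x
    = metV (A i) x (X x) (Y x) *: xi (A i) x - etaV (A i) x (Y x) *: X x.

Definition generalized_km_space_form (f1 f2 f3 f4 f5 f6 : M -> R) : Prop :=
  [/\ smooth_function f1, smooth_function f2 & smooth_function f3] /\
  [/\ smooth_function f4, smooth_function f5 & smooth_function f6] /\
  forall i (X Y Z : vec -> vec) x,
    smooth_on (cod (charts i)) X -> smooth_on (cod (charts i)) Y ->
    smooth_on (cod (charts i)) Z -> cod (charts i) x ->
    let p := param (charts i) x in
    curv (met (A i)) X Y Z x =
      f1 p *: R1 (A i) X Y Z x + f2 p *: R2 (A i) X Y Z x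
      + f3 p *: R3 (A i) X Y Z x + f4 p *: R4 (A i) X Y Z x
      + f5 p *: R5 (A i) X Y Z x + f6 p *: R6 (A i) X Y Z x.

Definition km_space (kappa mu : R) : Prop :=
  contact_metric /\
  forall i (X Y : vec -> vec) x,
    smooth_on (cod (charts i)) X -> smooth_on (cod (charts i)) Y ->
    cod (charts i) x ->
    curv (met (A i)) X Y (xi (A i)) x =
      kappa *: (etaV (A i) x (Y x) *: X x - etaV (A i) x (X x) *: Y x)
      + mu *: (etaV (A i) x (Y x) *: hF (A i) X x
               - etaV (A i) x (X x) *: hF (A i) Y x).

(* The plane at x is spanned by X x, a unit vector orthogonal to xi, and by
   phi (X x); K(X, phi X) = g(R(X, phi X) phi X, X). *)
Definition constant_phi_sectional_curvature (c : R) : Prop :=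
  forall i (X : vec -> vec) x,
    smooth_on (cod (charts i)) X -> cod (charts i) x ->
    metV (A i) x (X x) (X x) = 1 -> metV (A i) x (X x) (xi (A i) x) = 0 ->
    metV (A i) x
      (curv (met (A i)) X (phiF (A i) X) (phiF (A i) X) x) (X x) = c.

End Conditions.

(* Main.v *)
(* Write B = nabla xi = S - phi, so that h = phi S.  The contact condition makes S
   symmetric and anticommuting with phi.  With kappa = f1 - f3 and mu = f4 - f6
   the curvature identity for R(X,Y)xi gives S^2 = 1 - kappa on horizontal
   vectors together with a Codazzi equation relating nabla S and nabla phi.
   Where kappa <> 1 the antisymmetry and the cyclicity of g((nabla_X phi)Y, Z)
   force nabla phi to vanish horizontally; then dkappa = 0 in dimension at least
   5, and nabla S vanishes horizontally as well.  Hence kappa is locally constant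
   off {kappa = 1}, so constant on the connected M unless kappa is identically 1,
   which is the Sasakian case.

   When kappa < 1, nabla phi and nabla S are explicit, and the Ricci identities
   for phi and S express how far R is from commuting with them.  Evaluating them
   on two eigenvectors e, e' of h with e' orthogonal to e and phi e yields linear
   equations that determine f1, ..., f6.  Conversely, the difference between R and
   the expected tensor is a curvature-like tensor that vanishes when an argument is
   xi, commutes with phi on horizontal vectors by the Ricci identity for phi, and
   has zero phi-sectional curvature; by the polarization used for Kaehler manifolds
   it is zero. *)

Require Import Defs.
From mathcomp Require Import all_boot all_order all_algebra.
From mathcomp Require Import all_classical all_reals all_analysis.
From mathcomp Require Import ring lra.

Set Implicit Arguments.
Unset Strict Implicit.
Unset Printing Implicit Defensive.

Import Order.TTheory GRing.Theory Num.Theory.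
Import numFieldNormedType.Exports.

Local Open Scope classical_set_scope.
Local Open Scope ring_scope.

(** * Smooth maps on an open set *)

(** Vector fields are eliminated early: in a chart the connection is a matrix-valued function, and
    each tensor identity is tested on constant vectors at one point. Matrices act on rows from the
    right, so products are read from left to right: [u *m S_mx A x *m phi A x] is phi (S u). The
    obstacle is at second order, where derivatives of h and of mu threaten to appear. They drop out
    because the Ricci identities are tested on horizontal vectors only: every term of the explicit
    nabla phi and nabla S carries a factor eta or xi, and a derivative survives only if it falls on
    that factor. The skew part of the derivative of eta is d eta, which is how mu remains in the
    identity for S. The constants come from the final linear system: f4 = 1 gives mu = 1 - f6, then
    2 f2 = - mu and f1 = f2 + 1, and 4 f1 - 3 = - kappa - mu yields kappa = - f6. The phi-sectional
    curvature of the model is f1 + 3 f2 = 2 f6 - 1, because the terms in h cancel when h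
    anticommutes with phi. The dimension enters only through the existence of a nonzero vector
    satisfying three linear conditions. *)

Section NearEq.
Variables (R : realType) (V E : normedModType R).

(** The difference [d] vanishes near [x], so the zero map is its differential there, and
    [g = d + f]. *)
Lemma near_eq_differentiable (f g : V -> E) (x : V) :
  (\forall y \near x, f y = g y) -> differentiable f x -> differentiable g x.
Proof.
move=> fg df; have gf : f x = g x by exact: nbhs_singleton fg.
pose d : V -> E := g - f.
have d0 : d \o shift x = cst (d x) + (0 : V -> E) +o_ 0 id.
  apply/eqaddoP => _/posnumP[e]; near=> h.
  rewrite !fctE /= /d !fctE gf subrr addr0 subr0.
  have -> : f (h + x) = g (h + x).
    near: h.
    have sx : h + x @[h --> (0 : V)] --> 0 + x by apply: cvgD; [exact: cvg_id|exact: cvg_cst].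
    by rewrite add0r in sx; exact: sx _ fg.
  by rewrite subrr normr0 mulr_ge0.
have -> : g = d + f by apply/funext => y; rewrite /d !fctE subrK.
apply: differentiableD => //.
have c0 : continuous (\0 : V -> E) by exact: cst_continuous.
by apply/diff_locallyP; rewrite (diff_unique c0 d0).
Unshelve. all: by end_near. Qed.

End NearEq.

Section SmoothCalculus.
Variables (R : realType) (m : nat) (W : set 'rV[R]_m.+1).
Hypothesis Wo : open W.
Local Notation vec := 'rV[R]_m.+1.

Let nearW (x : vec) : W x -> \forall y \near x, W y.
Proof. by move=> Wx; apply: open_nbhs_nbhs. Qed.

Lemma derive_eq_on (E : normedModType R) (f g : vec -> E) (v x : vec) :
  {in W, f =1 g} -> W x -> 'D_v f x = 'D_v g x.
Proof.
move=> fg Wx; apply: near_eq_derive.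
by apply: filterS (nearW Wx) => y Wy; apply: fg; rewrite inE.
Qed.

Lemma differentiable_eq_on (E : normedModType R) (f g : vec -> E) (x : vec) :
  {in W, f =1 g} -> W x -> differentiable f x -> differentiable g x.
Proof.
move=> fg Wx; apply: near_eq_differentiable.
by apply: filterS (nearW Wx) => y Wy; apply: fg; rewrite inE.
Qed.

(** Peels off the derivative taken first, which is the last entry of the list in [smooth_on];
    derivatives of order up to and including [k] are differentiable. The finite order allows
    inductions in which the Leibniz rule introduces new functions. *)
Fixpoint Ck (E : normedModType R) (k : nat) (f : vec -> E) : Prop :=
  (forall x, W x -> differentiable f x) /\
  if k is k'.+1 then forall v : vec, Ck k' (fun y => 'D_v f y) else True.

Lemma smooth_onP (E : normedModType R) (f : vec -> E) :
  smooth_on W f <-> forall k, Ck k f.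
Proof.
split=> [sf k|Cf vs].
  elim: k f sf => [|k IH] f sf /=; (split=> [|//]; first exact: (sf [::])).
  move=> v; apply: IH => vs x Wx.
  by have := sf (rcons vs v) x Wx; rewrite -cats1 foldr_cat.
elim/last_ind: vs f Cf => [|vs v IH] f Cf x Wx; first exact: (Cf 0%N).1.
rewrite -cats1 foldr_cat /=; apply: (IH _ _ x Wx) => k.
exact: (Cf k.+1).2.
Qed.

Lemma Ck_eq (E : normedModType R) (k : nat) (f g : vec -> E) :
  {in W, f =1 g} -> Ck k f -> Ck k g.
Proof.
elim: k f g => [|k IH] f g fg /= [df Cf]; (split=> [x Wx|//];
  first exact: differentiable_eq_on fg Wx (df x Wx)).
move=> v; apply: IH (Cf v) => x /[!inE] Wx; exact: derive_eq_on.
Qed.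

Lemma CkS (E : normedModType R) (k : nat) (f : vec -> E) : Ck k.+1 f -> Ck k f.
Proof.
elim: k f => [|k IH] f [df Cf]; split=> // v; exact: IH (Cf v).
Qed.

Lemma Ck_cst (E : normedModType R) (k : nat) (c : E) : Ck k (cst c).
Proof.
elim: k c => [|k IH] c /=; split=> // v.
apply: Ck_eq (IH 0) => x _ /=.
by rewrite derive_cst.
Qed.

Lemma CkD (E : normedModType R) (k : nat) (f g : vec -> E) :
  Ck k f -> Ck k g -> Ck k (f + g).
Proof.
elim: k f g => [|k IH] f g /= [df Cf] [dg Cg]; (split=> [x Wx|//];
  first exact: differentiableD (df x Wx) (dg x Wx)).
move=> v; apply: Ck_eq (IH _ _ (Cf v) (Cg v)) => x /[!inE] Wx.
by rewrite deriveD//; [exact/diff_derivable/df|exact/diff_derivable/dg].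
Qed.

Lemma CkM (k : nat) (f g : vec -> R) :
  @Ck R^o k f -> @Ck R^o k g -> @Ck R^o k (f * g).
Proof.
elim: k f g => [|k IH] f g /= [df Cf] [dg Cg]; (split=> [x Wx|//];
  first exact: differentiableM (df x Wx) (dg x Wx)).
move=> v; have C1 : @Ck R^o k g by apply: CkS; split.
have C2 : @Ck R^o k f by apply: CkS; split.
apply: Ck_eq (CkD (IH _ _ C2 (Cg v)) (IH _ _ C1 (Cf v))) => x /[!inE] Wx.
by rewrite deriveM//; [exact/diff_derivable/df|exact/diff_derivable/dg].
Qed.

(** The derivative of 1/f is - (1/f) (1/f) f', a product to whose factors the induction on [k]
    applies. *)
Lemma CkV (k : nat) (f : vec -> R) :
  (forall x, W x -> f x != 0) ->
  @Ck R^o k f -> @Ck R^o k (fun x => (f x)^-1).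
Proof.
move=> f0; elim: k f f0 => [|k IH] f f0 /= [df Cf]; (split=> [x Wx|//];
  first exact: differentiableV (df x Wx) (f0 x Wx)).
move=> v; have C1 : @Ck R^o k f by apply: CkS; split.
have C2 := CkM (@Ck_cst R^o k (-1)) (CkM (CkM (IH f f0 C1) (IH f f0 C1)) (Cf v)).
apply: Ck_eq C2 => x /[!inE] Wx.
rewrite deriveV ?f0//; last exact/diff_derivable/df.
rewrite !fctE -exprVn expr2 mulN1r scaleNr; congr (- _).
Qed.

Section Closure.
Variable E : normedModType R.

Lemma smooth_on_eq (f g : vec -> E) :
  {in W, f =1 g} -> smooth_on W f -> smooth_on W g.
Proof. by move=> fg /smooth_onP Cf; apply/smooth_onP => k; exact: Ck_eq fg _. Qed.

Lemma smooth_cst (c : E) : smooth_on W (fun=> c).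
Proof. by apply/smooth_onP => k; exact: Ck_cst. Qed.

Lemma smoothD (f g : vec -> E) :
  smooth_on W f -> smooth_on W g -> smooth_on W (fun x => f x + g x).
Proof. by move=> /smooth_onP Cf /smooth_onP Cg; apply/smooth_onP => k; exact: CkD. Qed.

Lemma smooth_derive (f : vec -> E) (v : vec) :
  smooth_on W f -> smooth_on W (fun x => 'D_v f x).
Proof. by move=> /smooth_onP Cf; apply/smooth_onP => k; exact: (Cf k.+1).2. Qed.

Lemma smooth_differentiable (f : vec -> E) (x : vec) :
  smooth_on W f -> W x -> differentiable f x.
Proof. by move=> sf; exact: (sf [::]). Qed.

Lemma smooth_derivable (f : vec -> E) (x v : vec) :
  smooth_on W f -> W x -> derivable f x v.
Proof. by move=> sf Wx; exact/diff_derivable/smooth_differentiable. Qed.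

End Closure.

Lemma smoothM (f g : vec -> R) : smooth_on W (f : _ -> R^o) ->
  smooth_on W (g : _ -> R^o) -> smooth_on W (fun x => f x * g x : R^o).
Proof. by move=> /smooth_onP Cf /smooth_onP Cg; apply/smooth_onP => k; exact: CkM. Qed.

Lemma smoothV (f : vec -> R) : (forall x, W x -> f x != 0) ->
  smooth_on W (f : _ -> R^o) -> smooth_on W (fun x => (f x)^-1 : R^o).
Proof. by move=> f0 /smooth_onP Cf; apply/smooth_onP => k; exact: CkV. Qed.

Lemma smooth_sum (E : normedModType R) (I : Type) (r : seq I) (P : pred I)
    (F : I -> vec -> E) :
  (forall i, smooth_on W (F i)) -> smooth_on W (fun x => \sum_(i <- r | P i) F i x).
Proof.
move=> sF; elim: r => [|i r IH].
  by apply: smooth_on_eq (smooth_cst 0) => x _; rewrite big_nil.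
have [Pi|Pi] := boolP (P i).
  by apply: smooth_on_eq (smoothD (sF i) IH) => x _; rewrite big_cons Pi.
by apply: smooth_on_eq IH => x _; rewrite big_cons (negbTE Pi).
Qed.

Lemma smooth_prod (I : Type) (r : seq I) (F : I -> vec -> R) :
  (forall i, smooth_on W (F i : _ -> R^o)) ->
  smooth_on W (fun x => \prod_(i <- r) F i x : R^o).
Proof.
move=> sF; elim: r => [|i r IH].
  by apply: smooth_on_eq (smooth_cst (1 : R^o)) => x _; rewrite big_nil.
by apply: smooth_on_eq (smoothM (sF i) IH) => x _; rewrite big_cons.
Qed.

Section MatrixValued.
Variables (p q : nat).
Local Notation mx := 'M[R]_(p.+1, q.+1).

Lemma differentiable_mxP (M : vec -> mx) (x : vec) :
  differentiable M x <-> forall i j, differentiable (fun y => M y i j : R^o) x.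
Proof.
split=> [dM i j|dM].
  exact: (differentiable_comp dM (differentiable_coord _ i j)).
have -> : M = \sum_i \sum_j (fun y => (M y i j : R) *: delta_mx i j).
  apply/funext => y; rewrite fct_sumE [LHS]matrix_sum_delta.
  by apply: eq_bigr => i _; rewrite fct_sumE.
apply: differentiable_sum => i; apply: differentiable_sum => j.
exact: (@differentiableZl _ _ _ (fun y => M y i j : R)).
Qed.

Lemma derive_mxE (M : vec -> mx) (x v : vec) i j : derivable M x v ->
  ('D_v M x) i j = 'D_v (fun y => M y i j : R^o) x.
Proof. by move=> dM; rewrite derive_mx// mxE. Qed.

Lemma Ck_mxP (k : nat) (M : vec -> mx) :
  Ck k M <-> forall i j, @Ck R^o k (fun x => M x i j).
Proof.
elim: k M => [|k IH] M; split.
- by move=> [dM _] i j; split=> // x Wx; exact: ((differentiable_mxP _ _).1 (dM x Wx) i j).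
- by move=> CM; split=> // x Wx; apply/differentiable_mxP => i j; exact: (CM i j).1.
- move=> [dM CM] i j; split.
    by move=> x Wx; exact: ((differentiable_mxP _ _).1 (dM x Wx) i j).
  move=> v; have /IH/(_ i j) := CM v; apply: Ck_eq => x /[!inE] Wx.
  exact/derive_mxE/diff_derivable/dM.
- move=> CM; have dM x : W x -> differentiable M x.
    by move=> Wx; apply/differentiable_mxP => i j; exact: (CM i j).1.
  split=> // v; apply/IH => i j; apply: Ck_eq ((CM i j).2 v) => x /[!inE] Wx.
  exact/esym/derive_mxE/diff_derivable/dM.
Qed.

Lemma smooth_mxP (M : vec -> mx) :
  smooth_on W M <-> forall i j, smooth_on W (fun x => M x i j : R^o).
Proof.
split=> [/smooth_onP CM i j|CM]; apply/smooth_onP => k.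
  exact: ((Ck_mxP k M).1 (CM k) i j).
by apply/Ck_mxP => i j; exact: ((smooth_onP _).1 (CM i j) k).
Qed.

Lemma smoothZ (f : vec -> R) (M : vec -> mx) :
  smooth_on W (f : _ -> R^o) -> smooth_on W M -> smooth_on W (fun x => f x *: M x).
Proof.
move=> sf /smooth_mxP sM; apply/smooth_mxP => i j.
by apply: smooth_on_eq (smoothM sf (sM i j)) => x _; rewrite mxE.
Qed.

Lemma smoothN (M : vec -> mx) : smooth_on W M -> smooth_on W (fun x => - M x).
Proof.
move=> sM; apply: smooth_on_eq (smoothZ (smooth_cst (-1 : R^o)) sM) => x _.
by rewrite scaleN1r.
Qed.

Lemma smoothB (M N : vec -> mx) :
  smooth_on W M -> smooth_on W N -> smooth_on W (fun x => M x - N x).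
Proof. by move=> sM sN; apply: smoothD => //; exact: smoothN. Qed.

End MatrixValued.

Lemma smooth_trmx (p q : nat) (M : vec -> 'M[R]_(p.+1, q.+1)) :
  smooth_on W M -> smooth_on W (fun x => (M x)^T).
Proof.
move=> /smooth_mxP sM; apply/smooth_mxP => i j.
by apply: smooth_on_eq (sM j i) => x _; rewrite mxE.
Qed.

Lemma smooth_mulmx (p q r : nat) (M : vec -> 'M[R]_(p.+1, q.+1))
    (N : vec -> 'M[R]_(q.+1, r.+1)) :
  smooth_on W M -> smooth_on W N -> smooth_on W (fun x => M x *m N x).
Proof.
move=> /smooth_mxP sM /smooth_mxP sN; apply/smooth_mxP => i j.
have s := smooth_sum (index_enum 'I_q.+1) xpredT (fun k => smoothM (sM i k) (sN k j)).
by apply: smooth_on_eq s => x _; rewrite mxE.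
Qed.

Lemma smooth_det (p : nat) (M : vec -> 'M[R]_p) :
  (forall i j, smooth_on W (fun x => M x i j : R^o)) ->
  smooth_on W (fun x => \det (M x) : R^o).
Proof.
move=> sM; apply: (@smooth_sum R^o) => s.
apply: smoothM; first exact: smooth_cst.
by apply: smooth_prod => i; exact: sM.
Qed.

Lemma smooth_invmx (p : nat) (M : vec -> 'M[R]_p.+1) :
  (forall x, W x -> M x \in unitmx) -> smooth_on W M ->
  smooth_on W (fun x => invmx (M x)).
Proof.
move=> uM /smooth_mxP sM.
have sdet := smooth_det sM.
have d0 x : W x -> \det (M x) != 0 by move=> /uM; rewrite unitmxE unitfE.
have sadj : smooth_on W (fun x => \adj (M x)).
  apply/smooth_mxP => i j.
  have sc : smooth_on W (fun x => cofactor (M x) j i : R^o).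
    apply: smoothM; first exact: smooth_cst.
    apply: smooth_det => k l.
    by apply: smooth_on_eq (sM (lift j k) (lift i l)) => x _; rewrite !mxE.
  by apply: smooth_on_eq sc => x _; rewrite mxE.
have s := smoothZ (smoothV d0 sdet) sadj.
by apply: smooth_on_eq s => x /[!inE] Wx; rewrite /invmx uM.
Qed.

End SmoothCalculus.

(** * Mean value theorem along lines and symmetry of second derivatives *)

Section MeanValue.
Variables (R : realType) (V : normedModType R).

Lemma is_derive_line (f : V -> R^o) (x u : V) (s : R) :
  derivable f (s *: u + x) u ->
  is_derive s 1 (fun t : R => f (t *: u + x)) ('D_u f (s *: u + x)).
Proof.
have E : (fun h : R => h^-1 *: (((fun t : R => f (t *: u + x)) \o shift s) (h *: 1) -
            f (s *: u + x))) =
    (fun h => h^-1 *: ((f \o shift (s *: u + x)) (h *: u) - f (s *: u + x))).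
  apply/funext => h /=; congr (_ *: (f _ - _)).
  by rewrite [h%:A]mulr1 scalerDl addrA.
by move=> df; apply: DeriveDef; [rewrite /derivable E|rewrite /derive E].
Qed.

Lemma mvt_line (f df : R -> R^o) (h : R) : 0 < h ->
  (forall t, 0 <= t <= h -> is_derive t 1 f (df t)) ->
  exists2 c, 0 <= c <= h & f h - f 0 = df c * h.
Proof.
move=> h0 dfE.
have [||c] := @MVT R f df 0 h h0.
- by move=> t; rewrite in_itv /= => /andP[a b]; apply: dfE; rewrite !ltW.
- apply: derivable_within_continuous => t; rewrite in_itv /= => tI.
  by have [] := dfE _ tI.
rewrite in_itv /= => /andP[a b]; rewrite subr0 => E.
by exists c => //; rewrite !ltW.
Qed.

End MeanValue.

Section Schwarz.
Variables (R : realType) (m : nat) (W : set 'rV[R]_m.+1).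
Hypothesis Wo : open W.
Local Notation vec := 'rV[R]_m.+1.

(** The mean value theorem is used along [u], for the difference of [f] between two opposite edges,
    and then along [v]. The corner [z] is a variable with an equation so that both orders of
    differentiation can name the same corner. *)
Lemma mixed_difference (f : vec -> R^o) (x u v z : vec) (h : R) : 0 < h ->
  z = h *: u + (h *: v + x) -> smooth_on W f ->
  (forall s t, 0 <= s <= h -> 0 <= t <= h -> W (s *: u + (t *: v + x))) ->
  exists y, (exists c d, [/\ 0 <= c <= h, 0 <= d <= h & y = c *: u + (d *: v + x)]) /\
    f z - f (h *: u + x) - (f (h *: v + x) - f x) =
    'D_v (fun y => 'D_u f y) y * h * h.
Proof.
move=> h0 -> sf Wbox.
have hh : 0 <= h <= h by rewrite lexx ltW.
have zh : 0 <= (0 : R) <= h by rewrite lexx ltW.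
have [|c cI Ec] := @mvt_line R
    (fun s => f (s *: u + (h *: v + x)) - f (s *: u + (0 *: v + x)))
    (fun s => 'D_u f (s *: u + (h *: v + x)) - 'D_u f (s *: u + (0 *: v + x))) h h0.
  move=> s sI.
  have D1 := is_derive_line (smooth_derivable sf (Wbox _ _ sI hh)).
  have D2 := is_derive_line (smooth_derivable sf (Wbox _ _ sI zh)).
  exact: is_deriveB D1 D2.
have [|d dI Ed] := @mvt_line R
    (fun t => 'D_u f (t *: v + (c *: u + x)))
    (fun t => 'D_v (fun y => 'D_u f y) (t *: v + (c *: u + x))) h h0.
  move=> t tI; apply: is_derive_line.
  by rewrite addrCA; exact: smooth_derivable (smooth_derive _ sf) (Wbox _ _ cI tI).
exists (c *: u + (d *: v + x)); split; first by exists c, d.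
move: Ec Ed; rewrite !scale0r !add0r ![c *: u + (_ + x)]addrCA => -> ->.
by [].
Qed.

Lemma schwarz_scalar (f : vec -> R^o) (x u v : vec) : smooth_on W f -> W x ->
  'D_u (fun y => 'D_v f y) x = 'D_v (fun y => 'D_u f y) x.
Proof.
have aux (a b c d p q h : R) : h != 0 ->
    a - b - (c - d) = p * h * h -> a - c - (b - d) = q * h * h -> p = q.
  move=> h0 E1 E2; apply: (mulIf h0); apply: (mulIf h0).
  by rewrite -E1 -E2; ring.
have aux2 (a b y : R) :
    `|a - y| < `|a - b| / 2 -> `|b - y| < `|a - b| / 2 -> false.
  move=> a1 a2; suff : `|a - b| < `|a - b| by rewrite ltxx.
  rewrite [ltRHS]splitr; have {1}-> : a - b = (a - y) - (b - y) by ring.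
  by apply: (le_lt_trans (ler_normB _ _)); exact: ltrD.
move=> sf Wx; apply/eqP; rewrite eq_sym -subr_eq0; apply: contraT => AB.
set A := 'D_v _ x in AB; set B := 'D_u _ x in AB.
pose e := `|A - B| / 2.
have e0 : 0 < e by rewrite divr_gt0 // normr_gt0.
have cont w z : {for x, continuous (fun y => 'D_w (fun y' => 'D_z f y') y)}.
  apply: differentiable_continuous.
  exact: smooth_differentiable (smooth_derive _ (smooth_derive _ sf)) Wx.
have nA : \forall y \near x, `|A - 'D_v (fun y' => 'D_u f y') y| < e.
  by have /cvgrPdist_lt := cont v u; apply.
have nB : \forall y \near x, `|B - 'D_u (fun y' => 'D_v f y') y| < e.
  by have /cvgrPdist_lt := cont u v; apply.
have nW : \forall y \near x, W y by apply: open_nbhs_nbhs.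
have nABW : nbhs x ([set y | `|A - 'D_v (fun y' => 'D_u f y') y| < e] `&`
                    [set y | `|B - 'D_u (fun y' => 'D_v f y') y| < e] `&` W).
  by apply: filterI nW; exact: filterI nA nB.
have [r /= r0 rP] := (nbhs_ballP _ _).1 nABW.
(* The summand 1 keeps [N] positive when [u = v = 0]; a box of side [r / (2 * N)] stays within
   [r / 2] of [x]. *)
pose N := `|u| + `|v| + 1.
have N0 : 0 < N by rewrite ltr_wpDl // addr_ge0.
pose h := r / (2 * N).
have h0 : 0 < h by rewrite divr_gt0 // mulr_gt0.
have inball s t : 0 <= s <= h -> 0 <= t <= h -> ball x r (s *: u + (t *: v + x)).
  move=> /andP[s0 sh] /andP[t0 th]; rewrite -ball_normE /ball_ /= addrA opprD addrCA subrr addr0.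
  rewrite normrN (le_lt_trans (ler_normD _ _)) // !normrZ !ger0_norm //.
  have hN : h * N = r / 2 by rewrite /h; field; rewrite lt0r_neq0.
  apply: (@le_lt_trans _ _ (h * N)); last by rewrite hN; lra.
  rewrite /N !mulrDr mulr1; have := ler_wpM2r (normr_ge0 u) sh.
  by have := ler_wpM2r (normr_ge0 v) th; lra.
have inW s t sI tI := (rP _ (inball s t sI tI)).2.
have inW' s t : 0 <= s <= h -> 0 <= t <= h -> W (s *: v + (t *: u + x)).
  by move=> sI tI; rewrite addrCA; exact: inW.
(* One second difference of [f] is written through each mixed derivative, at points where these are
   within [e] of their values at [x]. *)
have [y1 [[c [d [cI dI y1E]]] E1]] := mixed_difference h0 erefl sf inW.
have [y2 [[c' [d' [cI' dI' y2E]]] E2]] := mixed_difference h0 (addrCA _ _ _) sf inW'.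
have [[a1 _] _] := rP _ (inball c d cI dI).
have [[_ a2] _] := rP _ (inball d' c' dI' cI').
rewrite -y1E in a1; rewrite addrCA -y2E /= in a2.
have E := aux _ _ _ _ _ _ h (lt0r_neq0 h0) E1 E2.
rewrite /= -E in a2.
exact: aux2 a1 a2.
Qed.

Lemma schwarz (p q : nat) (F : vec -> 'M[R]_(p.+1, q.+1)) (x u v : vec) :
  smooth_on W F -> W x ->
  'D_u (fun y => 'D_v F y) x = 'D_v (fun y => 'D_u F y) x.
Proof.
move=> sF Wx; apply/matrixP => i j.
have sFij := (smooth_mxP Wo _).1 sF i j.
have aux w z : ('D_w (fun y => 'D_z F y) x) i j =
               'D_w (fun y => 'D_z (fun y' => F y' i j : R^o) y) x.
  rewrite (@derive_mxE _ _ _ _ (fun y => 'D_z F y)).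
    apply: (derive_eq_on Wo) => // y /[!inE] Wy.
    exact: derive_mxE (smooth_derivable sF Wy).
  exact: (smooth_derivable (smooth_derive _ sF) Wx).
exact: etrans (aux u v) (etrans (schwarz_scalar u v sFij Wx) (esym (aux v u))).
Qed.

Lemma near_constant (f : vec -> R^o) (x : vec) : W x -> smooth_on W f ->
  (forall y u, W y -> 'D_u f y = 0) -> \forall y \near x, f y = f x.
Proof.
move=> Wx sf df0.
have nW : \forall y \near x, W y by apply: open_nbhs_nbhs.
have [r /= r0 rP] := (nbhs_ballP _ _).1 nW.
apply/nbhs_ballP; exists r => //= y xy.
have inball t : 0 <= t <= 1 -> W (t *: (y - x) + x).
  move=> /andP[t0 t1]; apply: rP.
  move: xy; rewrite -ball_normE /ball_ /= opprD addrCA subrr addr0 normrN normrZ ger0_norm//.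
  by rewrite -normrN opprB; apply: le_lt_trans; rewrite ler_piMl.
have [|c cI] := @mvt_line R (fun t => f (t *: (y - x) + x))
    (fun t => 'D_(y - x) f (t *: (y - x) + x)) 1 ltr01.
  by move=> t /inball Wt; apply: is_derive_line; exact: smooth_derivable sf Wt.
rewrite df0 ?mul0r; last exact: inball.
by rewrite scale1r scale0r subrK add0r => /eqP; rewrite subr_eq0 => /eqP.
Qed.

End Schwarz.

(** * Matrix-valued maps *)

Section MatrixAlgebra.
Variable R : realType.

Lemma addmxE (p q : nat) (A B : 'M[R]_(p, q)) i j : (A + B) i j = A i j + B i j.
Proof. by rewrite mxE. Qed.

Lemma oppmxE (p q : nat) (A : 'M[R]_(p, q)) i j : (- A) i j = - A i j.
Proof. by rewrite mxE. Qed.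

Lemma scalemxE (p q : nat) (a : R) (A : 'M[R]_(p, q)) i j : (a *: A) i j = a * A i j.
Proof. by rewrite mxE. Qed.

Lemma zeromxE (p q : nat) i j : (0 : 'M[R]_(p, q)) i j = 0.
Proof. by rewrite mxE. Qed.

Lemma trmxD (p q : nat) (A B : 'M[R]_(p, q)) : (A + B)^T = A^T + B^T.
Proof. exact: linearD. Qed.

Lemma trmxN (p q : nat) (A : 'M[R]_(p, q)) : (- A)^T = - A^T.
Proof. exact: linearN. Qed.

Lemma mulmx_row_inj (p q : nat) (A B : 'M[R]_(p, q)) :
  (forall v : 'rV_p, v *m A = v *m B) -> A = B.
Proof. by move=> AB; apply/row_matrixP => i; rewrite !rowE. Qed.

(** Defined for every map [L], so that smoothness can be treated apart from linearity; it represents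
    [L] once [L] is linear. *)
Definition mx_of_rows (p q : nat) (L : 'rV[R]_p -> 'rV[R]_q) : 'M[R]_(p, q) :=
  \sum_k delta_mx k 0 *m L (delta_mx 0 k).

Lemma mul_mx_of_rows (p q : nat) (L : 'rV[R]_p -> 'rV[R]_q) (v : 'rV[R]_p) :
  (L v = \sum_k v 0 k *: L (delta_mx 0 k)) -> v *m mx_of_rows L = L v.
Proof.
move=> ->; rewrite /mx_of_rows mulmx_sumr; apply: eq_bigr => k _.
rewrite mulmxA; have -> : v *m delta_mx k 0 = (v 0 k)%:M.
  by rewrite -colE; apply/matrixP => i j; rewrite !ord1 !mxE mulr1n.
by rewrite mul_scalar_mx.
Qed.

End MatrixAlgebra.

(** Distributes products and passes to entries, where each noncommutative monomial is an atom for
    [ring]. *)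
Ltac mx_ring :=
  rewrite -?scalemxAl -?scalemxAr
    ?(mulmxDl, mulmxDr, mulNmx, mulmxN, mulmxA, opprD, opprK);
  rewrite -?scalemxAl -?scalemxAr ?mulmxA;
  apply/matrixP => ? ?; rewrite ?(addmxE, oppmxE, scalemxE, zeromxE); ring.

Section MatrixCalculus.
Variables (R : realType) (m : nat) (W : set 'rV[R]_m.+1).
Hypothesis Wo : open W.
Local Notation vec := 'rV[R]_m.+1.

Lemma smooth_mx_of_rows (p q : nat) (L : vec -> 'rV[R]_p.+1 -> 'rV[R]_q.+1) :
  (forall v, smooth_on W (fun y => L y v)) ->
  smooth_on W (fun y => mx_of_rows (L y)).
Proof.
move=> sL; apply: (smooth_sum Wo) => k.
by apply: (smooth_mulmx Wo) => //; exact: (smooth_cst Wo).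
Qed.

Lemma derive_mulmx (p q r : nat) (F : vec -> 'M[R]_(p.+1, q.+1))
    (N : vec -> 'M[R]_(q.+1, r.+1)) (x u : vec) :
  smooth_on W F -> smooth_on W N -> W x ->
  'D_u (fun y => F y *m N y) x = 'D_u F x *m N x + F x *m 'D_u N x.
Proof.
move=> sF sN Wx.
by have [_] := is_derive_mulmx (smooth_derivable (v := u) sF Wx) (smooth_derivable sN Wx).
Qed.

Lemma derive_mulmxl (p q r : nat) (a : 'M[R]_(p.+1, q.+1))
    (N : vec -> 'M[R]_(q.+1, r.+1)) (x u : vec) :
  smooth_on W N -> W x -> 'D_u (fun y => a *m N y) x = a *m 'D_u N x.
Proof.
move=> sN Wx; rewrite (derive_mulmx _ (smooth_cst Wo a) sN Wx).
by rewrite (derive_cst a x u) mul0mx add0r.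
Qed.

Lemma derive_trmx (p q : nat) (F : vec -> 'M[R]_(p.+1, q.+1)) (x u : vec) :
  smooth_on W F -> W x -> 'D_u (fun y => (F y)^T) x = ('D_u F x)^T.
Proof.
by move=> sF Wx; have [_] := is_derive_trmx (smooth_derivable (v := u) sF Wx).
Qed.

Lemma deriveD_on (E : normedModType R) (F N : vec -> E) (x u : vec) :
  smooth_on W F -> smooth_on W N -> W x ->
  'D_u (fun y => F y + N y) x = 'D_u F x + 'D_u N x.
Proof. by move=> sF sN Wx; apply: deriveD; apply: smooth_derivable Wx. Qed.

Lemma deriveN_on (E : normedModType R) (F : vec -> E) (x u : vec) :
  smooth_on W F -> W x -> 'D_u (fun y => - F y) x = - 'D_u F x.
Proof. by move=> sF Wx; apply: deriveN; apply: smooth_derivable Wx. Qed.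

Lemma deriveZ_on (E : normedModType R) (F : vec -> E) (a : R) (x u : vec) :
  smooth_on W F -> W x -> 'D_u (fun y => a *: F y) x = a *: 'D_u F x.
Proof. by move=> sF Wx; apply: deriveZ; apply: smooth_derivable Wx. Qed.

Lemma deriveZf (p q : nat) (f : vec -> R) (F : vec -> 'M[R]_(p.+1, q.+1)) (x u : vec) :
  smooth_on W (f : _ -> R^o) -> smooth_on W F -> W x ->
  'D_u (fun y => f y *: F y) x = ('D_u (f : _ -> R^o) x : R) *: F x + f x *: 'D_u F x.
Proof.
move=> sf sF Wx; have sFij := (smooth_mxP Wo _).1 sF.
have dfF := smooth_derivable (v := u) (smoothZ Wo sf sF) Wx.
apply/matrixP => i j; rewrite derive_mxE//.
have -> : (fun y => (f y *: F y) i j : R^o) = (f : _ -> R^o) * (fun y => F y i j : R^o).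
  by apply/funext => y; rewrite mxE.
rewrite deriveM; [|exact: smooth_derivable sf Wx|exact: smooth_derivable (sFij i j) Wx].
rewrite addmxE !scalemxE addrC derive_mxE; last exact: smooth_derivable sF Wx.
by congr (_ + _); exact: mulrC.
Qed.

Lemma derive_linear (E : normedModType R) (F : vec -> E) (x : vec) (a : R) (u v : vec) :
  smooth_on W F -> W x -> 'D_(a *: u + v) F x = a *: 'D_u F x + 'D_v F x.
Proof.
move=> sF Wx; have dF := smooth_differentiable sF Wx.
by rewrite !deriveE// linearD linearZ.
Qed.

Lemma derive_row_sum (E : normedModType R) (F : vec -> E) (x u : vec) :
  smooth_on W F -> W x -> 'D_u F x = \sum_k u 0 k *: 'D_(delta_mx 0 k) F x.
Proof.
move=> sF Wx; have dF := smooth_differentiable sF Wx.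
rewrite deriveE// {1}(row_sum_delta u) linear_sum; apply: eq_bigr => k _.
by rewrite linearZ deriveE.
Qed.

Section Contraction.
Variables (p q : nat) (L : vec -> vec -> 'M[R]_(p.+1, q.+1)) (Y : vec -> vec).
Hypothesis sL : forall v, smooth_on W (fun y => L y v).
Hypothesis linL : forall y v, W y -> L y v = \sum_k v 0 k *: L y (delta_mx 0 k).
Hypothesis sY : smooth_on W Y.

Let sYk k : smooth_on W (fun y => Y y 0 k : R^o).
Proof. exact: ((smooth_mxP Wo _).1 sY). Qed.

(** Leibniz rule for a tensor evaluated on a varying vector; its use is the covariant derivative of
    a field in a varying direction. *)
Lemma derive_contraction (x u : vec) : W x ->
  'D_u (fun y => L y (Y y)) x = L x ('D_u Y x) + 'D_u (fun y => L y (Y x)) x.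
Proof.
move=> Wx; have dsum (F : 'I_m.+1 -> vec -> 'M[R]_(p.+1, q.+1)) :
    (forall k, smooth_on W (F k)) ->
    'D_u (fun y => \sum_k F k y) x = \sum_k 'D_u (F k) x.
  move=> sF; have -> : (fun y => \sum_k F k y) = \sum_k F k.
    by apply/funext => y; rewrite fct_sumE.
  by rewrite derive_sum// => k; apply: smooth_derivable Wx.
have sLk k := sL (delta_mx 0 k).
rewrite (@derive_eq_on _ _ _ Wo _ _ (fun y => \sum_k Y y 0 k *: L y (delta_mx 0 k)))//; last first.
  by move=> y /[!inE] Wy; rewrite -linL.
rewrite [in RHS](@derive_eq_on _ _ _ Wo _ _
  (fun y => \sum_k Y x 0 k *: L y (delta_mx 0 k)))//; last first.
  by move=> y /[!inE] Wy; rewrite -linL.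
rewrite (dsum (fun k y => Y y 0 k *: L y (delta_mx 0 k))); last first.
  by move=> k; exact: smoothZ (sYk k) (sLk k).
rewrite (dsum (fun k y => Y x 0 k *: L y (delta_mx 0 k))); last first.
  by move=> k; exact: smoothZ (smooth_cst Wo (Y x 0 k : R^o)) (sLk k).
rewrite (linL _ Wx) -big_split; apply: eq_bigr => k _ /=.
rewrite deriveZf// deriveZ_on//; congr (_ *: _ + _).
by rewrite derive_mxE//; exact: smooth_derivable sY Wx.
Qed.

End Contraction.

End MatrixCalculus.

(** * The Levi-Civita connection and its curvature in a chart *)

Section Connection.
Variables (R : realType) (m : nat) (W : set 'rV[R]_m.+1).
Hypothesis Wo : open W.
Local Notation vec := 'rV[R]_m.+1.
Local Notation mat := 'M[R]_m.+1.
Variable G : vec -> mat.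
Hypothesis sG : smooth_on W G.
Hypothesis symG : forall x, W x -> (G x)^T = G x.
Hypothesis uG : forall x, W x -> G x \in unitmx.

Let nearW (x : vec) : W x -> \forall y \near x, W y.
Proof. by move=> Wx; apply: open_nbhs_nbhs. Qed.

Let near_symG (x : vec) : W x -> \forall y \near x, (G y)^T = G y.
Proof. by move=> Wx; apply: filterS (nearW Wx) => y; exact: symG. Qed.

Fact conn_key : unit. Proof. exact: tt. Qed.

(* Locked: otherwise rewriting with linearity lemmas unfolds it. *)
Definition conn (x u : vec) : mat := locked_with conn_key
  (let N := mx_of_rows (fun v => u *m 'D_v G x) in
   2^-1 *: (('D_u G x + N - N^T) *m invmx (G x))).

Lemma connE (x u : vec) :
  let N := mx_of_rows (fun v => u *m 'D_v G x) in
  conn x u = 2^-1 *: (('D_u G x + N - N^T) *m invmx (G x)).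
Proof. by rewrite /conn locked_withE. Qed.

(** The Christoffel form is linear in [v], hence multiplication by a matrix. The term of
    [christoffel] with a free index is [v *m N^T], where [N] is the matrix inside [conn]. *)
Lemma christoffelE (x u v : vec) : W x -> christoffel G x u v = v *m conn x u.
Proof.
move=> Wx; rewrite /christoffel connE -scalemxAr; congr (_ *: _).
rewrite mulmxA !mulmxDr mulmxN; congr ((_ + _ - _) *m _).
  rewrite mul_mx_of_rows// (derive_row_sum v sG Wx) mulmx_sumr.
  by apply: eq_bigr => k _; rewrite -scalemxAr.
apply/rowP => k; rewrite mxE /mx_of_rows.
transitivity ((u *m 'D_(delta_mx 0 k) G x *m v^T)^T 0 0); first by rewrite [RHS]mxE.
have entry j (w : vec) :
    (v *m (delta_mx j 0 *m w)^T) 0 k = (v *m w^T) 0 0 * (j == k)%:R.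
  by rewrite trmx_mul trmx_delta mulmxA mxE big_ord1 [X in _ * X]mxE eqxx eq_sym.
rewrite trmx_mul trmxK linear_sum mulmx_sumr summxE (bigD1 k) //= big1 => [|j jk].
  by rewrite addr0 entry eqxx mulr1.
by rewrite entry (negbTE jk) mulr0.
Qed.

Lemma smooth_conn (u : vec) : smooth_on W (fun x => conn x u).
Proof.
have sN : smooth_on W (fun x => mx_of_rows (fun v => u *m 'D_v G x)).
  apply: (smooth_mx_of_rows Wo) => v; apply: (smooth_mulmx Wo); first exact: (smooth_cst Wo).
  exact: smooth_derive.
apply: (smooth_on_eq Wo) => [x _|]; first by rewrite connE.
apply: (smoothZ Wo); first exact: (smooth_cst Wo).
apply: (smooth_mulmx Wo); last exact: (smooth_invmx Wo).
apply: (smoothB Wo); last exact: (smooth_trmx Wo).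
by apply: (smoothD Wo) => //; exact: smooth_derive.
Qed.

Lemma conn_sym (x u v : vec) : W x -> v *m conn x u = u *m conn x v.
Proof.
move=> Wx; rewrite -!christoffelE// christoffel_sym//; first exact: near_symG.
exact: smooth_differentiable sG Wx.
Qed.

(** In the other slot linearity is that of the matrix product, and [conn_sym] exchanges the
    slots. *)
Lemma conn_linear (x u v : vec) (a : R) : W x ->
  conn x (a *: u + v) = a *: conn x u + conn x v.
Proof.
move=> Wx; apply: mulmx_row_inj => w.
rewrite (conn_sym _ w Wx) mulmxDl mulmxDr -scalemxAl -scalemxAr.
by rewrite (conn_sym u w Wx) (conn_sym v w Wx).
Qed.

Lemma conn_row_sum (x u : vec) : W x ->
  conn x u = \sum_k u 0 k *: conn x (delta_mx 0 k).
Proof.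
move=> Wx; apply: mulmx_row_inj => w.
rewrite conn_sym// {1}(row_sum_delta u) mulmx_suml mulmx_sumr; apply: eq_bigr => k _.
by rewrite -scalemxAl -scalemxAr conn_sym.
Qed.

Lemma derive_metric (x u : vec) : W x ->
  'D_u G x = conn x u *m G x + G x *m (conn x u)^T.
Proof.
move=> Wx; have dG := smooth_differentiable sG Wx.
have aux (p q a b c d : R) : p = 2^-1 * (a + b - c) -> q = 2^-1 * (d + c - b) ->
    d = a -> a = p + q by move=> -> -> ->; lra.
suff E (v w : vec) : (v *m 'D_u G x *m w^T) 0 0 =
    (v *m (conn x u *m G x + G x *m (conn x u)^T) *m w^T) 0 0.
  apply/matrixP => i j; have := E (delta_mx 0 i) (delta_mx 0 j).
  by rewrite -!rowE trmx_delta -!colE !mxE.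
have E1 := inner_christoffel u v w (symG Wx) dG (uG Wx).
have E2 := inner_christoffel u w v (symG Wx) dG (uG Wx).
have D : (w *m 'D_u G x *m v^T) 0 0 = (v *m 'D_u G x *m w^T) 0 0.
  by rewrite form_trmx derive_sym//; [exact: near_symG|exact: diff_derivable].
rewrite (aux _ _ _ _ _ _ E1 E2 D) /inner !christoffelE//.
rewrite [in X in _ + X]form_trmx symG// trmx_mul mulmxDr mulmxDl addmxE.
by rewrite !mulmxA.
Qed.

Definition cov_row (Y : vec -> vec) (x u : vec) : vec :=
  locked ('D_u Y x + Y x *m conn x u).

Definition cov_col (e : vec -> 'cV[R]_m.+1) (x u : vec) : 'cV[R]_m.+1 :=
  locked ('D_u e x - conn x u *m e x).

Definition cov_mx (F : vec -> mat) (x u : vec) : mat :=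
  locked ('D_u F x + F x *m conn x u - conn x u *m F x).

(** [w *m Riem x u v] is R(u, v) w. Rows compose from left to right, so the commutator has the
    reverse of its usual order. *)
Definition Riem (x u v : vec) : mat :=
  locked ('D_u (fun y => conn y v) x - 'D_v (fun y => conn y u) x
          + conn x v *m conn x u - conn x u *m conn x v).

Lemma cov_rowE Y x u : cov_row Y x u = 'D_u Y x + Y x *m conn x u.
Proof. by rewrite /cov_row -lock. Qed.

Lemma cov_colE e x u : cov_col e x u = 'D_u e x - conn x u *m e x.
Proof. by rewrite /cov_col -lock. Qed.

Lemma cov_mxE F x u : cov_mx F x u = 'D_u F x + F x *m conn x u - conn x u *m F x.
Proof. by rewrite /cov_mx -lock. Qed.

Lemma RiemE x u v : Riem x u v =
  'D_u (fun y => conn y v) x - 'D_v (fun y => conn y u) x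
  + conn x v *m conn x u - conn x u *m conn x v.
Proof. by rewrite /Riem -lock. Qed.

Section Leibniz.
Variables (x u : vec) (Y : vec -> vec) (e : vec -> 'cV[R]_m.+1) (F N : vec -> mat).
Hypotheses (Wx : W x) (sY : smooth_on W Y) (se : smooth_on W e).
Hypotheses (sF : smooth_on W F) (sN : smooth_on W N).

Lemma cov_mx_mul :
  cov_mx (fun y => F y *m N y) x u = cov_mx F x u *m N x + F x *m cov_mx N x u.
Proof. rewrite !cov_mxE (derive_mulmx _ sF sN Wx); mx_ring. Qed.

Lemma cov_mxD : cov_mx (fun y => F y + N y) x u = cov_mx F x u + cov_mx N x u.
Proof. rewrite !cov_mxE (deriveD_on _ sF sN Wx); mx_ring. Qed.

Lemma cov_mxN : cov_mx (fun y => - F y) x u = - cov_mx F x u.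
Proof. rewrite !cov_mxE (deriveN_on _ sF Wx); mx_ring. Qed.

Lemma cov_mxZ (f : vec -> R) : smooth_on W (f : _ -> R^o) ->
  cov_mx (fun y => f y *: F y) x u =
  ('D_u (f : _ -> R^o) x : R) *: F x + f x *: cov_mx F x u.
Proof. move=> sf; rewrite !cov_mxE (deriveZf Wo _ sf sF Wx); mx_ring. Qed.

Lemma cov_row_mul :
  cov_row (fun y => Y y *m F y) x u = cov_row Y x u *m F x + Y x *m cov_mx F x u.
Proof. rewrite !cov_rowE !cov_mxE (derive_mulmx _ sY sF Wx); mx_ring. Qed.

Lemma cov_outer :
  cov_mx (fun y => e y *m Y y) x u = cov_col e x u *m Y x + e x *m cov_row Y x u.
Proof. rewrite !cov_colE !cov_mxE !cov_rowE (derive_mulmx _ se sY Wx); mx_ring. Qed.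

Lemma cov_pairing :
  'D_u (fun y => Y y *m e y) x = cov_row Y x u *m e x + Y x *m cov_col e x u.
Proof. rewrite !cov_colE !cov_rowE (derive_mulmx _ sY se Wx); mx_ring. Qed.

Lemma cov_lower :
  cov_col (fun y => G y *m (Y y)^T) x u = G x *m (cov_row Y x u)^T.
Proof.
have sYt := smooth_trmx Wo sY.
rewrite !cov_colE !cov_rowE (derive_mulmx _ sG sYt Wx) (derive_trmx _ sY Wx).
rewrite (derive_metric _ Wx) linearD /= trmx_mul; mx_ring.
Qed.

(** Differentiates the adjunction relation; the derivative of the metric is absorbed by metric
    compatibility. It serves with [c = -1] for [phi] and [c = 1] for [S_mx]. *)
Lemma cov_adjoint (c : R) :
  (forall y, W y -> F y *m G y = c *: (G y *m (F y)^T)) ->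
  cov_mx F x u *m G x = c *: (G x *m (cov_mx F x u)^T).
Proof.
move=> FG; have sFt := smooth_trmx Wo sF.
have D : 'D_u (fun y => F y *m G y) x = 'D_u (fun y => c *: (G y *m (F y)^T)) x.
  by apply: (derive_eq_on Wo) => // y /[!inE]; exact: FG.
rewrite (deriveZ_on _ _ (smooth_mulmx Wo sG sFt) Wx) in D.
rewrite (derive_mulmx _ sF sG Wx) (derive_mulmx _ sG sFt Wx) (derive_trmx _ sF Wx) in D.
rewrite (derive_metric _ Wx) in D.
move: (FG _ Wx) D; rewrite !cov_mxE; move: ('D_u F x) (F x) (G x) (conn x u) => DF f g C.
move=> E D.
have -> : (DF + f *m C - C *m f) *m g =
    (DF *m g + f *m (C *m g + g *m C^T)) - f *m g *m C^T - C *m (f *m g) by mx_ring.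
have -> : (DF + f *m C - C *m f)^T = DF^T + C^T *m f^T - f^T *m C^T.
  by rewrite linearB linearD /= !trmx_mul.
rewrite D E; mx_ring.
Qed.

(** The directions are constant in the chart, so their bracket vanishes and no first-order term
    appears. *)
Lemma ricci_mx (v : vec) :
  cov_mx (fun y => cov_mx F y v) x u - cov_mx (fun y => cov_mx F y u) x v =
  F x *m Riem x u v - Riem x u v *m F x.
Proof.
have D w z : 'D_w (fun y => cov_mx F y z) x =
    'D_w (fun y => 'D_z F y) x +
    ('D_w F x *m conn x z + F x *m 'D_w (fun y => conn y z) x)
    - ('D_w (fun y => conn y z) x *m F x + conn x z *m 'D_w F x).
  have sC := smooth_conn z; have sD := smooth_derive z sF.
  have -> : (fun y => cov_mx F y z) = fun y => 'D_z F y + F y *m conn y z - conn y z *m F y.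
    by apply/funext => y; rewrite cov_mxE.
  have s1 := smooth_mulmx Wo sF sC; have s2 := smooth_mulmx Wo sC sF.
  rewrite (deriveD_on _ (smoothD Wo sD s1) (smoothN Wo s2) Wx) (deriveD_on _ sD s1 Wx).
  by rewrite (deriveN_on _ s2 Wx) (derive_mulmx _ sF sC Wx) (derive_mulmx _ sC sF Wx).
have E w z : cov_mx (fun y => cov_mx F y z) x w =
    'D_w (fun y => cov_mx F y z) x + cov_mx F x z *m conn x w
    - conn x w *m cov_mx F x z by exact: cov_mxE.
have aux (X a b f P Q p q : mat) :
    X + (a *m Q + f *m q) - (q *m f + Q *m a) + (b + f *m Q - Q *m f) *m P
    - P *m (b + f *m Q - Q *m f)
    - (X + (b *m P + f *m p) - (p *m f + P *m b) + (a + f *m P - P *m f) *m Q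
       - Q *m (a + f *m P - P *m f))
    = f *m (q - p + Q *m P - P *m Q) - (q - p + Q *m P - P *m Q) *m f by mx_ring.
rewrite RiemE (E u v) (E v u) (D u v) (D v u) (schwarz Wo v u sF Wx) !cov_mxE; exact: aux.
Qed.

Lemma ricci_row (v : vec) :
  cov_row (fun y => cov_row Y y v) x u - cov_row (fun y => cov_row Y y u) x v =
  Y x *m Riem x u v.
Proof.
have D w z : 'D_w (fun y => cov_row Y y z) x =
    'D_w (fun y => 'D_z Y y) x +
    ('D_w Y x *m conn x z + Y x *m 'D_w (fun y => conn y z) x).
  have sC := smooth_conn z; have sD := smooth_derive z sY.
  have -> : (fun y => cov_row Y y z) = fun y => 'D_z Y y + Y y *m conn y z.
    by apply/funext => y; rewrite cov_rowE.
  rewrite (deriveD_on _ sD (smooth_mulmx Wo sY sC) Wx).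
  by rewrite (derive_mulmx _ sY sC Wx).
have E w z : cov_row (fun y => cov_row Y y z) x w =
    'D_w (fun y => cov_row Y y z) x + cov_row Y x z *m conn x w by exact: cov_rowE.
have aux (X a b f : vec) (P Q p q : mat) :
    X + (a *m Q + f *m q) + (b + f *m Q) *m P - (X + (b *m P + f *m p) + (a + f *m P) *m Q)
    = f *m (q - p + Q *m P - P *m Q) by mx_ring.
rewrite RiemE (E u v) (E v u) (D u v) (D v u) (schwarz Wo v u sY Wx) !cov_rowE; exact: aux.
Qed.

End Leibniz.

Lemma smooth_cov_row (Y : vec -> vec) (u : vec) :
  smooth_on W Y -> smooth_on W (fun y => cov_row Y y u).
Proof.
move=> sY; apply: (smooth_on_eq Wo) => [y _|]; first by rewrite cov_rowE.
apply: (smoothD Wo); first exact: smooth_derive.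
exact: smooth_mulmx (smooth_conn u).
Qed.

Lemma cov_row_linear (Y : vec -> vec) (x u v : vec) (a : R) :
  smooth_on W Y -> W x ->
  cov_row Y x (a *: u + v) = a *: cov_row Y x u + cov_row Y x v.
Proof.
move=> sY Wx; rewrite !cov_rowE (derive_linear a u v sY Wx) (conn_linear u v a Wx).
have aux (p q y : vec) (c d : mat) :
  a *: p + q + y *m (a *: c + d) = a *: (p + y *m c) + (q + y *m d) by mx_ring.
exact: aux.
Qed.

Lemma cov_mx_linear (F : vec -> mat) (x u v : vec) (a : R) :
  smooth_on W F -> W x ->
  cov_mx F x (a *: u + v) = a *: cov_mx F x u + cov_mx F x v.
Proof.
move=> sF Wx; rewrite !cov_mxE (derive_linear a u v sF Wx) (conn_linear u v a Wx).
have aux (p q y c d : mat) :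
  a *: p + q + y *m (a *: c + d) - (a *: c + d) *m y =
  a *: (p + y *m c - c *m y) + (q + y *m d - d *m y) by mx_ring.
exact: aux.
Qed.

(** Metric compatibility turns second derivatives of [G] into first derivatives of [conn]; equating
    the two orders of differentiation leaves the skewness. *)
Lemma Riem_skew (x u v : vec) : W x ->
  Riem x u v *m G x = - (G x *m (Riem x u v)^T).
Proof.
move=> Wx.
have D w z : 'D_w (fun y => 'D_z G y) x =
    'D_w (fun y => conn y z) x *m G x + conn x z *m (conn x w *m G x + G x *m (conn x w)^T)
    + ((conn x w *m G x + G x *m (conn x w)^T) *m (conn x z)^T
       + G x *m ('D_w (fun y => conn y z) x)^T).
  have sC := smooth_conn z; have sCt := smooth_trmx Wo sC.
  rewrite (@derive_eq_on _ _ _ Wo _ _ (fun y => conn y z *m G y + G y *m (conn y z)^T)) //.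
    rewrite (deriveD_on _ (smooth_mulmx Wo sC sG) (smooth_mulmx Wo sG sCt) Wx).
    rewrite (derive_mulmx _ sC sG Wx) (derive_mulmx _ sG sCt Wx) (derive_trmx _ sC Wx).
    by rewrite -(derive_metric _ Wx).
  by move=> y /[!inE] Wy; exact: derive_metric.
have aux (a b C D' g : mat) :
    a *m g + D' *m (C *m g + g *m C^T) + ((C *m g + g *m C^T) *m D'^T + g *m a^T) =
    b *m g + C *m (D' *m g + g *m D'^T) + ((D' *m g + g *m D'^T) *m C^T + g *m b^T) ->
    (a - b + D' *m C - C *m D') *m g = - (g *m (a - b + D' *m C - C *m D')^T).
  move=> /eqP; rewrite -subr_eq0 => /eqP E; apply/eqP; rewrite -subr_eq0 -E.
  apply/eqP; rewrite ?(trmxD, trmxN, trmx_mul); mx_ring.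
rewrite RiemE; exact: aux (etrans (esym (D u v)) (etrans (schwarz Wo u v sG Wx) (D v u))).
Qed.

(** The symmetry of [conn] passes to its derivatives, which cancel in pairs; the quadratic terms
    cancel by the symmetry itself. *)
Lemma bianchi (x u v w : vec) : W x ->
  w *m Riem x u v + u *m Riem x v w + v *m Riem x w u = 0.
Proof.
move=> Wx.
have D a b c : a *m 'D_b (fun y => conn y c) x = c *m 'D_b (fun y => conn y a) x.
  have aux (p q : vec) : p *m 'D_b (fun y => conn y q) x = 'D_b (fun y => p *m conn y q) x.
    by rewrite (derive_mulmx _ (smooth_cst Wo p) (smooth_conn q) Wx) derive_cst mul0mx add0r.
  by rewrite !aux; apply: (derive_eq_on Wo) => // y /[!inE] Wy; rewrite conn_sym.
have aux (cu cv cw duv dvu dvw dwv dwu duw : mat) :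
    u *m dvw = w *m dvu -> v *m duw = w *m duv -> u *m dwv = v *m dwu ->
    w *m cv = v *m cw -> w *m cu = u *m cw -> u *m cv = v *m cu ->
    w *m (duv - dvu + cv *m cu - cu *m cv) + u *m (dvw - dwv + cw *m cv - cv *m cw)
    + v *m (dwu - duw + cu *m cw - cw *m cu) = 0.
  move=> e1 e2 e3 e4 e5 e6; rewrite !mulmxDr !mulmxN !mulmxA e1 e2 e3 e4 e5 e6; mx_ring.
rewrite !RiemE; exact: aux (D u v w) (D v u w) (D u w v)
  (conn_sym v w Wx) (conn_sym u w Wx) (conn_sym v u Wx).
Qed.

End Connection.

(** * Curvature of vector fields as a pointwise tensor *)

Section Tensoriality.
Variables (R : realType) (m : nat) (W : set 'rV[R]_m.+1).
Hypothesis Wo : open W.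
Local Notation vec := 'rV[R]_m.+1.
Local Notation mat := 'M[R]_m.+1.
Variable G : vec -> mat.
Hypothesis sG : smooth_on W G.
Hypothesis symG : forall x, W x -> (G x)^T = G x.
Hypothesis uG : forall x, W x -> G x \in unitmx.

Lemma nablaE (X Y : vec -> vec) (x : vec) : W x ->
  nabla G X Y x = cov_row G Y x (X x).
Proof. by move=> Wx; rewrite /nabla cov_rowE (christoffelE sG _ _ Wx). Qed.

Lemma cov_row_row_sum (Y : vec -> vec) (x u : vec) : smooth_on W Y -> W x ->
  cov_row G Y x u = \sum_k u 0 k *: cov_row G Y x (delta_mx 0 k).
Proof.
move=> sY Wx; rewrite !cov_rowE (derive_row_sum u sY Wx) (conn_row_sum Wo sG symG u Wx).
rewrite mulmx_sumr -big_split; apply: eq_bigr => k _ /=.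
by rewrite cov_rowE scalerDr -scalemxAr.
Qed.

Lemma cov_row_nabla (Y Z : vec -> vec) (x u : vec) :
  smooth_on W Y -> smooth_on W Z -> W x ->
  cov_row G (nabla G Y Z) x u =
  cov_row G Z x ('D_u Y x) + cov_row G (fun y => cov_row G Z y (Y x)) x u.
Proof.
move=> sY sZ Wx.
have sL v := smooth_cov_row Wo sG uG v sZ.
have linL y v (Wy : W y) := cov_row_row_sum v sZ Wy.
have E : 'D_u (nabla G Y Z) x = 'D_u (fun y => cov_row G Z y (Y y)) x.
  by apply: (derive_eq_on Wo) => // y /[!inE]; exact: nablaE.
have aux (a b c : vec) : a + b + c = a + (b + c) by rewrite addrA.
rewrite [LHS]cov_rowE [X in _ = _ + X]cov_rowE E.
rewrite (derive_contraction Wo sL linL sY u Wx) (nablaE _ _ Wx).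
exact: aux.
Qed.

(** The derivatives of [X] and [Y] produced by [cov_row_nabla] cancel against the bracket term,
    leaving the commutator of second derivatives in frozen directions. *)
Lemma curvE (X Y Z : vec -> vec) (x : vec) :
  smooth_on W X -> smooth_on W Y -> smooth_on W Z -> W x ->
  curv G X Y Z x = Z x *m Riem G x (X x) (Y x).
Proof.
move=> sX sY sZ Wx; rewrite -(ricci_row Wo sG uG _ Wx sZ) /curv.
rewrite (nablaE X _ Wx) (nablaE Y _ Wx) (nablaE _ _ Wx).
rewrite (cov_row_nabla _ sY sZ Wx) (cov_row_nabla _ sX sZ Wx) /bracket.
have -> : 'D_(X x) Y x - 'D_(Y x) X x = (-1) *: 'D_(Y x) X x + 'D_(X x) Y x.
  by rewrite scaleN1r addrC.
rewrite (cov_row_linear Wo sG symG _ _ _ sZ Wx).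
have aux (a b c d : vec) : a + b - (c + d) - (-1 *: c + a) = b - d by mx_ring.
exact: aux.
Qed.

End Tensoriality.

(** * Almost contact metric structures *)

Section AlmostContact.
Variables (R : realType) (m : nat) (W : set 'rV[R]_m.+1).
Local Notation vec := 'rV[R]_m.+1.
Local Notation mat := 'M[R]_m.+1.
Variable A : acm_components R m.
Hypothesis acmA : acm_axioms A W.
Local Notation G := (met A).
Local Notation g := (metV A).

Lemma metVDl (x u v w : vec) : g x (u + v) w = g x u w + g x v w.
Proof. by rewrite /metV /inner !mulmxDl mxE. Qed.

Lemma metVZl (x u w : vec) (a : R) : g x (a *: u) w = a * g x u w.
Proof. by rewrite /metV /inner -!scalemxAl mxE. Qed.

Lemma metVDr (x u v w : vec) : g x u (v + w) = g x u v + g x u w.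
Proof. by rewrite /metV /inner trmxD mulmxDr mxE. Qed.

Lemma metVZr (x u w : vec) (a : R) : g x u (a *: w) = a * g x u w.
Proof. by rewrite /metV /inner linearZ -scalemxAr mxE. Qed.

Lemma metVNl (x u w : vec) : g x (- u) w = - g x u w.
Proof. by rewrite -scaleN1r metVZl mulN1r. Qed.

Lemma metVNr (x u w : vec) : g x u (- w) = - g x u w.
Proof. by rewrite -scaleN1r metVZr mulN1r. Qed.

Lemma metV0l (x w : vec) : g x 0 w = 0.
Proof. by rewrite -(scale0r 0) metVZl mul0r. Qed.

Lemma metV0r (x w : vec) : g x w 0 = 0.
Proof. by rewrite -(scale0r 0) metVZr mul0r. Qed.

Lemma etaVD (x u v : vec) : etaV A x (u + v) = etaV A x u + etaV A x v.
Proof. by rewrite /etaV mulmxDl mxE. Qed.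

Lemma etaVZ (x u : vec) (a : R) : etaV A x (a *: u) = a * etaV A x u.
Proof. by rewrite /etaV -scalemxAl mxE. Qed.

Lemma etaVN (x u : vec) : etaV A x (- u) = - etaV A x u.
Proof. by rewrite -scaleN1r etaVZ mulN1r. Qed.

Lemma metV_inj (x u v : vec) : W x -> (forall w, g x u w = g x v w) -> u = v.
Proof.
move=> Wx E; apply/eqP; rewrite -subr_eq0; apply: contraT => uv.
have := met_pos acmA Wx uv.
by rewrite {1}metVDl metVNl E subrr ltxx.
Qed.

Lemma met_symmx (x : vec) : W x -> (G x)^T = G x.
Proof.
move=> Wx; apply/matrixP => i j.
have := met_sym acmA (delta_mx 0 j) (delta_mx 0 i) Wx.
by rewrite /metV /inner -!rowE !trmx_delta -!colE !mxE.
Qed.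

Lemma met_unit (x : vec) : W x -> G x \in unitmx.
Proof.
move=> Wx; rewrite -row_free_unit; apply/inj_row_free => u uG0.
apply: (metV_inj Wx) => w.
by rewrite {1}/metV /inner uG0 mul0mx mxE metV0l.
Qed.

(** For z = phi xi, phi^2 xi = 0 gives phi z = 0, so phi^2 z = 0 yields z = eta(z) xi. Applying phi
    gives eta(z) z = 0, that is eta(z)^2 xi = 0. *)
Lemma xi_phi (x : vec) : W x -> xi A x *m phi A x = 0.
Proof.
move=> Wx; have e1 := eta_xi acmA Wx.
have pp u := phi_phi acmA u Wx.
set z := xi A x *m phi A x.
have zz : z *m phi A x = 0 by rewrite /z pp e1 scale1r addNr.
have zE : etaV A x z *: xi A x = z.
  by have := pp z; rewrite zz mul0mx => /esym/eqP; rewrite addrC subr_eq0 => /eqP.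
have : etaV A x z *: (etaV A x z *: xi A x) = 0.
  by rewrite zE {2}/z scalemxAl zE.
rewrite scalerA.
move=> /(congr1 (etaV A x)); rewrite etaVZ e1 mulr1 [RHS](_ : _ = 0); last first.
  by rewrite /etaV mul0mx mxE.
by move/eqP; rewrite mulf_eq0 orbb => /eqP e0; rewrite -zE e0 scale0r.
Qed.

(** Computing phi^3 u as phi^2 (phi u) and as phi (phi^2 u) isolates eta(phi u) xi. *)
Lemma eta_phi (x u : vec) : W x -> etaV A x (u *m phi A x) = 0.
Proof.
move=> Wx; have e1 := eta_xi acmA Wx.
have := phi_phi acmA (u *m phi A x) Wx.
rewrite (phi_phi acmA u Wx) mulmxDl mulNmx -scalemxAl xi_phi// scaler0 addr0.
rewrite -{1}[- (u *m _)]addr0 => /addrI /(congr1 (etaV A x)).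
by rewrite etaVZ e1 mulr1 => <-; rewrite /etaV mul0mx mxE.
Qed.

Lemma metV_xi (x u : vec) : W x -> g x u (xi A x) = etaV A x u.
Proof.
move=> Wx; have := met_phi acmA u (xi A x) Wx.
rewrite xi_phi// metV0r (eta_xi acmA Wx) mulr1 => /esym/eqP.
by rewrite subr_eq0 => /eqP.
Qed.

Lemma metV_phi_skew (x u v : vec) : W x -> g x (u *m phi A x) v = - g x u (v *m phi A x).
Proof.
move=> Wx; have := met_phi acmA u (v *m phi A x) Wx.
rewrite (phi_phi acmA v Wx) metVDr metVNr metVZr metV_xi// !eta_phi// !mulr0 addr0 subr0.
by move=> <-; rewrite opprK.
Qed.

Lemma metV_mx (B C : mat) :
  (forall u v : vec, (u *m B *m v^T) 0 0 = (u *m C *m v^T) 0 0) -> B = C.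
Proof.
move=> E; apply/matrixP => i j; have := E (delta_mx 0 i) (delta_mx 0 j).
by rewrite trmx_delta -!rowE -!colE !mxE.
Qed.

Lemma phi_sq_mx (x : vec) : W x ->
  phi A x *m phi A x = - 1%:M + eta A x *m xi A x.
Proof.
move=> Wx; apply: mulmx_row_inj => u.
rewrite mulmxA (phi_phi acmA u Wx) mulmxDr mulmxN mulmx1 mulmxA; congr (_ + _).
by rewrite -mul_scalar_mx; congr (_ *m _); apply/matrixP => i j; rewrite !ord1 mxE eqxx mulr1n.
Qed.

Lemma eta_mx (x : vec) : W x -> eta A x = G x *m (xi A x)^T.
Proof.
move=> Wx; apply: mulmx_row_inj => u; apply/matrixP => i j; rewrite !ord1.
by have := metV_xi u Wx; rewrite /metV /inner /etaV mulmxA => ->.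
Qed.

Lemma phi_skew_mx (x : vec) : W x ->
  phi A x *m G x = (-1) *: (G x *m (phi A x)^T).
Proof.
move=> Wx; apply: metV_mx => u v; have := metV_phi_skew u v Wx.
by rewrite /metV /inner trmx_mul -scalemxAr -scalemxAl scalemxE mulN1r !mulmxA.
Qed.

End AlmostContact.

(** * Covariant derivatives of xi, eta and phi *)

Section CovariantAlmostContact.
Variables (R : realType) (m : nat) (W : set 'rV[R]_m.+1).
Hypothesis Wo : open W.
Local Notation vec := 'rV[R]_m.+1.
Local Notation mat := 'M[R]_m.+1.
Variable A : acm_components R m.
Hypothesis acmA : acm_axioms A W.
Local Notation G := (met A).
Local Notation g := (metV A).

Let sG : smooth_on W G. Proof. exact: met_smooth acmA. Qed.
Let sphi : smooth_on W (phi A). Proof. exact: phi_smooth acmA. Qed.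
Let sxi : smooth_on W (xi A). Proof. exact: xi_smooth acmA. Qed.
Let seta : smooth_on W (eta A). Proof. exact: eta_smooth acmA. Qed.
Let symG x : W x -> (G x)^T = G x. Proof. by move=> Wx; exact: (met_symmx acmA Wx). Qed.
Let uG x : W x -> G x \in unitmx. Proof. by move=> Wx; exact: (met_unit acmA Wx). Qed.

Definition nabla_xi (x : vec) : mat := mx_of_rows (cov_row G (xi A) x).

(** The Lie derivative with its brackets rewritten by the torsion-free connection: derivatives of
    the argument cancel and a pointwise matrix remains. *)
Definition h_mx (x : vec) : mat :=
  2^-1 *: (cov_mx G (phi A) x (xi A x) - phi A x *m nabla_xi x + nabla_xi x *m phi A x).

Lemma mul_nabla_xi (x u : vec) : W x -> u *m nabla_xi x = cov_row G (xi A) x u.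
Proof.
by move=> Wx; apply: mul_mx_of_rows; exact (cov_row_row_sum Wo sG symG _ sxi Wx).
Qed.

Lemma smooth_nabla_xi : smooth_on W nabla_xi.
Proof.
by apply: (smooth_mx_of_rows Wo) => v; exact: (smooth_cov_row Wo sG uG).
Qed.

Lemma hFE (X : vec -> vec) (x : vec) : smooth_on W X -> W x ->
  hF A X x = X x *m h_mx x.
Proof.
move=> sX Wx; rewrite /hF /h_mx -scalemxAr; congr (_ *: _).
rewrite /bracket /phiF (derive_mulmx _ sX sphi Wx).
rewrite mulmxDr mulmxDr mulmxN !mulmxA !(mul_nabla_xi _ Wx) cov_mxE !cov_rowE.
have E u : u *m conn G x (xi A x) = xi A x *m conn G x u by rewrite (conn_sym Wo sG symG _ _ Wx).
have aux (dX X' dxX dX' c1 c2 : vec) (D P C : mat) : X' *m C = c1 ->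
    X' *m P *m C = c2 ->
    dX *m P + X' *m D - dxX - (dX - dX') *m P =
    X' *m (D + P *m C - C *m P) - (dxX + c2) + (dX' + c1) *m P.
  by move=> <- <-; mx_ring.
exact: aux (E _) (E _).
Qed.

Lemma cov_col_eq_on (e e' : vec -> 'cV[R]_m.+1) (x u : vec) :
  (forall y, W y -> e y = e' y) -> W x -> cov_col G e x u = cov_col G e' x u.
Proof.
move=> E Wx; rewrite !cov_colE (@derive_eq_on _ _ _ Wo _ _ e') ?E//.
by move=> y /[!inE]; exact: E.
Qed.

Lemma cov_mx_eq_on (F N : vec -> mat) (x u : vec) :
  (forall y, W y -> F y = N y) -> W x -> cov_mx G F x u = cov_mx G N x u.
Proof.
move=> E Wx; rewrite !cov_mxE (@derive_eq_on _ _ _ Wo _ _ N) ?E//.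
by move=> y /[!inE]; exact: E.
Qed.

Lemma cov_row_eq_on (Y Z : vec -> vec) (x u : vec) :
  (forall y, W y -> Y y = Z y) -> W x -> cov_row G Y x u = cov_row G Z x u.
Proof.
move=> E Wx; rewrite !cov_rowE (@derive_eq_on _ _ _ Wo _ _ Z) ?E//.
by move=> y /[!inE]; exact: E.
Qed.

Lemma cov_row_cst (v x u : vec) : cov_row G (fun=> v) x u = v *m conn G x u.
Proof. by rewrite cov_rowE derive_cst add0r. Qed.

Lemma cov_mx_cst_scalar (c : R) (x u : vec) : cov_mx G (fun=> c%:M) x u = 0.
Proof. by rewrite cov_mxE derive_cst add0r scalar_mxC subrr. Qed.

Lemma cov_eta (x u : vec) : W x -> cov_col G (eta A) x u = G x *m (u *m nabla_xi x)^T.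
Proof.
move=> Wx; rewrite (cov_col_eq_on u (fun y => eta_mx acmA (x := y)) Wx).
by rewrite (cov_lower Wo sG symG uG _ Wx sxi) mul_nabla_xi.
Qed.

Lemma cov_phi_sq (x u : vec) : W x ->
  cov_mx G (phi A) x u *m phi A x + phi A x *m cov_mx G (phi A) x u =
  G x *m (u *m nabla_xi x)^T *m xi A x + eta A x *m (u *m nabla_xi x).
Proof.
move=> Wx; rewrite -(cov_mx_mul G _ Wx sphi sphi).
rewrite (cov_mx_eq_on _ (fun y => phi_sq_mx acmA (x := y)) Wx).
have s1 : smooth_on W (fun=> - 1%:M : mat) by exact: (smooth_cst Wo).
have s2 := smooth_mulmx Wo seta sxi.
rewrite (cov_mxD G _ Wx s1 s2) (cov_outer G _ Wx sxi seta) (cov_eta _ Wx).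
have -> : (fun=> - 1%:M) = (fun=> (-1)%:M) :> (vec -> mat).
  by apply/funext => y; rewrite -[RHS]scale1r raddfN scale1r.
by rewrite cov_mx_cst_scalar add0r -mul_nabla_xi.
Qed.

(** Differentiating eta(xi) = 1 gives two terms, which are equal because eta is the metric dual of
    xi. *)
Lemma nabla_xi_eta (x u : vec) : W x -> etaV A x (u *m nabla_xi x) = 0.
Proof.
move=> Wx.
have D0 : 'D_u (fun y => xi A y *m eta A y) x = 0.
  rewrite (@derive_eq_on _ _ _ Wo _ _ (cst 1%:M)) ?derive_cst// => y /[!inE] Wy.
  apply/matrixP => i j; rewrite !ord1; have := eta_xi acmA Wy; rewrite /etaV => ->.
  by rewrite mxE eqxx.
move: D0; rewrite (cov_pairing G _ Wx sxi seta) (cov_eta _ Wx) -mul_nabla_xi//.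
move=> /(congr1 (fun N : 'M[R]_1 => N 0 0)); rewrite addmxE zeromxE mulmxA.
have aux (a b : R) : a = b -> a + b = 0 -> a = 0 by lra.
apply: aux.
exact: esym (etrans (met_sym acmA _ _ Wx) (metV_xi acmA _ Wx)).
Qed.

Lemma xi_cov_phi (x u : vec) : W x ->
  xi A x *m cov_mx G (phi A) x u = - (u *m nabla_xi x *m phi A x).
Proof.
move=> Wx; rewrite mul_nabla_xi//.
have : cov_row G (fun y => xi A y *m phi A y) x u = 0.
  rewrite (cov_row_eq_on (Z := fun=> 0) _ _ Wx) ?cov_row_cst ?mul0mx//.
  by move=> y Wy; rewrite (xi_phi acmA Wy).
by rewrite (cov_row_mul G _ Wx sxi sphi) => /eqP; rewrite addrC addr_eq0 => /eqP.
Qed.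

Lemma metV_adjoint (x : vec) (F : mat) (c : R) :
  F *m G x = c *: (G x *m F^T) -> forall u v, g x (u *m F) v = c * g x u (v *m F).
Proof.
move=> E u v; rewrite /metV /inner.
have -> : u *m F *m G x = c *: (u *m G x *m F^T).
  by rewrite -(mulmxA u F) E -scalemxAr mulmxA.
by rewrite -scalemxAl scalemxE trmx_mul !mulmxA.
Qed.

Lemma metV_cov_phi (x u v w : vec) : W x ->
  g x (v *m cov_mx G (phi A) x u) w = - g x v (w *m cov_mx G (phi A) x u).
Proof.
move=> Wx; rewrite -mulN1r; apply: metV_adjoint.
by apply: (cov_adjoint Wo sG symG uG u Wx sphi) => y; exact: phi_skew_mx.
Qed.

Section Contact.
Hypothesis contactA : forall u v x, W x ->
  deta A (fun=> u) (fun=> v) x = g x u (v *m phi A x).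

Lemma deta_cst (x u v : vec) : W x -> deta A (fun=> u) (fun=> v) x =
  2^-1 * ((v *m 'D_u (eta A) x) 0 0 - (u *m 'D_v (eta A) x) 0 0).
Proof.
move=> Wx.
have E w z : 'D_w (fun y => etaV A y z : R^o) x = (z *m 'D_w (eta A) x) 0 0.
  rewrite -(derive_mulmxl Wo z w seta Wx) derive_mxE//.
  exact: smooth_derivable (smooth_mulmx Wo (smooth_cst Wo z) seta) Wx.
have b0 : bracket (fun=> u) (fun=> v) x = 0 by rewrite /bracket !derive_cst subrr.
rewrite /deta b0 (E u v) (E v u); congr (_ * _).
by rewrite /etaV mul0mx zeromxE subr0.
Qed.

(** On constant fields d eta is the skew part of the derivative of eta, and the symmetric
    Christoffel terms cancel, leaving the skew part of nabla xi. *)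
Lemma metV_nabla_xi (x u v : vec) : W x ->
  g x (u *m nabla_xi x) v - g x (v *m nabla_xi x) u = 2 * g x u (v *m phi A x).
Proof.
move=> Wx; rewrite -contactA// deta_cst//.
have E w z : (z *m 'D_w (eta A) x) 0 0 =
    g x (w *m nabla_xi x) z + (z *m conn G x w *m eta A x) 0 0.
  have := cov_eta w Wx; rewrite cov_colE => /eqP; rewrite subr_eq => /eqP ->.
  by rewrite mulmxDr addmxE (met_sym acmA _ _ Wx) /metV /inner !mulmxA.
have C := congr1 (fun z => (z *m eta A x) 0 0) (conn_sym Wo sG symG u v Wx).
have aux (a b c c' X Y : R) : X = a + c -> Y = b + c' -> c = c' ->
    a - b = 2 * (2^-1 * (X - Y)).
  by move=> -> -> ->; field.
exact: aux (E u v) (E v u) C.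
Qed.

(** This is d(d eta) = 0 for the form g(u, phi v) = d eta(u, v): the Schwarz lemma cancels the
    second derivatives of eta and the symmetry of [conn] cancels the Christoffel terms. *)
Lemma cov_phi_cyclic (x u v w : vec) : W x ->
  g x (u *m cov_mx G (phi A) x w) v + g x (v *m cov_mx G (phi A) x u) w
  + g x (w *m cov_mx G (phi A) x v) u = 0.
Proof.
move=> Wx.
pose F (a b y : vec) := a *m (G y *m (b *m phi A y)^T).
have dF (a b c : vec) : ('D_c (F a b) x) 0 0 = g x (a *m conn G x c) (b *m phi A x)
    + g x a (b *m conn G x c *m phi A x) + g x a (b *m cov_mx G (phi A) x c).
  have sa : smooth_on W (fun=> a) by exact: (smooth_cst Wo).
  have sb : smooth_on W (fun=> b) by exact: (smooth_cst Wo).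
  have sbp := smooth_mulmx Wo sb sphi.
  have s2 := smooth_mulmx Wo sG (smooth_trmx Wo sbp).
  rewrite (cov_pairing G _ Wx sa s2) (cov_lower Wo sG symG uG _ Wx sbp).
  rewrite (cov_row_mul G _ Wx sb sphi) !cov_row_cst addmxE -addrA; congr (_ + _).
    by rewrite /metV /inner !mulmxA.
  by rewrite -metVDr /metV /inner !mulmxA.
have FE (a b y : vec) : W y -> F a b y = 2^-1 *: (b *m 'D_a (eta A) y - a *m 'D_b (eta A) y).
  move=> Wy; apply/matrixP => i j; rewrite !ord1 scalemxE addmxE oppmxE -deta_cst//.
  by rewrite contactA// /F /metV /inner mulmxA.
have dF' (a b c : vec) : ('D_c (F a b) x) 0 0 = 2^-1 *
    ((b *m 'D_c (fun y => 'D_a (eta A) y) x) 0 0 - (a *m 'D_c (fun y => 'D_b (eta A) y) x) 0 0).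
  rewrite (@derive_eq_on _ _ _ Wo _ _
    (fun y => 2^-1 *: (b *m 'D_a (eta A) y - a *m 'D_b (eta A) y))) //.
    have sa : smooth_on W (fun=> a) by exact: (smooth_cst Wo).
    have sb : smooth_on W (fun=> b) by exact: (smooth_cst Wo).
    have sDa := smooth_derive a seta; have sDb := smooth_derive b seta.
    have s1 := smooth_mulmx Wo sb sDa; have s2 := smooth_mulmx Wo sa sDb.
    rewrite (deriveZ_on _ _ (smoothB Wo s1 s2) Wx) (deriveD_on _ s1 (smoothN Wo s2) Wx).
    rewrite (deriveN_on _ s2 Wx) (derive_mulmxl Wo b c sDa Wx) (derive_mulmxl Wo a c sDb Wx).
    by rewrite scalemxE addmxE oppmxE.
  by move=> y /[!inE]; exact: FE.
have E1 := etrans (esym (dF u v w)) (dF' u v w).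
have E2 := etrans (esym (dF v w u)) (dF' v w u).
have E3 := etrans (esym (dF w u v)) (dF' w u v).
have S1 := congr1 (fun z => (w *m z) 0 0) (schwarz Wo u v seta Wx).
have S2 := congr1 (fun z => (u *m z) 0 0) (schwarz Wo v w seta Wx).
have S3 := congr1 (fun z => (v *m z) 0 0) (schwarz Wo w u seta Wx).
have C1 := congr1 (fun z => g x z (w *m phi A x)) (conn_sym Wo sG symG u v Wx).
have C2 := congr1 (fun z => g x z (u *m phi A x)) (conn_sym Wo sG symG v w Wx).
have C3 := congr1 (fun z => g x z (v *m phi A x)) (conn_sym Wo sG symG w u Wx).
have sk (a b : vec) : g x a (b *m phi A x) = - g x b (a *m phi A x).
  by rewrite -(metV_phi_skew acmA _ _ Wx) (met_sym acmA _ _ Wx).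
have aux (p q r a a' b b' c c' d e f X1 X2 X3 Y1 Y2 Y3 T1 T2 T3 : R) :
    X2 = Y3 -> X3 = Y1 -> X1 = Y2 -> b = b' -> c = c' -> a = a' ->
    d = - c' -> e = - a' -> f = - b' -> p = - T1 -> q = - T2 -> r = - T3 ->
    a + d + T1 = 2^-1 * (X1 - Y1) -> b + e + T2 = 2^-1 * (X2 - Y2) ->
    c + f + T3 = 2^-1 * (X3 - Y3) -> p + q + r = 0 by clear; lra.
exact: aux S1 S2 S3 C1 C2 C3 (sk _ _) (sk _ _) (sk _ _) (metV_cov_phi w u v Wx)
  (metV_cov_phi u v w Wx) (metV_cov_phi v w u Wx) E1 E2 E3.
Qed.

End Contact.
End CovariantAlmostContact.

(** * Operators that commute or anticommute with phi *)

Section MatrixIdentities.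
Variables (R : realType) (m : nat).
Implicit Types F S E D : 'M[R]_m.+1.

(** Expanding the last hypothesis with F^2 = -1 off E gives 2 (F S F - S) = 0; multiplying F S F = S
    by F concludes. *)
Lemma anticommutation F S E : F *m F = - 1%:M + E -> S *m E = 0 -> E *m S = 0 ->
  (S *m F + F *m S) *m F + F *m (S *m F + F *m S) = 0 -> S *m F = - (F *m S).
Proof.
move=> FF SE ES E0.
have FSF : F *m S *m F = S.
  have E1 : S *m (F *m F) + (F *m F) *m S + 2 *: (F *m S *m F) = 0.
    by rewrite -[RHS]E0; mx_ring.
  move: E1; rewrite FF mulmxDr mulmxDl SE ES !addr0 mulmxN mulNmx mulmx1 mul1mx => E1.
  apply/eqP; rewrite -subr_eq0; apply/eqP.
  have : 2 *: (F *m S *m F - S) = 0 by rewrite -[RHS]E1; mx_ring.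
  by move/eqP; rewrite scaler_eq0 pnatr_eq0 /= => /eqP.
rewrite -{1}FSF -mulmxA FF mulmxDr mulmxN mulmx1 -[X in _ + X]mulmxA SE mulmx0 addr0.
by [].
Qed.

(** S^2 and F^2 belong to the part of the equation commuting with F, while D and S F anticommute
    with F. The two parts separate, since off E the matrix F is a complex structure. *)
Lemma square_identity F S E D (kappa mu : R) :
  F *m F = - 1%:M + E -> S *m E = 0 -> E *m S = 0 -> E *m F = 0 ->
  S *m F = - (F *m S) -> D *m F = - (F *m D) ->
  - ((S - F) *m (S - F)) - D = - kappa *: (F *m F) + mu *: (S *m F) ->
  S *m S = (kappa - 1) *: (F *m F) /\ D = - mu *: (S *m F).
Proof.
move=> FF SE ES EF SF DF E0.
have BB : (S - F) *m (S - F) = S *m S + F *m F.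
  have -> : (S - F) *m (S - F) = S *m S + F *m F - (S *m F + F *m S) by mx_ring.
  by rewrite SF addNr subr0.
have DE : D = - (S *m S) + (kappa - 1) *: (F *m F) - mu *: (S *m F).
  apply/eqP; rewrite eq_sym -subr_eq0; apply/eqP.
  have -> : - (S *m S) + (kappa - 1) *: (F *m F) - mu *: (S *m F) - D =
    (- ((S - F) *m (S - F)) - D) - (- kappa *: (F *m F) + mu *: (S *m F)).
    by rewrite BB; mx_ring.
  by rewrite E0 subrr.
have SFF : S *m F *m F = - S.
  by rewrite -mulmxA FF mulmxDr mulmxN mulmx1 SE addr0.
have FFS : F *m F *m S = - S by rewrite FF mulmxDl mulNmx mul1mx ES addr0.
have FFF : F *m F *m F = - F by rewrite FF mulmxDl mulNmx mul1mx EF addr0.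
have FSF : F *m S *m F = S by rewrite -mulmxA SF mulmxN mulmxA FFS opprK.
have FSS : F *m S *m S = S *m S *m F.
  have FS : F *m S = - (S *m F) by rewrite SF opprK.
  by rewrite FS mulNmx -(mulmxA S F S) FS mulmxN opprK mulmxA.
have SSF : 2 *: (S *m S *m F + (kappa - 1) *: F) = 0.
  have E1 : D *m F + F *m D = 0 by rewrite DF addNr.
  have E2 : D *m F + F *m D = - (S *m S *m F) - F *m S *m S
      + (2 * (kappa - 1)) *: (F *m F *m F) - mu *: (S *m F *m F + F *m S *m F).
    by rewrite DE; mx_ring.
  move: E1; rewrite E2 FSS FFF SFF FSF addNr scaler0 subr0 => E1.
  rewrite -oppr0 -E1; mx_ring.
have SS : S *m S = (kappa - 1) *: (F *m F).
  move/eqP: SSF; rewrite scaler_eq0 pnatr_eq0 /= addr_eq0 => /eqP SSF.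
  have : S *m (S *m F *m F) = - (kappa - 1) *: (F *m F).
    by rewrite !mulmxA SSF mulNmx -scalemxAl scaleNr.
  by rewrite SFF mulmxN scaleNr => /oppr_inj.
by split=> //; rewrite DE SS addNr add0r scaleNr.
Qed.

End MatrixIdentities.

(** * The symmetric part S of nabla xi *)

Section ContactMetric.
Variables (R : realType) (m : nat) (W : set 'rV[R]_m.+1).
Hypothesis Wo : open W.
Local Notation vec := 'rV[R]_m.+1.
Local Notation mat := 'M[R]_m.+1.
Variable A : acm_components R m.
Hypothesis acmA : acm_axioms A W.
Hypothesis contactA : forall u v x, W x ->
  deta A (fun=> u) (fun=> v) x = metV A x u (v *m phi A x).
Local Notation G := (met A).
Local Notation g := (metV A).
Local Notation B := (nabla_xi A).

Let sG : smooth_on W G. Proof. exact: met_smooth acmA. Qed.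
Let sphi : smooth_on W (phi A). Proof. exact: phi_smooth acmA. Qed.
Let sxi : smooth_on W (xi A). Proof. exact: xi_smooth acmA. Qed.
Let symG x : W x -> (G x)^T = G x.
Proof. by move=> Wx; exact: (met_symmx acmA Wx). Qed.
Let uG x : W x -> G x \in unitmx.
Proof. by move=> Wx; exact: (met_unit acmA Wx). Qed.
Let sB : smooth_on W B. Proof. exact: (smooth_nabla_xi Wo acmA). Qed.
Let gC x u v : W x -> g x u v = g x v u.
Proof. by move=> Wx; exact: (met_sym acmA _ _ Wx). Qed.

(* [nabla_u xi = - phi u + S u] *)
Definition S_mx (x : vec) : mat := locked (B x + phi A x).

Lemma S_mxE : S_mx = fun x => B x + phi A x.
Proof. by apply/funext => x; rewrite /S_mx -lock. Qed.

Lemma smooth_S : smooth_on W S_mx.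
Proof. by rewrite S_mxE; exact: (smoothD Wo sB sphi). Qed.

Lemma xi_nabla_xi (x : vec) : W x -> xi A x *m B x = 0.
Proof.
move=> Wx; apply: (metV_inj acmA Wx) => w; rewrite metV0l.
have := metV_nabla_xi Wo acmA contactA (xi A x) w Wx.
rewrite (metV_xi acmA _ Wx) (nabla_xi_eta Wo acmA _ Wx) subr0 => ->.
by rewrite gC// (metV_xi acmA _ Wx) (eta_phi acmA _ Wx) mulr0.
Qed.

(** By the contact condition the skew part of nabla xi is - phi, so adding phi leaves the symmetric
    part. *)
Lemma metV_S (x u v : vec) : W x -> g x (u *m S_mx x) v = g x u (v *m S_mx x).
Proof.
move=> Wx; rewrite (gC u (v *m _) Wx) S_mxE !mulmxDr !metVDl.
have aux (a b c p q : R) : a - b = 2 * c -> p = - c -> q = c -> a + p = b + q by lra.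
exact: aux (metV_nabla_xi Wo acmA contactA u v Wx) (metV_phi_skew acmA u v Wx)
  (gC (v *m phi A x) u Wx).
Qed.

Lemma S_adjoint (x : vec) : W x -> S_mx x *m G x = 1 *: (G x *m (S_mx x)^T).
Proof.
move=> Wx; apply: metV_mx => u v; have := metV_S u v Wx.
by rewrite /metV /inner trmx_mul scale1r !mulmxA.
Qed.

Lemma xi_S (x : vec) : W x -> xi A x *m S_mx x = 0.
Proof. by move=> Wx; rewrite S_mxE mulmxDr xi_nabla_xi// (xi_phi acmA Wx) addr0. Qed.

Lemma eta_S (x u : vec) : W x -> etaV A x (u *m S_mx x) = 0.
Proof.
by move=> Wx; rewrite -(metV_xi acmA _ Wx) metV_S// xi_S// metV0r.
Qed.

Lemma S_eta (x : vec) : W x -> S_mx x *m eta A x = 0.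
Proof.
move=> Wx; apply: mulmx_row_inj => u; apply/matrixP => i j; rewrite !ord1.
by have := eta_S u Wx; rewrite /etaV mulmxA mulmx0 zeromxE.
Qed.

Lemma nabla_xiE (x : vec) : B x = S_mx x - phi A x.
Proof. by rewrite S_mxE addrK. Qed.

(** In the cyclic identity with one argument xi, the other two terms are known from phi xi = 0 and
    the skewness of nabla phi. *)
Lemma cov_phi_xi_S (x : vec) : W x ->
  cov_mx G (phi A) x (xi A x) = - (S_mx x *m phi A x + phi A x *m S_mx x).
Proof.
have aux (T X a b c d e f h k1 k2 : R) :
    T + X - (a - b) = 0 -> X = - - (c - d) -> b = - e -> e = - d -> a = - f ->
    f = h -> h = k2 -> c = k1 -> T = - (k1 + k2) by lra.
move=> Wx; apply: mulmx_row_inj => v; apply: (metV_inj acmA Wx) => w.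
have c1 := cov_phi_cyclic Wo acmA contactA v w (xi A x) Wx.
have c2 := metV_cov_phi Wo acmA v w (xi A x) Wx.
rewrite (xi_cov_phi Wo acmA _ Wx) metVNr in c2.
have c3 := xi_cov_phi Wo acmA w Wx.
rewrite c3 metVNl in c1.
have E u : u *m B x *m phi A x = u *m S_mx x *m phi A x - u *m phi A x *m phi A x.
  by rewrite nabla_xiE mulmxDr mulmxN mulmxDl mulNmx.
rewrite !E !metVDl !metVNl in c1; rewrite !E !metVDr !metVNr in c2.
rewrite mulmxN metVNl mulmxDr metVDl !(mulmxA v).
have p1 := metV_phi_skew acmA (w *m phi A x) v Wx.
have p2 := metV_phi_skew acmA w (v *m phi A x) Wx.
have p3 := metV_phi_skew acmA (w *m S_mx x) v Wx.
have p4 := metV_S w (v *m phi A x) Wx.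
have p5 := gC w (v *m phi A x *m S_mx x) Wx.
have p8 := gC w (v *m S_mx x *m phi A x) Wx.
exact: aux c1 c2 p1 p2 p3 p4 p5 p8.
Qed.

(** Since nabla_xi xi = 0, the derivative of phi^2 along xi vanishes, so nabla_xi phi anticommutes
    with phi; [cov_phi_xi_S] turns this into the hypothesis of [anticommutation]. *)
Lemma S_phi (x : vec) : W x -> S_mx x *m phi A x = - (phi A x *m S_mx x).
Proof.
move=> Wx; apply: (anticommutation (phi_sq_mx acmA Wx)).
- by rewrite mulmxA S_eta// mul0mx.
- by rewrite -mulmxA xi_S// mulmx0.
apply: oppr_inj; rewrite oppr0 opprD -mulNmx -mulmxN -(cov_phi_xi_S Wx).
rewrite (cov_phi_sq Wo acmA (xi A x) Wx) (xi_nabla_xi Wx).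
by rewrite trmx0 !mulmx0 mul0mx addr0.
Qed.

Lemma cov_phi_xi (x : vec) : W x -> cov_mx G (phi A) x (xi A x) = 0.
Proof. by move=> Wx; rewrite cov_phi_xi_S// S_phi// addNr oppr0. Qed.

Lemma h_mxE (x : vec) : W x -> h_mx A x = S_mx x *m phi A x.
Proof.
move=> Wx; rewrite /h_mx cov_phi_xi// nabla_xiE.
have aux (S F : mat) : S *m F = - (F *m S) ->
    2^-1 *: (0 - F *m (S - F) + (S - F) *m F) = S *m F.
  move=> E; have -> : 0 - F *m (S - F) + (S - F) *m F = S *m F - F *m S by mx_ring.
  by rewrite -E; apply/matrixP => i j; rewrite scalemxE addmxE; field.
exact/aux/S_phi.
Qed.

Lemma metV_cov_S (x u v w : vec) : W x ->
  g x (v *m cov_mx G S_mx x u) w = g x v (w *m cov_mx G S_mx x u).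
Proof.
move=> Wx; rewrite -[RHS]mul1r; apply: metV_adjoint.
by apply: (cov_adjoint Wo sG symG uG u Wx smooth_S) => y; exact: S_adjoint.
Qed.

Lemma cov_S_phi (x u : vec) : W x ->
  cov_mx G S_mx x u *m phi A x + S_mx x *m cov_mx G (phi A) x u
  + cov_mx G (phi A) x u *m S_mx x + phi A x *m cov_mx G S_mx x u = 0.
Proof.
move=> Wx; have s1 := smooth_mulmx Wo smooth_S sphi.
have s2 := smooth_mulmx Wo sphi smooth_S.
rewrite -(cov_mx_mul G u Wx smooth_S sphi) -addrA -(cov_mx_mul G u Wx sphi smooth_S).
rewrite -(cov_mxD G _ Wx s1 s2) (@cov_mx_eq_on _ _ _ Wo A _ (fun=> 0%:M)) ?cov_mx_cst_scalar//.
by move=> y Wy; rewrite S_phi// addNr raddf0.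
Qed.

Lemma xi_cov_S (x u : vec) : W x ->
  xi A x *m cov_mx G S_mx x u = - (u *m B x *m S_mx x).
Proof.
move=> Wx; rewrite (mul_nabla_xi Wo acmA _ Wx).
have : cov_row G (fun y => xi A y *m S_mx y) x u = 0.
  rewrite (@cov_row_eq_on _ _ _ Wo A _ (fun=> 0)) ?cov_row_cst ?mul0mx//.
  by move=> y Wy; rewrite xi_S.
by rewrite (cov_row_mul G _ Wx sxi smooth_S) => /eqP; rewrite addrC addr_eq0 => /eqP.
Qed.

(** The Ricci identity for xi, with the first derivative of xi written as B = S - phi. *)
Lemma xi_Riem (x u v : vec) : W x ->
  xi A x *m Riem G x u v =
  v *m (cov_mx G S_mx x u - cov_mx G (phi A) x u)
  - u *m (cov_mx G S_mx x v - cov_mx G (phi A) x v).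
Proof.
move=> Wx; rewrite -(ricci_row Wo sG uG _ Wx sxi).
have E w : cov_mx G S_mx x w - cov_mx G (phi A) x w = cov_mx G B x w.
  by rewrite S_mxE (cov_mxD G w Wx sB sphi) addrK.
have D w z : cov_row G (fun y => cov_row G (xi A) y z) x w =
    z *m conn G x w *m B x + z *m cov_mx G B x w.
  rewrite (@cov_row_eq_on _ _ _ Wo A _ (fun y => z *m B y)) //.
    by rewrite (cov_row_mul G _ Wx (smooth_cst Wo z) sB) cov_row_cst.
  by move=> y Wy; rewrite (mul_nabla_xi Wo acmA _ Wy).
rewrite !E (D u v) (D v u) (conn_sym Wo sG symG u v Wx).
have aux (a b c : vec) : a + b - (a + c) = b - c by mx_ring.
exact: aux.
Qed.

End ContactMetric.

(* In the application [T x y z] and [t x y z] are [g ((nabla_x phi) y) z] and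
   [g ((nabla_x S) y) z], [k] is [- d kappa] and [lambda] is [1 - kappa]. *)
Section HorizontalAlgebra.
Variables (R : realFieldType) (V : lmodType R) (hor : V -> Prop).
Variables (J S : V -> V) (T t : V -> V -> V -> R).
Hypothesis horJ : forall x, hor x -> hor (J x).
Hypothesis horS : forall x, hor x -> hor (S x).
Hypothesis JJ : forall x, hor x -> J (J x) = - x.
Hypothesis SJ : forall x, hor x -> S (J x) = - J (S x).
Hypothesis TZ1 : forall a x y z, T (a *: x) y z = a * T x y z.
Hypothesis TZ3 : forall a x y z, T x y (a *: z) = a * T x y z.
Hypothesis tZ1 : forall a x y z, t (a *: x) y z = a * t x y z.
Hypothesis tZ3 : forall a x y z, t x y (a *: z) = a * t x y z.
Hypothesis Tskew : forall x y z, T x y z = - T x z y.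
Hypothesis Tcyc : forall x y z, T x y z + T y z x + T z x y = 0.
Hypothesis TJ : forall x y z, hor x -> hor y -> hor z -> T x (J y) z = T x y (J z).

Let TN1 x y z : T (- x) y z = - T x y z.
Proof. by rewrite -scaleN1r TZ1 mulN1r. Qed.

Let TN3 x y z : T x y (- z) = - T x y z.
Proof. by rewrite -scaleN1r TZ3 mulN1r. Qed.

Let tN3 x y z : t x y (- z) = - t x y z.
Proof. by rewrite -scaleN1r tZ3 mulN1r. Qed.

Let TJJ x y z : hor x -> hor y -> hor z -> T x (J y) (J z) = - T x y z.
Proof. by move=> hx hy hz; rewrite TJ ?JJ ?TN3//; exact: horJ. Qed.

(* The quasi-Kaehler identity of almost Kaehler geometry, transversally to [xi]. *)
Lemma complex_type x y z : hor x -> hor y -> hor z -> T x y z + T (J x) y (J z) = 0.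
Proof.
move=> hx hy hz; have [hx' hy' hz'] : [/\ hor (J x), hor (J y) & hor (J z)].
  by split; exact: horJ.
have c1 := Tcyc x y z; have c2 := Tcyc x (J y) (J z).
have c3 := Tcyc (J x) (J y) z; have c4 := Tcyc (J x) y (J z).
have e1 := TJJ hx hy hz; have e2 := TJ hy' hz hx; have e3 := TJ hz' hx hy.
have e4 := TJ hx' hy hz; have e5 := TJJ hz hx hy; have e6 := TJJ hy hz hx.
lra.
Qed.

Lemma complex_type1 x y z : hor x -> hor y -> hor z -> T x y (J z) = T (J x) y z.
Proof.
move=> hx hy hz; have := complex_type hx hy (horJ hz).
by rewrite JJ// TN3 => /eqP; rewrite subr_eq0 => /eqP.
Qed.

Hypothesis tsym : forall x y z, t x y z = t x z y.
Hypothesis codazzi : forall x y z, hor x -> hor y -> hor z ->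
  t x y z - t y x z = - T z x y.
Hypothesis tJ : forall x y z, hor x -> hor y -> hor z ->
  t x (J y) z - t x y (J z) + T x y (S z) + T x (S y) z = 0.

(** In [t (J x) (J y) z] both J can be removed: [tJ] moves one to the last slot, [codazzi] exchanges
    the first two slots, and [tJ] removes the other, ending at [t y x z]. So [codazzi] for
    [J x, J y] is compared with [codazzi] for [x, y], and the terms in [T] that are left over give
    this symmetry. *)
Lemma T_S_sym x y z : hor x -> hor y -> hor z -> T (J x) y (S z) = T (J y) x (S z).
Proof.
move=> hx hy hz; have [hx' hy' hz'] : [/\ hor (J x), hor (J y) & hor (J z)].
  by split; exact: horJ.
have [sx sy sz] : [/\ hor (S x), hor (S y) & hor (S z)] by split; exact: horS.
have d1 := codazzi hx hy hz; have d2 := codazzi hx' hy' hz.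
have d3 := TJJ hz hx hy.
have d4 := tJ hy' hx hz; have d5 := tJ hx' hy hz.
have d6 := codazzi hy' hx hz'; have d7 := codazzi hx' hy hz'.
have d8 := tJ hx hy hz'; have d9 := tJ hy hx hz'.
rewrite JJ// tN3 SJ// TN3 in d8; rewrite JJ// tN3 SJ// TN3 in d9.
have e1 := complex_type1 hx hy sz; have e2 := complex_type1 hx sy hz.
have e3 := complex_type1 hy hx sz; have e4 := complex_type1 hy sx hz.
have f1 := Tskew (J z) (J y) x; have f2 := TJ hz' hx hy.
have f3 := complex_type1 hz' hx hy; rewrite JJ// TN1 in f3.
lra.
Qed.

Variable lambda : R.
Hypothesis lambda_neq0 : lambda != 0.
Hypothesis SS : forall x, hor x -> S (S x) = lambda *: x.

Lemma T_hor_eq0 x y z : hor x -> hor y -> hor z -> T x y z = 0.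
Proof.
have sym u v w : hor u -> hor v -> hor w -> T (J u) v w = T (J v) u w.
  move=> hu hv hw; have := T_S_sym hu hv (horS hw).
  by rewrite SS// !TZ3 => /(mulfI lambda_neq0).
have J0 u v w : hor u -> hor v -> hor w -> T (J u) v w = 0.
  move=> hu hv hw.
  have s1 := sym u v w hu hv hw; have s2 := sym v w u hv hw hu.
  have s3 := sym w u v hw hu hv.
  have k1 := Tskew (J u) v w; have k2 := Tskew (J v) w u; have k3 := Tskew (J w) u v.
  lra.
move=> hx hy hz; have := J0 _ _ _ (horJ hx) hy hz.
by rewrite JJ// TN1 => /eqP; rewrite oppr_eq0 => /eqP.
Qed.

Variables (g : V -> V -> R) (k : V -> R).
Hypothesis gJ : forall x y, g (J x) y = - g x (J y).
Hypothesis gN : forall x y, g x (- y) = - g x y.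
Hypothesis tS : forall x y z, hor x -> hor y -> hor z ->
  t x (S y) z + t x y (S z) = k x * g y z.

Let tsym12 x y z : hor x -> hor y -> hor z -> t x y z = t y x z.
Proof.
move=> hx hy hz; have := codazzi hx hy hz.
by rewrite T_hor_eq0// oppr0 => /eqP; rewrite subr_eq0 => /eqP.
Qed.

(** With T = 0 the form t is totally symmetric, and the three cyclic instances of [tS] are solved as
    in the Koszul formula. *)
Lemma t_S x y z : hor x -> hor y -> hor z ->
  2 * t (S x) y z = k y * g x z + k z * g x y - k x * g y z.
Proof.
move=> hx hy hz.
have [sx sy sz] : [/\ hor (S x), hor (S y) & hor (S z)] by split; exact: horS.
have a1 := tS hx hy hz; have a2 := tS hy hx hz; have a3 := tS hz hx hy.
have b1 := tsym12 hx sy hz; have b2 := tsym12 hx hy sz; have b3 := tsym x y (S z).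
have b4 := tsym12 hx sz hy; have b5 := tsym12 hy sx hz; have b6 := tsym12 hy hx sz.
have b7 := tsym y x (S z); have b8 := tsym12 hy sz hx; have b9 := tsym12 hz sx hy.
have b10 := tsym12 hz hx sy; have b11 := tsym z x (S y); have b12 := tsym12 hz sy hx.
have b13 := tsym (S x) y z; have b14 := tsym (S y) x z; have b15 := tsym (S z) x y.
lra.
Qed.

(** By [t_S], the values of [t (S x)] on the pairs (y, y) and (J y, J y) are equal; by [tJ] with T =
    0 they are opposite. Both are - k(x) g(y, y) / 2. *)
Lemma dkappa_hor_eq0 x y : hor x -> hor y -> g x y = 0 -> g x (J y) = 0 -> g y y != 0 ->
  k x = 0.
Proof.
move=> hx hy g1 g2 g3; have hy' := horJ hy; have sx := horS hx.
have a1 := t_S hx hy' hy'; have a2 := t_S hx hy hy.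
have a3 := tJ sx hy hy'; rewrite JJ// tN3 in a3.
have h0 u v w (hu : hor u) (hv : hor v) (hw : hor w) := T_hor_eq0 hu hv hw.
have a4 := h0 _ _ _ sx hy (horS hy'); have a5 := h0 _ _ _ sx (horS hy) hy'.
have a6 := gJ y (J y); rewrite JJ// gN in a6.
rewrite g2 !mulr0 in a1; rewrite g1 !mulr0 in a2.
have : k x * g y y = 0 by rewrite a6 in a1; lra.
by move/eqP; rewrite mulf_eq0 (negbTE g3) orbF => /eqP.
Qed.

Lemma t_hor_eq0 x y z : (forall u, hor u -> k u = 0) ->
  hor x -> hor y -> hor z -> t x y z = 0.
Proof.
move=> k0 hx hy hz; have := t_S (horS hx) hy hz.
rewrite SS// !k0 ?mul0r ?addr0 ?subr0//; last exact: horS.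
move/eqP; rewrite mulf_eq0 pnatr_eq0 /= tZ1 mulf_eq0 (negbTE lambda_neq0) /=.
by move/eqP.
Qed.

End HorizontalAlgebra.

(** * The nullity condition with variable coefficients *)

Section HorizontalVectors.
Variables (R : realType) (m : nat) (W : set 'rV[R]_m.+1).
Local Notation vec := 'rV[R]_m.+1.
Variable A : acm_components R m.
Hypothesis acmA : acm_axioms A W.
Local Notation g := (metV A).

Definition hor_part (x u : vec) : vec := u - etaV A x u *: xi A x.

Lemma hor_partP (x u : vec) : W x -> etaV A x (hor_part x u) = 0.
Proof.
by move=> Wx; rewrite /hor_part etaVD etaVN etaVZ (eta_xi acmA Wx) mulr1 subrr.
Qed.

Lemma mul_eta_row (x v y : vec) : v *m (eta A x *m y) = etaV A x v *: y.
Proof. by rewrite mulmxA [v *m _]mx11_scalar mul_scalar_mx. Qed.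

Lemma mul_dual_row (x v a y : vec) : v *m (met A x *m a^T *m y) = g x v a *: y.
Proof. by rewrite !mulmxA [v *m _ *m a^T]mx11_scalar mul_scalar_mx. Qed.

Lemma metV_neq0 (x u : vec) : W x -> u != 0 -> g x u u != 0.
Proof. by move=> Wx u0; rewrite lt0r_neq0// (met_pos acmA Wx u0). Qed.

Lemma metV_expand (x a b p q y z : vec) (c d e : R) :
  g x (a - c *: b - e *: (p - c *: q)) (y - d *: z) =
  g x a y - c * g x b y - e * (g x p y - c * g x q y)
  - d * (g x a z - c * g x b z - e * (g x p z - c * g x q z)).
Proof.
rewrite !metVDl !metVNl !metVZl !metVDl !metVNl !metVZl.
by rewrite !metVDr !metVNr !metVZr; ring.
Qed.

Lemma exists_left_kernel (p : nat) (C : 'M[R]_(m.+1, p)) : (p < m.+1)%N ->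
  exists2 y : vec, y != 0 & y *m C = 0.
Proof.
move=> pm; have rk : \rank (kermx C) != 0%N.
  by rewrite mxrank_ker subn_eq0 -ltnNge (leq_ltn_trans (rank_leq_col C)).
have [i ri0] : exists i, row i (kermx C) != 0.
  apply/existsP; apply: contraNT rk => /existsPn r0; rewrite mxrank_eq0.
  by apply/eqP/row_matrixP => i; rewrite row0; apply/eqP; have := r0 i; rewrite negbK.
by exists (row i (kermx C)) => //; rewrite -row_mul mulmx_ker row0.
Qed.

(** Three linear conditions in a space of dimension more than 3. With [u = 0] it simply provides a
    nonzero horizontal vector. *)
Lemma exists_hor_perp (x u : vec) : W x -> (3 < m.+1)%N ->
  exists y : vec, [/\ y != 0, etaV A x y = 0, g x u y = 0 & g x u (y *m phi A x) = 0].
Proof.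
move=> Wx m3.
have [y y0] := @exists_left_kernel (1 + (1 + 1))%N
  (row_mx (eta A x) (row_mx (met A x *m u^T) (phi A x *m met A x *m u^T))) m3.
rewrite !mul_mx_row -[RHS]row_mx0 => /eq_row_mx[e1].
rewrite -[RHS]row_mx0 => /eq_row_mx[e2 e3].
exists y; split=> //; first by rewrite /etaV e1 zeromxE.
  by rewrite (met_sym acmA _ _ Wx) /metV /inner -mulmxA e2 zeromxE.
rewrite (met_sym acmA _ _ Wx) /metV /inner -!mulmxA.
by rewrite !mulmxA in e3 *; rewrite e3 zeromxE.
Qed.

End HorizontalVectors.

Section KappaMu.
Variables (R : realType) (m : nat) (W : set 'rV[R]_m.+1).
Hypothesis Wo : open W.
Local Notation vec := 'rV[R]_m.+1.
Local Notation mat := 'M[R]_m.+1.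
Variable A : acm_components R m.
Hypothesis acmA : acm_axioms A W.
Hypothesis contactA : forall u v x, W x ->
  deta A (fun=> u) (fun=> v) x = metV A x u (v *m phi A x).
Local Notation G := (met A).
Local Notation g := (metV A).
Local Notation eta_ := (etaV A).
Local Notation B := (nabla_xi A).
Local Notation S := (S_mx A).
Local Notation F := (phi A).
Local Notation dF := (cov_mx G F).
Local Notation dS := (cov_mx G S).
Variables (kappa mu : vec -> R).
Hypothesis skappa : smooth_on W (kappa : vec -> R^o).
Hypothesis kmA : forall x u v, W x -> xi A x *m Riem G x u v =
  kappa x *: (eta_ x v *: u - eta_ x u *: v)
  + mu x *: (eta_ x v *: (u *m h_mx A x) - eta_ x u *: (v *m h_mx A x)).

Let sG : smooth_on W G. Proof. exact: met_smooth acmA. Qed.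
Let sphi : smooth_on W F. Proof. exact: phi_smooth acmA. Qed.
Let symG x : W x -> (G x)^T = G x.
Proof. by move=> Wx; exact: (met_symmx acmA Wx). Qed.
Let sS : smooth_on W S. Proof. exact: (smooth_S Wo acmA). Qed.
Let gC x u v : W x -> g x u v = g x v u.
Proof. by move=> Wx; exact: (met_sym acmA _ _ Wx). Qed.
Let etaxi x : W x -> eta_ x (xi A x) = 1.
Proof. by move=> Wx; exact: (eta_xi acmA Wx). Qed.

Let xiS x : W x -> xi A x *m S x = 0.
Proof. by move=> Wx; exact: (xi_S Wo acmA contactA Wx). Qed.
Let hE x : W x -> h_mx A x = S x *m F x.
Proof. by move=> Wx; exact: (h_mxE Wo acmA contactA Wx). Qed.

Lemma xi_h (x : vec) : W x -> xi A x *m h_mx A x = 0.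
Proof. by move=> Wx; rewrite hE// mulmxA xiS// mul0mx. Qed.

Lemma eta_h (x u : vec) : W x -> eta_ x (u *m h_mx A x) = 0.
Proof. by move=> Wx; rewrite hE// mulmxA (eta_phi acmA _ Wx). Qed.

Lemma hor_phi_phi (x u : vec) : W x -> eta_ x u = 0 -> u *m F x *m F x = - u.
Proof. by move=> Wx u0; rewrite (phi_phi acmA _ Wx) u0 scale0r addr0. Qed.

Lemma hor_phi_S (x u : vec) : W x -> u *m F x *m S x = - (u *m S x *m F x).
Proof.
by move=> Wx; rewrite -!mulmxA (S_phi Wo acmA contactA Wx) mulmxN opprK.
Qed.

(** R(u, xi) xi computed from [kmA] and from [xi_Riem] gives one equation in S^2 and nabla_xi S,
    which [square_identity] splits in two. *)
Lemma S_sq_cov_S_xi (x : vec) : W x ->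
  S x *m S x = (kappa x - 1) *: (F x *m F x) /\
  dS x (xi A x) = - mu x *: h_mx A x.
Proof.
move=> Wx; have Fxi := cov_phi_xi Wo acmA contactA Wx.
have DF : dS x (xi A x) *m F x = - (F x *m dS x (xi A x)).
  have := cov_S_phi Wo acmA contactA (xi A x) Wx.
  by rewrite Fxi mulmx0 mul0mx !addr0 => /eqP; rewrite addr_eq0 => /eqP.
rewrite hE//; apply: (square_identity (phi_sq_mx acmA Wx)) => //.
- by rewrite mulmxA (S_eta Wo acmA contactA Wx) mul0mx.
- by rewrite -mulmxA xiS// mulmx0.
- by rewrite -mulmxA (xi_phi acmA Wx) mulmx0.
- exact: (S_phi Wo acmA contactA Wx).
rewrite -(nabla_xiE A x); apply: mulmx_row_inj => u.
have := kmA u (xi A x) Wx; rewrite (xi_Riem Wo acmA _ _ Wx).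
rewrite etaxi// !scale1r xi_h// scaler0 subr0 Fxi subr0 hE//.
have -> : u - eta_ x u *: xi A x = - (u *m F x *m F x).
  by rewrite (phi_phi acmA _ Wx) opprD opprK.
rewrite mulmxDr mulmxN (xi_cov_S Wo acmA contactA _ Wx) (xi_cov_phi Wo acmA _ Wx).
have aux (b s f d : mat) (k l : R) : b = s - f ->
    - (u *m b *m s) - - (u *m b *m f) - u *m d =
      k *: - (u *m f *m f) + l *: (u *m (s *m f)) ->
    u *m (- (b *m b) - d) = u *m (- k *: (f *m f) + l *: (s *m f)).
  move=> bE E; transitivity (- (u *m b *m s) - - (u *m b *m f) - u *m d).
    by rewrite {2}bE; mx_ring.
  by rewrite E; mx_ring.
by apply: aux; exact: (nabla_xiE A x).
Qed.

Lemma S_sq (x : vec) : W x -> S x *m S x = (kappa x - 1) *: (F x *m F x).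
Proof. by move=> /S_sq_cov_S_xi[]. Qed.

Lemma cov_S_xi (x : vec) : W x -> dS x (xi A x) = - mu x *: h_mx A x.
Proof. by move=> /S_sq_cov_S_xi[]. Qed.

Lemma hor_S_S (x u : vec) : W x -> eta_ x u = 0 -> u *m S x *m S x = (1 - kappa x) *: u.
Proof.
move=> Wx u0; rewrite -mulmxA S_sq// -scalemxAr mulmxA hor_phi_phi//.
by rewrite scalerN -scaleNr opprB.
Qed.

Lemma cov_mx0 (N : vec -> mat) (x : vec) : smooth_on W N -> W x -> cov_mx G N x 0 = 0.
Proof.
move=> sN Wx; have := cov_mx_linear Wo sG symG 0 0 1 sN Wx.
by rewrite scaler0 addr0 scale1r -{1}[cov_mx _ _ _ _]addr0 => /addrI/esym.
Qed.

Lemma cov_mxZv (N : vec -> mat) (x u : vec) (a : R) : smooth_on W N -> W x ->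
  cov_mx G N x (a *: u) = a *: cov_mx G N x u.
Proof.
move=> sN Wx; have := cov_mx_linear Wo sG symG u 0 a sN Wx.
by rewrite cov_mx0// !addr0.
Qed.

(** Differentiates [S_sq]; the derivative of phi^2 = -1 + eta (x) xi vanishes between horizontal
    vectors, so only the derivative of kappa remains on the right. *)
Lemma cov_S_sq (x u v w : vec) : W x -> eta_ x v = 0 -> eta_ x w = 0 ->
  g x (v *m S x *m dS x u) w + g x (v *m dS x u) (w *m S x) =
  - ('D_u (kappa : _ -> R^o) x : R) * g x v w.
Proof.
move=> Wx v0 w0.
have E := cov_mx_eq_on Wo A u S_sq Wx.
have sk1 : smooth_on W (fun y => kappa y - 1 : R^o).
  by apply: (smoothD Wo) => //; exact: (smooth_cst Wo).
rewrite (cov_mx_mul G u Wx sS sS) in E.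
rewrite (cov_mxZ Wo G u Wx (smooth_mulmx Wo sphi sphi) sk1) in E.
rewrite (cov_mx_mul G u Wx sphi sphi) (cov_phi_sq Wo acmA _ Wx) in E.
have D : 'D_u (fun y => kappa y - 1 : R^o) x = 'D_u (kappa : _ -> R^o) x.
  have sc : smooth_on W (fun=> -1 : R^o) by exact: (smooth_cst Wo).
  by rewrite (deriveD_on u skappa sc Wx) (derive_cst (-1 : R^o) x u) addr0.
rewrite D in E.
have := congr1 (fun N => g x (v *m N) w) E.
rewrite /= mulmxDr (mulmxA v (dS x u)) (mulmxA v (S x)) metVDl (metV_S Wo acmA contactA _ _ Wx).
rewrite addrC => ->; move: ('D_u _ x : R) => d.
rewrite mulmxDr -!scalemxAr mulmxDr (mulmxA v (F x)) mul_dual_row mul_eta_row v0 scale0r addr0.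
rewrite hor_phi_phi// scalerN -scaleNr scalerA metVDl !metVZl.
by rewrite (gC (xi A x) w Wx) (metV_xi acmA _ Wx) w0 mulr0 addr0.
Qed.

Section AtPoint.
Variable x : vec.
Hypothesis Wx : W x.
Hypothesis kappa_neq1 : kappa x != 1.

Let lambda_neq0 : 1 - kappa x != 0.
Proof. by rewrite subr_eq0 eq_sym. Qed.
Let hor u : Prop := eta_ x u = 0.
Let J (u : vec) : vec := u *m F x.
Let Sf (u : vec) : vec := u *m S x.
Let T (u v w : vec) : R := g x (v *m dF x u) w.
Let t (u v w : vec) : R := g x (v *m dS x u) w.

Let horJ u : hor u -> hor (J u). Proof. by move=> _; exact: (eta_phi acmA _ Wx). Qed.
Let horS u : hor u -> hor (Sf u).
Proof. by move=> _; exact: (eta_S Wo acmA contactA _ Wx). Qed.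
Let JJ u : hor u -> J (J u) = - u. Proof. by move=> hu; exact: hor_phi_phi. Qed.
Let SJ u : hor u -> Sf (J u) = - J (Sf u). Proof. by move=> _; exact: hor_phi_S. Qed.
Let TZ1 a u v w : T (a *: u) v w = a * T u v w.
Proof. by rewrite /T cov_mxZv// -scalemxAr metVZl. Qed.
Let tZ1 a u v w : t (a *: u) v w = a * t u v w.
Proof. by rewrite /t cov_mxZv// -scalemxAr metVZl. Qed.
Let TZ3 a u v w : T u v (a *: w) = a * T u v w. Proof. by rewrite /T metVZr. Qed.
Let tZ3 a u v w : t u v (a *: w) = a * t u v w. Proof. by rewrite /t metVZr. Qed.
Let Tskew u v w : T u v w = - T u w v.
Proof. by rewrite /T (metV_cov_phi Wo acmA _ _ _ Wx) gC. Qed.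
Let Tcyc u v w : T u v w + T v w u + T w u v = 0.
Proof. by rewrite -(cov_phi_cyclic Wo acmA contactA v w u Wx). Qed.
Let TJ u v w : hor u -> hor v -> hor w -> T u (J v) w = T u v (J w).
Proof.
move=> hu hv hw; have := congr1 (fun N => g x (v *m N) w) (cov_phi_sq Wo acmA u Wx).
rewrite /= !mulmxDr mul_dual_row mul_eta_row !mulmxA hv scale0r addr0 metVDl metVZl.
rewrite (gC (xi A x) w Wx) (metV_xi acmA _ Wx) hw mulr0 (metV_phi_skew acmA _ _ Wx).
by move/eqP; rewrite addrC subr_eq0 => /eqP.
Qed.
Let tsym u v w : t u v w = t u w v.
Proof. by rewrite /t (metV_cov_S Wo acmA contactA _ _ _ Wx) gC. Qed.
(** R(u, v) xi = 0 for horizontal u and v, so [xi_Riem] equates the skew parts of nabla S and nabla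
    phi; cyclicity merges the latter into one term. *)
Let codazzi u v w : hor u -> hor v -> hor w -> t u v w - t v u w = - T w u v.
Proof.
have aux (a b c d e : R) : a - b - (c - d) = 0 -> b + (- d) + e = 0 -> a - c = - e by lra.
move=> hu hv hw; have E0 : xi A x *m Riem G x u v = 0.
  by rewrite (kmA _ _ Wx) hu hv !scale0r subrr !scaler0 addr0.
rewrite (xi_Riem Wo acmA _ _ Wx) in E0.
have := congr1 (fun z => g x z w) E0.
rewrite /= metV0l !mulmxDr !mulmxN !(metVDl, metVNl) => E.
have k1 := Tcyc u v w; rewrite (Tskew v w u) in k1.
exact: (aux (t u v w) (T u v w) (t v u w) (T v u w) (T w u v) E k1).
Qed.
Let tJ u v w : hor u -> hor v -> hor w ->
  t u (J v) w - t u v (J w) + T u v (Sf w) + T u (Sf v) w = 0.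
Proof.
have aux (a b c d : R) : - a + b + c + d = 0 -> d - a + c + b = 0 by lra.
move=> hu hv hw; have := congr1 (fun N => g x (v *m N) w) (cov_S_phi Wo acmA contactA u Wx).
rewrite /= mulmx0 metV0l 3!mulmxDr !mulmxA !metVDl (metV_phi_skew acmA _ w Wx).
rewrite (metV_S Wo acmA contactA (v *m dF x u) w Wx).
exact: aux.
Qed.
Let SS u : hor u -> Sf (Sf u) = (1 - kappa x) *: u.
Proof. by move=> hu; exact: hor_S_S. Qed.

Lemma cov_phi_hor (u v w : vec) : eta_ x u = 0 -> eta_ x v = 0 -> eta_ x w = 0 ->
  g x (v *m dF x u) w = 0.
Proof.
move=> hu hv hw.
exact: (@T_hor_eq0 _ _ hor J Sf T t horJ horS JJ SJ TZ1 TZ3 tZ3 Tskew Tcyc TJ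
  codazzi tJ _ lambda_neq0 SS u v w hu hv hw).
Qed.

Lemma derive_kappa_hor (u : vec) : (3 < m.+1)%N -> eta_ x u = 0 ->
  'D_u (kappa : _ -> R^o) x = 0 :> R.
Proof.
move=> m3 hu; have [y [y0 hy g1 g2]] := exists_hor_perp acmA u Wx m3.
pose k v : R := - ('D_v (kappa : _ -> R^o) x : R).
have tS a b c : hor a -> hor b -> hor c -> t a (Sf b) c + t a b (Sf c) = k a * g x b c.
  by move=> ha hb hc; exact: cov_S_sq.
have gN a b : g x a (- b) = - g x a b by exact: metVNr.
have gJ a b : g x (J a) b = - g x a (J b) by exact: (metV_phi_skew acmA).
have := @dkappa_hor_eq0 _ _ hor J Sf T t horJ horS JJ SJ TZ1 TZ3 tZ3 Tskew Tcyc TJ tsym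
  codazzi tJ _ lambda_neq0 SS (g x) k gJ gN tS u y hu hy g1 g2
  (metV_neq0 acmA Wx y0).
by move/eqP; rewrite oppr_eq0 => /eqP.
Qed.

Lemma cov_S_hor (u v w : vec) : (forall z, 'D_z (kappa : _ -> R^o) x = 0 :> R) ->
  eta_ x u = 0 -> eta_ x v = 0 -> eta_ x w = 0 ->
  g x (v *m dS x u) w = 0.
Proof.
move=> dk hu hv hw.
pose k (v : vec) : R := 0.
have tS a b c : hor a -> hor b -> hor c -> t a (Sf b) c + t a b (Sf c) = k a * g x b c.
  by move=> ha hb hc; have := cov_S_sq a Wx hb hc; rewrite dk oppr0.
exact: (@t_hor_eq0 _ _ hor J Sf T t horJ horS JJ SJ TZ1 TZ3 tZ1 tZ3 Tskew Tcyc TJ tsym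
  codazzi tJ _ lambda_neq0 SS (g x) k tS u v w (fun _ _ => erefl) hu hv hw).
Qed.

(** The components with an argument xi are known from phi xi = 0, the skewness of nabla_u phi and
    nabla_xi phi = 0. They are all there is, since the horizontal components vanish. *)
Lemma cov_phi_expand (u v w : vec) :
  g x (v *m dF x u) w =
  g x (u + u *m h_mx A x) v * eta_ x w - eta_ x v * g x (u + u *m h_mx A x) w.
Proof.
have aux (T0 Tw Tv Tz a b c d e : R) : Tw = b - c * e -> Tv = - (a - c * d) -> Tz = 0 ->
    T0 - d * Tw - e * Tv + d * e * Tz = 0 -> T0 = b * d - e * a.
  by move=> -> -> ->; lra.
have Bphi z : z *m B x *m F x = z + z *m h_mx A x - eta_ x z *: xi A x.
  rewrite hE// (nabla_xiE A x) mulmxDr mulmxN mulmxDl mulNmx (phi_phi acmA _ Wx).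
  by rewrite mulmxA opprD opprK addrC -!addrA; congr (_ + _); rewrite addrC.
have Txi z y : g x (xi A x *m dF x z) y =
    - (g x (z + z *m h_mx A x) y - eta_ x z * eta_ x y).
  rewrite (xi_cov_phi Wo acmA _ Wx) Bphi metVNl (metVDl _ _ _ (- _)) metVNl metVZl.
  by rewrite (gC (xi A x) y Wx) (metV_xi acmA _ Wx).
have Txi' z y : g x (y *m dF x z) (xi A x) =
    g x (z + z *m h_mx A x) y - eta_ x z * eta_ x y.
  by rewrite (metV_cov_phi Wo acmA _ _ _ Wx) (gC y _ Wx) Txi opprK.
have Pxi z : g x (z + z *m h_mx A x) (xi A x) = eta_ x z.
  by rewrite (metV_xi acmA _ Wx) etaVD eta_h// addr0.
apply: (aux _ _ _ _ _ _ _ _ _ (Txi' u v) (Txi u w)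
  (_ : g x (xi A x *m dF x u) (xi A x) = 0)).
  by rewrite Txi Pxi etaxi// mulr1 subrr oppr0.
have := cov_phi_hor (hor_partP acmA u Wx) (hor_partP acmA v Wx) (hor_partP acmA w Wx).
rewrite /hor_part.
have -> : dF x (u - eta_ x u *: xi A x) = dF x u.
  rewrite -[u - _]addrC -scaleNr (cov_mx_linear Wo sG symG _ _ _ sphi Wx).
  by rewrite (cov_phi_xi Wo acmA contactA Wx) scaler0 add0r.
rewrite mulmxDl mulNmx -scalemxAl !(metVDl, metVNl, metVZl, metVDr, metVNr, metVZr).
have aux2 (p q r s d e : R) : p - e * r + (- (d * q) - e * - (d * s)) = 0 ->
    p - d * q - e * r + d * e * s = 0 by lra.
exact: aux2.
Qed.

(** As for phi, but with S xi = 0, the symmetry of nabla_u S and nabla_xi S = - mu h. *)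
Lemma cov_S_expand (u v w : vec) : (forall z, 'D_z (kappa : _ -> R^o) x = 0 :> R) ->
  g x (v *m dS x u) w =
  - eta_ x v * g x (u *m B x *m S x) w - g x (u *m B x *m S x) v * eta_ x w
  - mu x * eta_ x u * g x (v *m h_mx A x) w.
Proof.
have aux (p q r s y v' X Y h hx hv q1 q2 a b d e : R) :
    p - a * q - e * (r - a * s) - d * (y - a * v' - e * (X - a * Y)) = 0 ->
    q = - b * h -> r = - q2 -> s = - b * hx -> hx = 0 -> y = - q1 -> v' = - b * hv ->
    hv = 0 -> X = 0 -> Y = 0 -> p = - e * q2 - q1 * d - b * a * h.
  move=> E E1 E2 E3 E4 E5 E6 E7 E8 E9.
  by rewrite E1 E2 E3 E4 E5 E6 E7 E8 E9 in E; lra.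
move=> dk.
have Hxi z : eta_ x (z *m h_mx A x) = 0 by exact: eta_h.
have txi z y : g x (xi A x *m dS x z) y = - g x (z *m B x *m S x) y.
  by rewrite (xi_cov_S Wo acmA contactA _ Wx) metVNl.
have txi' z y : g x (y *m dS x z) (xi A x) = - g x (z *m B x *m S x) y.
  by rewrite (metV_cov_S Wo acmA contactA _ _ _ Wx) gC// txi.
have txx z : g x (xi A x *m dS x z) (xi A x) = 0.
  by rewrite txi (metV_xi acmA _ Wx) (eta_S Wo acmA contactA _ Wx) oppr0.
have tX y z : g x (y *m dS x (xi A x)) z = - mu x * g x (y *m h_mx A x) z.
  by rewrite cov_S_xi// -scalemxAr metVZl.
have := cov_S_hor dk (hor_partP acmA u Wx) (hor_partP acmA v Wx) (hor_partP acmA w Wx).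
rewrite /hor_part.
have -> : dS x (u - eta_ x u *: xi A x) = dS x u - eta_ x u *: dS x (xi A x).
  rewrite -[u - _]addrC -scaleNr (cov_mx_linear Wo sG symG _ _ _ sS Wx).
  by rewrite scaleNr addrC.
have X (y : vec) : y *m (dS x u - eta_ x u *: dS x (xi A x)) =
    y *m dS x u - eta_ x u *: (y *m dS x (xi A x)).
  by rewrite mulmxDr mulmxN -scalemxAr.
rewrite mulmxDl mulNmx -scalemxAl !X.
rewrite metV_expand => E0.
have hx0 : g x (xi A x *m h_mx A x) w = 0 by rewrite xi_h// metV0l.
have hv0 : g x (v *m h_mx A x) (xi A x) = 0 by rewrite (metV_xi acmA _ Wx).
exact: (aux _ _ _ _ _ _ _ _ _ _ _ _ _ _ _ _ _ E0 (tX v w) (txi u w) (tX (xi A x) w) hx0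
  (txi' u v) (tX v (xi A x)) hv0 (txx u) (txx (xi A x))).
Qed.

End AtPoint.

End KappaMu.

(** * Derivative of kappa and Ricci identities for phi and S *)

Section KappaMuRicci.
Variables (R : realType) (m : nat) (W : set 'rV[R]_m.+1).
Hypothesis Wo : open W.
Local Notation vec := 'rV[R]_m.+1.
Local Notation mat := 'M[R]_m.+1.
Variable A : acm_components R m.
Hypothesis acmA : acm_axioms A W.
Hypothesis contactA : forall u v x, W x ->
  deta A (fun=> u) (fun=> v) x = metV A x u (v *m phi A x).
Local Notation G := (met A).
Local Notation g := (metV A).
Local Notation eta_ := (etaV A).
Local Notation B := (nabla_xi A).
Local Notation S := (S_mx A).
Local Notation F := (phi A).
Local Notation h := (h_mx A).
Local Notation dF := (cov_mx G F).
Local Notation dS := (cov_mx G S).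
Variables (kappa mu : vec -> R).
Hypothesis skappa : smooth_on W (kappa : vec -> R^o).
Hypothesis kmA : forall x u v, W x -> xi A x *m Riem G x u v =
  kappa x *: (eta_ x v *: u - eta_ x u *: v)
  + mu x *: (eta_ x v *: (u *m h_mx A x) - eta_ x u *: (v *m h_mx A x)).

Let sG : smooth_on W G. Proof. exact: met_smooth acmA. Qed.
Let sphi : smooth_on W F. Proof. exact: phi_smooth acmA. Qed.
Let sxi : smooth_on W (xi A). Proof. exact: xi_smooth acmA. Qed.
Let seta : smooth_on W (eta A). Proof. exact: eta_smooth acmA. Qed.
Let symG x : W x -> (G x)^T = G x.
Proof. by move=> Wx; exact: (met_symmx acmA Wx). Qed.
Let uG x : W x -> G x \in unitmx.
Proof. by move=> Wx; exact: (met_unit acmA Wx). Qed.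
Let sS : smooth_on W S. Proof. exact: (smooth_S Wo acmA). Qed.
Let sB : smooth_on W B. Proof. exact: (smooth_nabla_xi Wo acmA). Qed.
Let gC x u v : W x -> g x u v = g x v u.
Proof. by move=> Wx; exact: (met_sym acmA _ _ Wx). Qed.
Let hE x : W x -> h x = S x *m F x.
Proof. by move=> Wx; exact: (h_mxE Wo acmA contactA Wx). Qed.

Lemma smooth_h : smooth_on W h.
Proof.
by apply: (smooth_on_eq Wo) (smooth_mulmx Wo sS sphi) => y /[!inE] Wy; rewrite hE.
Qed.

Lemma metV_ge0 (x u : vec) : W x -> 0 <= g x u u.
Proof.
move=> Wx; have [->|u0] := eqVneq u 0; first by rewrite metV0l.
exact/ltW/(met_pos acmA Wx u0).
Qed.

(** For a horizontal y, the squared length of S y is (1 - kappa) times that of y. *)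
Lemma kappa_le1 (x : vec) : W x -> (3 < m.+1)%N -> kappa x <= 1.
Proof.
move=> Wx m3; have [y [y0 hy _ _]] := exists_hor_perp acmA 0 Wx m3.
have := metV_ge0 (y *m S x) Wx.
rewrite -(metV_S Wo acmA contactA _ _ Wx) (hor_S_S Wo acmA contactA kmA Wx hy) metVZl.
by rewrite pmulr_lge0 ?subr_ge0// (met_pos acmA Wx y0).
Qed.

Lemma metV_phi_alt (x u : vec) : W x -> g x (u *m F x) u = 0.
Proof.
move=> Wx; have := metV_phi_skew acmA u u Wx; rewrite (gC u _ Wx).
have aux (a : R) : a = - a -> a = 0 by lra.
exact: aux.
Qed.

(** Along xi, nabla S = - mu phi S, so both terms of [cov_S_sq] on the pair (y, y) have the form
    g(phi v, v) = 0. *)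
Lemma derive_kappa_xi (x : vec) : W x -> (3 < m.+1)%N ->
  'D_(xi A x) (kappa : _ -> R^o) x = 0 :> R.
Proof.
move=> Wx m3; have [y [y0 hy _ _]] := exists_hor_perp acmA 0 Wx m3.
have E := cov_S_sq Wo acmA contactA skappa kmA (xi A x) Wx hy hy.
rewrite (cov_S_xi Wo acmA contactA kmA Wx) in E.
have e1 : g x (y *m S x *m (- mu x *: h x)) y = 0.
  rewrite -scalemxAr metVZl hE// mulmxA (hor_S_S Wo acmA contactA kmA Wx hy).
  by rewrite -scalemxAl metVZl metV_phi_alt// !mulr0.
have e2 : g x (y *m (- mu x *: h x)) (y *m S x) = 0.
  by rewrite -scalemxAr metVZl hE// mulmxA metV_phi_alt// mulr0.
move: E; rewrite e1 e2 add0r => /esym/eqP; rewrite mulf_eq0 oppr_eq0.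
by rewrite (negbTE (metV_neq0 acmA Wx y0)) orbF => /eqP.
Qed.

Lemma derive_kappa_eq0 (x u : vec) : W x -> (3 < m.+1)%N -> kappa x != 1 ->
  'D_u (kappa : _ -> R^o) x = 0 :> R.
Proof.
move=> Wx m3 k1.
have -> : u = eta_ x u *: xi A x + hor_part A x u by rewrite /hor_part addrC subrK.
rewrite (derive_linear _ _ _ skappa Wx) derive_kappa_xi// scaler0 add0r.
exact: (derive_kappa_hor Wo acmA contactA skappa kmA Wx k1 m3 (hor_partP acmA u Wx)).
Qed.

Section OuterProducts.
Variables (a : vec -> vec) (x w z t : vec).
Hypothesis sa : smooth_on W a.
Hypothesis Wx : W x.
Hypothesis hz : eta_ x z = 0.
Hypothesis ht : eta_ x t = 0.

(** The derivative of [a] is multiplied by eta(z) = 0. Hence no derivative of h is ever needed when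
    nabla phi is differentiated again. *)
Lemma cov_eta_outer :
  g x (z *m cov_mx G (fun y => eta A y *m a y) x w) t = g x z (w *m B x) * g x (a x) t.
Proof.
rewrite (cov_outer G w Wx sa seta) (cov_eta Wo acmA _ Wx) mulmxDr mul_dual_row mul_eta_row.
by rewrite hz scale0r addr0 metVZl.
Qed.

Lemma cov_dual_outer :
  g x (z *m cov_mx G (fun y => G y *m (a y)^T *m xi A y) x w) t =
  g x z (a x) * g x (w *m B x) t.
Proof.
rewrite (cov_outer G w Wx sxi (smooth_mulmx Wo sG (smooth_trmx Wo sa))).
rewrite (cov_lower Wo sG symG uG w Wx sa) mulmxDr mul_dual_row -(mul_nabla_xi Wo acmA _ Wx).
rewrite -(mulmxA (G x)) (mulmxA (G x)) mul_dual_row metVDl !metVZl.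
by rewrite (gC (xi A x) t Wx) (metV_xi acmA _ Wx) ht mulr0 add0r.
Qed.

End OuterProducts.

Section Constant.
Hypothesis kappa_neq1 : forall y, W y -> kappa y != 1.

Lemma cov_phi_mx (y u : vec) : W y ->
  dF y u = G y *m (u *m (1%:M + h y))^T *m xi A y - eta A y *m (u *m (1%:M + h y)).
Proof.
move=> Wy; apply: mulmx_row_inj => v; apply: (metV_inj acmA Wy) => w.
rewrite mulmxDr mulmxN mul_dual_row mul_eta_row metVDl metVNl !metVZl mulmxDr mulmx1.
rewrite (gC (xi A y) w Wy) (metV_xi acmA _ Wy) (gC v _ Wy).
exact: (cov_phi_expand Wo acmA contactA kmA Wy (kappa_neq1 Wy)).
Qed.

(** [cov_phi_mx] is a difference of outer products with xi or eta, so its horizontal derivative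
    involves only nabla xi and undifferentiated factors. *)
Lemma ricci_phi (x u w z t : vec) : W x -> eta_ x z = 0 -> eta_ x t = 0 ->
  g x (z *m F x *m Riem G x w u) t - g x (z *m Riem G x w u *m F x) t =
  g x z (u *m (1%:M + h x)) * g x (w *m B x) t - g x z (w *m B x) * g x (u *m (1%:M + h x)) t
  - (g x z (w *m (1%:M + h x)) * g x (u *m B x) t
     - g x z (u *m B x) * g x (w *m (1%:M + h x)) t).
Proof.
move=> Wx hz ht.
have sP : smooth_on W (fun y => 1%:M + h y).
  by apply: (smoothD Wo); [exact: (smooth_cst Wo)|exact: smooth_h].
have K a b : g x (z *m cov_mx G (fun y => dF y a) x b) t =
    g x z (a *m (1%:M + h x)) * g x (b *m B x) t
    - g x z (b *m B x) * g x (a *m (1%:M + h x)) t.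
  have sa := smooth_mulmx Wo (smooth_cst Wo a) sP.
  have s1 := smooth_mulmx Wo (smooth_mulmx Wo sG (smooth_trmx Wo sa)) sxi.
  have s2 := smooth_mulmx Wo seta sa.
  rewrite (cov_mx_eq_on Wo A _ (fun y => @cov_phi_mx y a) Wx).
  rewrite (cov_mxD G b Wx s1 (smoothN Wo s2)) (cov_mxN G b Wx s2) (mulmxBr z) metVDl metVNl.
  by rewrite (cov_dual_outer b z sa Wx ht) (cov_eta_outer b t sa Wx hz).
have E := congr1 (fun N => g x (z *m N) t) (ricci_mx Wo sG uG w Wx sphi u).
rewrite /= !(mulmxBr z) !metVDl !metVNl !(mulmxA z) in E.
exact: etrans (esym E) (congr2 (fun p q => p - q) (K u w) (K w u)).
Qed.

Hypothesis smu : smooth_on W (mu : vec -> R^o).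
Hypothesis kappa_cst : forall y z, W y -> 'D_z (kappa : _ -> R^o) y = 0 :> R.

Lemma cov_S_mx (y u : vec) : W y ->
  dS y u = - (eta A y *m (u *m (B y *m S y))) - G y *m (u *m (B y *m S y))^T *m xi A y
           - (mu y * eta_ y u) *: h y.
Proof.
move=> Wy; apply: mulmx_row_inj => v; apply: (metV_inj acmA Wy) => w.
rewrite !mulmxDr !mulmxN mul_dual_row mul_eta_row !metVDl !metVNl -scalemxAr !metVZl.
rewrite (gC (xi A y) w Wy) (metV_xi acmA _ Wy) (gC v _ Wy) mulmxA.
rewrite (cov_S_expand Wo acmA contactA skappa kmA Wy (kappa_neq1 Wy) u v w).
  by rewrite mulNr.
by move=> z'; exact: kappa_cst.
Qed.

Lemma derive_eta_cst (x u w : vec) : W x ->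
  'D_w (fun y => eta_ y u : R^o) x = (u *m 'D_w (eta A) x) 0 0.
Proof.
move=> Wx; rewrite -(derive_mulmxl Wo u w seta Wx) derive_mxE//.
exact: smooth_derivable (smooth_mulmx Wo (smooth_cst Wo u) seta) Wx.
Qed.

(** In the term mu eta(u) h of nabla S, the factor eta(u) vanishes at [x]: the derivatives of mu and
    h disappear, and antisymmetrizing the derivative of eta gives 2 d eta(w, u) = 2 g(w, phi u). *)
Lemma ricci_S (x u w z t : vec) : W x ->
  eta_ x u = 0 -> eta_ x w = 0 -> eta_ x z = 0 -> eta_ x t = 0 ->
  g x (z *m S x *m Riem G x w u) t - g x (z *m Riem G x w u *m S x) t =
  - (g x z (w *m B x) * g x (u *m (B x *m S x)) t) - g x z (u *m (B x *m S x)) * g x (w *m B x) t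
  + g x z (u *m B x) * g x (w *m (B x *m S x)) t + g x z (w *m (B x *m S x)) * g x (u *m B x) t
  - 2 * mu x * g x w (u *m F x) * g x (z *m h x) t.
Proof.
have aux (a b c d e f l v1 v2 : R) : v1 - v2 = 2 * e ->
    - a - b - (l * v1) * f - (- c - d - (l * v2) * f) = - a - b + c + d - 2 * l * e * f.
  by move=> E; have -> : v1 = v2 + 2 * e by [rewrite -E; ring]; ring.
have half (p q : R) : p - q = 2 * (2^-1 * (p - q)) by field.
move=> Wx hu hw hz ht.
have sBS := smooth_mulmx Wo sB sS.
have se a : smooth_on W (fun y => eta_ y a : R^o).
  exact: (smooth_mxP Wo _).1 (smooth_mulmx Wo (smooth_cst Wo a) seta) 0 0.
have K a b : eta_ x a = 0 -> g x (z *m cov_mx G (fun y => dS y a) x b) t =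
    - (g x z (b *m B x) * g x (a *m (B x *m S x)) t)
    - g x z (a *m (B x *m S x)) * g x (b *m B x) t
    - (mu x * (a *m 'D_b (eta A) x) 0 0) * g x (z *m h x) t.
  move=> ha; have sa := smooth_mulmx Wo (smooth_cst Wo a) sBS.
  have s1 := smooth_mulmx Wo (smooth_mulmx Wo sG (smooth_trmx Wo sa)) sxi.
  have s2 := smooth_mulmx Wo seta sa.
  have s3 := smoothM Wo smu (se a).
  have s4 := smoothZ Wo s3 smooth_h.
  rewrite (cov_mx_eq_on Wo A _ (fun y => @cov_S_mx y a) Wx).
  rewrite (cov_mxD G b Wx (smoothB Wo (smoothN Wo s2) s1) (smoothN Wo s4)) (cov_mxN G b Wx s4).
  rewrite (cov_mxD G b Wx (smoothN Wo s2) (smoothN Wo s1)) (cov_mxN G b Wx s2) (cov_mxN G b Wx s1).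
  rewrite (cov_mxZ Wo G b Wx smooth_h s3) ha mulr0 scale0r addr0.
  have -> : 'D_b (fun y => mu y * eta_ y a : R^o) x = mu x * (a *m 'D_b (eta A) x) 0 0.
    rewrite (deriveM (smooth_derivable smu Wx) (smooth_derivable (se a) Wx)).
    by rewrite ha scale0r addr0 (derive_eta_cst _ _ Wx).
  rewrite !(mulmxBr z) (mulmxN z) -scalemxAr !metVDl !metVNl metVZl.
  by rewrite (cov_dual_outer b z sa Wx ht) (cov_eta_outer b t sa Wx hz).
have E := congr1 (fun N => g x (z *m N) t) (ricci_mx Wo sG uG w Wx sS u).
rewrite /= !(mulmxBr z) !metVDl !metVNl !(mulmxA z) in E.
have D : (u *m 'D_w (eta A) x) 0 0 - (w *m 'D_u (eta A) x) 0 0 = 2 * g x w (u *m F x).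
  rewrite -contactA// (deta_cst Wo acmA _ _ Wx).
  exact: half.
apply: etrans (esym E) (etrans (congr2 (fun p q => p - q) (K u w hu) (K w u hw)) _).
exact: aux D.
Qed.

End Constant.
End KappaMuRicci.

(** * Algebraic curvature tensors *)

Section CurvatureLike.
Variables (R : realFieldType) (V : lmodType R) (Q : V -> V -> V -> V -> R).
Hypothesis QD1 : forall a x x' y z w, Q (a *: x + x') y z w = a * Q x y z w + Q x' y z w.
Hypothesis QD3 : forall a x y z z' w, Q x y (a *: z + z') w = a * Q x y z w + Q x y z' w.
Hypothesis Qskew12 : forall x y z w, Q x y z w = - Q y x z w.
Hypothesis Qskew34 : forall x y z w, Q x y z w = - Q x y w z.
Hypothesis Qbianchi : forall x y z w, Q x y z w + Q y z x w + Q z x y w = 0.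

Lemma QD2 a x y y' z w : Q x (a *: y + y') z w = a * Q x y z w + Q x y' z w.
Proof.
by rewrite Qskew12 QD1 (Qskew12 x y) (Qskew12 x y'); ring.
Qed.

Lemma QD4 a x y z w w' : Q x y z (a *: w + w') = a * Q x y z w + Q x y z w'.
Proof.
by rewrite Qskew34 QD3 (Qskew34 x y z w) (Qskew34 x y z w'); ring.
Qed.

(** Reduces the phi-sectional curvature of an arbitrary horizontal vector to that of a unit
    vector. *)
Lemma curvature_like_scale a x y z w :
  Q (a *: x) (a *: y) (a *: z) (a *: w) = a ^+ 4 * Q x y z w.
Proof.
have Q0 y' z' w' : Q 0 y' z' w' = 0.
  by have := QD1 1 0 0 y' z' w'; rewrite scaler0 addr0 mul1r; lra.
have Q1 x' y' z' w' : Q (a *: x') y' z' w' = a * Q x' y' z' w'.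
  by rewrite -[a *: x']addr0 QD1 Q0 addr0.
have Q3 x' y' z' w' : Q x' y' (a *: z') w' = a * Q x' y' z' w'.
  have : Q x' y' 0 w' = 0 by have := QD3 1 x' y' 0 0 w'; rewrite scaler0 addr0 mul1r; lra.
  by rewrite -[a *: z']addr0 QD3 => ->; rewrite addr0.
by rewrite Q1 Qskew12 Q1 -mulrN -Qskew12 Q3 Qskew34 Q3 -mulrN -Qskew34; ring.
Qed.

Lemma pair_sym x y z w : Q x y z w = Q z w x y.
Proof.
have b1 := Qbianchi x y z w; have b2 := Qbianchi y z w x.
have b3 := Qbianchi z w x y; have b4 := Qbianchi w x y z.
have s1 := Qskew34 x y z w; have s2 := Qskew34 z w x y; have s3 := Qskew34 y z x w.
have s4 := Qskew34 w x y z; have s5 := Qskew34 z x y w; have s6 := Qskew34 y w z x.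
have t1 := Qskew12 x y w z; have t2 := Qskew12 z w y x; have t3 := Qskew12 z x y w.
have t4 := Qskew12 y w z x; have t5 := Qskew12 x z w y; have t6 := Qskew12 w y x z.
have t7 := Qskew34 x z w y; have t8 := Qskew34 w y x z.
lra.
Qed.

Section Kaehler.
Variables (hor : V -> Prop) (J : V -> V).
Hypothesis horD : forall a x y, hor x -> hor y -> hor (a *: x + y).
Hypothesis horJ : forall x, hor x -> hor (J x).
Hypothesis JJ : forall x, hor x -> J (J x) = (-1) *: x + 0.
Hypothesis JD : forall a x y, J (a *: x + y) = a *: J x + J y.
Hypothesis QJ : forall x y z w, hor x -> hor y -> hor z -> hor w ->
  Q x y (J z) (J w) = Q x y z w.
Hypothesis hol0 : forall x, hor x -> Q x (J x) (J x) x = 0.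

Let Q01 y z w : Q 0 y z w = 0.
Proof. by have := QD1 1 0 0 y z w; rewrite scaler0 addr0 mul1r; lra. Qed.
Let QN1 x y z w : Q ((-1) *: x + 0) y z w = - Q x y z w.
Proof. by rewrite QD1 Q01 addr0 mulN1r. Qed.
Let QN2 x y z w : Q x ((-1) *: y + 0) z w = - Q x y z w.
Proof. by rewrite Qskew12 QN1 -Qskew12. Qed.
Let QN3 x y z w : Q x y ((-1) *: z + 0) w = - Q x y z w.
Proof. by rewrite pair_sym QN1 -pair_sym. Qed.
Let QJ12 x y z w : hor x -> hor y -> hor z -> hor w -> Q (J x) (J y) z w = Q x y z w.
Proof. by move=> *; rewrite pair_sym QJ// -pair_sym. Qed.

(** Adding the quartic identity at x + y and at - x + y removes the terms of odd degree in x; the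
    pure fourth powers vanish by hypothesis. *)
Let hol_polar x y : hor x -> hor y ->
  Q x (J x) (J y) y + Q x (J y) (J x) y + Q x (J y) (J y) x
  + Q y (J x) (J x) y + Q y (J x) (J y) x + Q y (J y) (J x) x = 0.
Proof.
move=> hx hy.
have h1 := hol0 hx; have h2 := hol0 hy.
have h3 := hol0 (horD 1 hx hy); have h4 := hol0 (horD (-1) hx hy).
rewrite !JD in h3 h4.
rewrite !(QD1, QD2, QD3, QD4) in h3; rewrite !(QD1, QD2, QD3, QD4) in h4.
lra.
Qed.

(** The six terms of [hol_polar] reduce to two values p and s, with 2 p + 4 s = 0, where p = Q(x,
    Jx, Jy, y) and s = Q(x, Jy, Jy, x). Bianchi gives Q(x, y, y, x) = p - s = - 3 s. *)
Let sectional x y : hor x -> hor y -> Q x y y x = - 3 * Q x (J y) (J y) x.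
Proof.
move=> hx hy; have hx' := horJ hx; have hy' := horJ hy.
have p := hol_polar hx hy.
have a1 : Q y (J x) (J x) y = Q x (J y) (J y) x.
  have e1 := QJ12 hy hx' hx' hy; rewrite JJ// QN2 in e1.
  have e2 := QJ hy' hx hx' hy; rewrite JJ// QN3 in e2.
  by have e3 := Qskew12 (J y) x x (J y); have e4 := Qskew34 x (J y) x (J y); lra.
have a2 : Q y (J y) (J x) x = Q x (J x) (J y) y.
  by rewrite pair_sym Qskew12 Qskew34 opprK.
have a3 : Q x (J y) (J x) y = Q x (J y) (J y) x.
  by rewrite -(QJ hx hy' hx' hy) JJ// QN3 -Qskew34.
have a4 : Q y (J x) (J y) x = Q x (J y) (J x) y.
  by rewrite pair_sym Qskew12 Qskew34 opprK.
have b := Qbianchi x (J x) (J y) y.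
have b1 := QJ12 hx hy hx hy; have b2 := Qskew34 x y x y; have b3 := Qskew12 (J y) x (J x) y.
lra.
Qed.

(** Applying [sectional] to y and then to J y multiplies the value by 9. *)
Let sectional0 x y : hor x -> hor y -> Q x y y x = 0.
Proof.
move=> hx hy; have s1 := sectional hx hy; have s2 := sectional hx (horJ hy).
by rewrite JJ// QN2 QN3 opprK in s2; lra.
Qed.

(** Polarization of Q(x, y, y, x) = 0 makes Q invariant under cyclic permutation of its first three
    arguments, so Bianchi reads 3 Q = 0. *)
Lemma kaehler_hol_eq0 x y z w : hor x -> hor y -> hor z -> hor w -> Q x y z w = 0.
Proof.
have s1 a b c : hor a -> hor b -> hor c -> Q a b c a = 0.
  move=> ha hb hc; have := sectional0 ha (horD 1 hb hc).
  rewrite !(QD2, QD3) !sectional0//; have := pair_sym a c b a.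
  by rewrite (Qskew12 b) (Qskew34 a b a c) opprK; lra.
have s2 a b c d : hor a -> hor b -> hor c -> hor d -> Q a b c d = - Q d b c a.
  move=> ha hb hc hd; have := s1 _ _ _ (horD 1 ha hd) hb hc.
  by rewrite QD1 !QD4 !s1//; lra.
have s3 a b c d : hor a -> hor b -> hor c -> hor d -> Q b c a d = Q a b c d.
  move=> ha hb hc hd; rewrite Qskew12 s2// opprK Qskew34 s2// !opprK.
  by [].
move=> hx hy hz hw; have b := Qbianchi x y z w.
have c1 := s3 x y z w hx hy hz hw; have c2 := s3 y z x w hy hz hx hw.
lra.
Qed.

End Kaehler.

Lemma curvature_like_eq0 (xi : V) (eta : V -> R) :
  (forall x y z w, eta x = 0 -> eta y = 0 -> eta z = 0 -> eta w = 0 -> Q x y z w = 0) ->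
  (forall x, eta (- eta x *: xi + x) = 0) ->
  (forall x y w, Q x y xi w = 0) -> forall x y z w, Q x y z w = 0.
Proof.
move=> Q0 hor Qxi x y z w.
have Q4 a b c : Q a b c xi = 0 by rewrite Qskew34 Qxi oppr0.
have Q1 a b c : Q xi a b c = 0 by rewrite pair_sym Qxi.
have Q2 a b c : Q a xi b c = 0 by rewrite Qskew12 Q1 oppr0.
have := Q0 _ _ _ _ (hor x) (hor y) (hor z) (hor w).
by rewrite QD1 Q1 mulr0 add0r QD2 Q2 mulr0 add0r QD3 Qxi mulr0 add0r QD4 Q4 mulr0 add0r.
Qed.

End CurvatureLike.

(** * The model curvature tensor at a point *)

Section SpaceForm.
Variables (R : realFieldType) (V : lmodType R).
Variables (g : V -> V -> R) (J h : V -> V) (xi : V).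
Local Notation eta x := (g x xi).
Hypothesis gD : forall a x x' y, g (a *: x + x') y = a * g x y + g x' y.
Hypothesis gC : forall x y, g x y = g y x.
Hypothesis gJ : forall x y, g (J x) y = - g x (J y).
Hypothesis gh : forall x y, g (h x) y = g x (h y).
Hypothesis JD : forall a x y, J (a *: x + y) = a *: J x + J y.
Hypothesis hD : forall a x y, h (a *: x + y) = a *: h x + h y.
Hypothesis JJ : forall x, J (J x) = - x + eta x *: xi.
Hypothesis hJ : forall x, h (J x) = - J (h x).
Hypothesis Jxi : J xi = 0.
Hypothesis hxi : h xi = 0.
Hypothesis etaxi : eta xi = 1.

(** The value g(R(w, u) z, t) for R = f1 R1 + ... + f6 R6. *)
Definition space_form_tensor (f1 f2 f3 f4 f5 f6 : R) (w u z t : V) : R :=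
  f1 * (g u z * g w t - g w z * g u t)
  + f2 * (g w (J z) * g (J u) t - g u (J z) * g (J w) t + 2 * g w (J u) * g (J z) t)
  + f3 * (eta w * eta z * g u t - eta u * eta z * g w t
          + g w z * eta u * eta t - g u z * eta w * eta t)
  + f4 * (g u z * g (h w) t - g w z * g (h u) t + g (h u) z * g w t - g (h w) z * g u t)
  + f5 * (g (h u) z * g (h w) t - g (h w) z * g (h u) t
          + g (J (h w)) z * g (J (h u)) t - g (J (h u)) z * g (J (h w)) t)
  + f6 * (eta w * eta z * g (h u) t - eta u * eta z * g (h w) t
          + g (h w) z * eta u * eta t - g (h u) z * eta w * eta t).

Let g0 y : g 0 y = 0.
Proof. by have := gD 1 0 0 y; rewrite scaler0 addr0 mul1r; lra. Qed.
Let gZ a x y : g (a *: x) y = a * g x y.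
Proof. by have := gD a x 0 y; rewrite !addr0 g0 addr0. Qed.
Let gN x y : g (- x) y = - g x y.
Proof. by rewrite -scaleN1r gZ mulN1r. Qed.
Let gNr x y : g x (- y) = - g x y.
Proof. by rewrite gC gN gC. Qed.
Let gDl x x' y : g (x + x') y = g x y + g x' y.
Proof. by rewrite -[x]scale1r gD mul1r scale1r. Qed.
Let gDr a y z x : g x (a *: y + z) = a * g x y + g x z.
Proof. by rewrite gC gD !(gC x). Qed.
Let JZ a x : J (a *: x) = a *: J x.
Proof.
have J0 : J 0 = 0.
  have /eqP := JD 1 0 0; rewrite scaler0 addr0 scale1r -subr_eq subrr eq_sym.
  by move/eqP.
by rewrite -[_ *: x]addr0 JD J0 addr0.
Qed.
Let JN x : J (- x) = - J x. Proof. by rewrite -scaleN1r JZ scaleN1r. Qed.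
Let etaJ x : g (J x) xi = 0. Proof. by rewrite gJ Jxi gC g0 oppr0. Qed.
Let etah x : g (h x) xi = 0. Proof. by rewrite gh hxi gC g0. Qed.
Let gJC x y : g x (J y) = - g y (J x). Proof. by rewrite -gJ gC. Qed.
Let ghC x y : g (h x) y = g (h y) x. Proof. by rewrite gh gC. Qed.
Let ghJC x y : g (h x) (J y) = g (h y) (J x).
Proof. by rewrite gh hJ gNr -gJ gC. Qed.

Let gJJ x y : g (J x) (J y) = g x y - eta x * eta y.
Proof. by rewrite gJ JJ addrC gDr gNr; ring. Qed.
Let gJJr x y : g x (J (J y)) = - g x y + eta y * eta x.
Proof. by rewrite JJ addrC gDr gNr addrC. Qed.

Section Coefficients.
Variables f1 f2 f3 f4 f5 f6 : R.
Local Notation Q := (space_form_tensor f1 f2 f3 f4 f5 f6).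

Lemma space_form_linear1 a x x' y z w : Q (a *: x + x') y z w = a * Q x y z w + Q x' y z w.
Proof. by rewrite /space_form_tensor !JD !hD !JD !gD; ring. Qed.

Lemma space_form_linear3 a x y z z' w : Q x y (a *: z + z') w = a * Q x y z w + Q x y z' w.
Proof. by rewrite /space_form_tensor !JD !gDr !gD; ring. Qed.

Lemma space_form_skew12 x y z w : Q x y z w = - Q y x z w.
Proof. by rewrite /space_form_tensor (gJC x y); ring. Qed.

Lemma space_form_skew34 x y z w : Q x y z w = - Q x y w z.
Proof. by rewrite /space_form_tensor !gJ (gJC z w); ring. Qed.

Lemma space_form_bianchi x y z w : Q x y z w + Q y z x w + Q z x y w = 0.
Proof.
rewrite /space_form_tensor !gJ (gC y x) (gC z x) (gC z y) (gJC y x) (gJC z x) (gJC z y).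
rewrite (ghC y x) (ghC z x) (ghC z y) (ghJC y x) (ghJC z x) (ghJC z y).
ring.
Qed.

Lemma space_form_xi x y w : Q x y xi w =
  (f1 - f3) * (eta y * g x w - eta x * g y w)
  + (f4 - f6) * (eta y * g (h x) w - eta x * g (h y) w).
Proof.
rewrite /space_form_tensor Jxi !(etaJ, etah) !etaxi !(gC _ 0) !g0.
ring.
Qed.

(** The contributions of f4 and of f5 cancel because h anticommutes with J, and those of f3 and f6
    contain eta(x) or eta(J x), both zero. *)
Lemma space_form_hol x : eta x = 0 -> Q x (J x) (J x) x = (f1 + 3 * f2) * g x x ^+ 2.
Proof.
move=> ex; have J2 : J (J x) = - x by rewrite JJ ex scale0r addr0.
have gxJ : g x (J x) = 0 by have := gJC x x; lra.
have gJx : g (J x) x = 0 by rewrite gC.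
have J2h : J (J (h x)) = - h x by rewrite JJ etah scale0r addr0.
have JhJ : J (h (J x)) = h x by rewrite hJ JN J2h opprK.
rewrite /space_form_tensor !JhJ !J2 !hJ !gJJ !gJ ?J2 ?gJJr !(gN, gNr, etah, ex, gxJ, gJx).
by rewrite Jxi JN gNr gxJ (gC x 0) g0 !gJJ !gJ !(etah, ex); ring.
Qed.

End Coefficients.

(* The failure of the curvature of a (kappa, mu)-space to commute with [phi] on
   horizontal vectors, where [P = 1 + h] and [nabla_w xi = - phi (P w)]. *)
Definition phi_defect (w u z t : V) : R :=
  g z (u + h u) * g (- J (w + h w)) t - g z (- J (w + h w)) * g (u + h u) t
  - (g z (w + h w) * g (- J (u + h u)) t - g z (- J (u + h u)) * g (w + h w) t).

Lemma space_form_phi_defect (w u z t : V) (c : R) :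
  eta w = 0 -> eta u = 0 -> eta z = 0 -> eta t = 0 ->
  let Q := space_form_tensor ((c + 1) / 2) ((c - 1) / 2) ((3 * c + 1) / 2) 1 (1 / 2) c in
  Q w u (J z) (J t) - Q w u z t = phi_defect w u z (J t).
Proof.
move=> ew eu ez et /=; rewrite /space_form_tensor /phi_defect.
rewrite !(gC z) !(gN, gJJ) !gJ !gJJr !gDl !(etaJ, etah, ew, eu, ez, et).
by field.
Qed.

Section Determination.
Variables (f1 f2 f3 f4 f5 f6 lambda mu : R) (e e1 : V).
Local Notation Q := (space_form_tensor f1 f2 f3 f4 f5 f6).
Hypothesis lambda_neq0 : lambda != 0.
Hypothesis ee0 : g e e != 0.
Hypothesis e1e10 : g e1 e1 != 0.
Hypothesis eta_e : eta e = 0.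
Hypothesis eta_e1 : eta e1 = 0.
Hypothesis he : h e = lambda *: e.
Hypothesis he1 : h e1 = lambda *: e1.
Hypothesis ee1 : g e e1 = 0.
Hypothesis eJe1 : g e (J e1) = 0.
Hypothesis phi_identity : forall w u z t,
  eta w = 0 -> eta u = 0 -> eta z = 0 -> eta t = 0 ->
  Q w u (J z) (J t) - Q w u z t = phi_defect w u z (J t).
Hypothesis S_identity : forall w u z t,
  eta w = 0 -> eta u = 0 -> eta z = 0 -> eta t = 0 ->
  - Q w u (J (h z)) t + Q w u z (J (h t)) =
  - (g z (- J (w + h w)) * g (h u + h (h u)) t) - g z (h u + h (h u)) * g (- J (w + h w)) t
  + g z (- J (u + h u)) * g (h w + h (h w)) t + g z (h w + h (h w)) * g (- J (u + h u)) t
  - 2 * mu * g w (J u) * g (h z) t.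

Let hZ a x : h (a *: x) = a *: h x.
Proof.
have h0 : h 0 = 0.
  have /eqP := hD 1 0 0; rewrite scaler0 addr0 scale1r -subr_eq subrr eq_sym.
  by move/eqP.
by rewrite -[_ *: x]addr0 hD h0 addr0.
Qed.
Let JDl x y : J (x + y) = J x + J y.
Proof. by have := JD 1 x y; rewrite !scale1r. Qed.
Let hN x : h (- x) = - h x. Proof. by rewrite -scaleN1r hZ scaleN1r. Qed.
Let gZr a x y : g x (a *: y) = a * g x y. Proof. by rewrite gC gZ gC. Qed.
Let gDr' x y z : g x (y + z) = g x y + g x z. Proof. by rewrite gC gDl !(gC x). Qed.
Let e1e : g e1 e = 0. Proof. by rewrite gC. Qed.
Let e1Je : g e1 (J e) = 0. Proof. by rewrite gJC eJe1 oppr0. Qed.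
Let eJe : g e (J e) = 0. Proof. by have := gJC e e; lra. Qed.
Let e1Je1 : g e1 (J e1) = 0. Proof. by have := gJC e1 e1; lra. Qed.
Let hJe : h (J e) = - (lambda *: J e). Proof. by rewrite hJ he JZ. Qed.
Let hJe1 : h (J e1) = - (lambda *: J e1). Proof. by rewrite hJ he1 JZ. Qed.
Let JJe : J (J e) = - e. Proof. by rewrite JJ eta_e scale0r addr0. Qed.
Let JJe1 : J (J e1) = - e1. Proof. by rewrite JJ eta_e1 scale0r addr0. Qed.
Let vecE := (he, he1, hJe, hJe1, JZ, JDl, hZ, JN, hN, JJe, JJe1).
Let gE := (gDl, gDr', gN, gNr, gZ, gZr).
Let gJxi x : g x (J xi) = 0. Proof. by rewrite Jxi gC g0. Qed.
Let gramE := (e1e, e1Je, eJe, e1Je1, ee1, eJe1, eta_e, eta_e1, etaJ, gJxi).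

(** J e and J e1 are eigenvectors for - lambda. The commutation identities are evaluated on pairs
    with equal or opposite eigenvalues, and the coefficients are separated by their parity in
    lambda. *)
Lemma space_form_determined :
  [/\ f4 = 1, f5 = 1 / 2, f2 = f1 - 1, 4 * f1 - 3 = - (1 - lambda ^+ 2) - mu & 2 * f2 = - mu].
Proof.
have k1 := phi_identity eta_e eta_e1 eta_e1 eta_e.
have k2 := phi_identity (etaJ e) (etaJ e1) (etaJ e1) (etaJ e).
have k3 := phi_identity eta_e (etaJ e1) (etaJ e1) eta_e.
have k4 := S_identity eta_e (etaJ e) eta_e eta_e.
have k5 := S_identity eta_e (etaJ e) eta_e1 eta_e1.
rewrite /space_form_tensor /phi_defect in k1 k2 k3 k4 k5.
(* Each evaluated identity is a known nonzero factor, a product of squared lengths and possibly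
   lambda, times the linear equation sought. *)
have cancel (c x y z : R) : c != 0 -> x = y -> x - y = c * z -> z = 0.
  by move=> c0 ->; rewrite subrr => /esym/eqP; rewrite mulf_eq0 (negbTE c0) => /eqP.
have NM0 : g e e * g e1 e1 != 0 by rewrite mulf_neq0.
have r1 : f2 - f1 - 2 * lambda * f4 - 2 * lambda ^+ 2 * f5 + (1 + lambda) ^+ 2 = 0.
  apply: (cancel _ _ _ _ NM0 k1).
  by do 3 rewrite ?vecE ?gE ?gJJ ?gJ ?gramE; ring.
have r2 : f2 - f1 + 2 * lambda * f4 - 2 * lambda ^+ 2 * f5 + (1 - lambda) ^+ 2 = 0.
  apply: (cancel _ _ _ _ NM0 k2).
  by do 3 rewrite ?vecE ?gE ?gJJ ?gJ ?gramE; ring.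
have r3 : f2 - f1 + 2 * lambda ^+ 2 * f5 + (1 - lambda ^+ 2) = 0.
  apply: (cancel _ _ _ _ NM0 k3).
  by do 3 rewrite ?vecE ?gE ?gJJ ?gJ ?gramE; ring.
have l0 : lambda * g e e ^+ 2 != 0 by rewrite mulf_neq0// expf_neq0.
have r4 : - 2 * (f1 + 3 * f2 + (1 - lambda ^+ 2) + mu) = 0.
  apply: (cancel _ _ _ _ l0 k4).
  by do 3 rewrite ?vecE ?gE ?gJJ ?gJ ?gramE; ring.
have l1 : lambda * (g e e * g e1 e1) != 0 by rewrite mulf_neq0.
have r5 : - 2 * (2 * f2 + mu) = 0.
  apply: (cancel _ _ _ _ l1 k5).
  by do 3 rewrite ?vecE ?gE ?gJJ ?gJ ?gramE; ring.
(* [r1] and [r2] differ by the sign of lambda, so their difference isolates f4; comparing [r1] with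
   [r3] then gives f5. *)
have f4E : f4 = 1.
  have : lambda * (f4 - 1) = 0 by lra.
  by move/eqP; rewrite mulf_eq0 (negbTE lambda_neq0) subr_eq0 => /eqP.
have f5E : f5 = 1 / 2.
  have : lambda ^+ 2 * (2 * f5 - 1) = 0 by rewrite f4E in r1; lra.
  by move/eqP; rewrite mulf_eq0 expf_eq0 (negbTE lambda_neq0) andbF /= => /eqP; lra.
have f2E : f2 = f1 - 1 by rewrite f5E in r3; lra.
by split=> //; lra.
Qed.

End Determination.

End SpaceForm.

(** * Generalized space forms in a chart *)

Section ChartSpaceForm.
Variables (R : realType) (m : nat) (W : set 'rV[R]_m.+1).
Hypothesis Wo : open W.
Local Notation vec := 'rV[R]_m.+1.
Local Notation mat := 'M[R]_m.+1.
Variable A : acm_components R m.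
Hypothesis acmA : acm_axioms A W.
Hypothesis contactA : forall u v x, W x ->
  deta A (fun=> u) (fun=> v) x = metV A x u (v *m phi A x).
Local Notation G := (met A).
Local Notation g := (metV A).
Local Notation eta_ := (etaV A).
Local Notation B := (nabla_xi A).
Local Notation S := (S_mx A).
Local Notation F := (phi A).
Local Notation h := (h_mx A).

Definition space_form_at (x : vec) :=
  space_form_tensor (g x) (fun u : vec => u *m F x) (fun u : vec => u *m h x) (xi A x).

Let sG : smooth_on W G. Proof. exact: met_smooth acmA. Qed.
Let symG x : W x -> (G x)^T = G x.
Proof. by move=> Wx; exact: (met_symmx acmA Wx). Qed.
Let uG x : W x -> G x \in unitmx.
Proof. by move=> Wx; exact: (met_unit acmA Wx). Qed.
Let hE x : W x -> h x = S x *m F x.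
Proof. by move=> Wx; exact: (h_mxE Wo acmA contactA Wx). Qed.

Section AtPoint.
Variable x : vec.
Hypothesis Wx : W x.

Let gD a u u' v : g x (a *: u + u') v = a * g x u v + g x u' v.
Proof. by rewrite metVDl metVZl. Qed.
Let gC u v : g x u v = g x v u. Proof. exact: (met_sym acmA _ _ Wx). Qed.
Let gJ (u v : vec) : g x (u *m F x) v = - g x u (v *m F x). Proof. exact: (metV_phi_skew acmA). Qed.
Let gh (u v : vec) : g x (u *m h x) v = g x u (v *m h x).
Proof.
rewrite hE// !mulmxA gJ (metV_S Wo acmA contactA _ _ Wx) (hor_phi_S Wo acmA contactA _ Wx).
by rewrite metVNr opprK.
Qed.
Let linD (N : mat) a (u v : vec) : (a *: u + v) *m N = a *: (u *m N) + v *m N.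
Proof. by rewrite mulmxDl scalemxAl. Qed.
Let JJ (u : vec) : u *m F x *m F x = - u + g x u (xi A x) *: xi A x.
Proof. by rewrite (phi_phi acmA _ Wx) (metV_xi acmA _ Wx). Qed.
Let hJ (u : vec) : u *m F x *m h x = - (u *m h x *m F x).
Proof. by rewrite hE// !mulmxA (hor_phi_S Wo acmA contactA _ Wx) !mulNmx. Qed.
Let Jxi : xi A x *m F x = 0. Proof. exact: (xi_phi acmA). Qed.
Let hxi : xi A x *m h x = 0. Proof. exact: (xi_h Wo acmA contactA). Qed.
Let etaxi : g x (xi A x) (xi A x) = 1.
Proof. by rewrite (metV_xi acmA _ Wx) (eta_xi acmA Wx). Qed.
Let eta0 (u : vec) : eta_ x u = 0 -> g x u (xi A x) = 0.
Proof. by rewrite (metV_xi acmA _ Wx). Qed.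

Lemma space_form_at_xi f1 f2 f3 f4 f5 f6 (u v w : vec) :
  space_form_at x f1 f2 f3 f4 f5 f6 u v (xi A x) w =
  (f1 - f3) * (eta_ x v * g x u w - eta_ x u * g x v w)
  + (f4 - f6) * (eta_ x v * g x (u *m h x) w - eta_ x u * g x (v *m h x) w).
Proof.
have := @space_form_xi _ _ (g x) (fun u : vec => u *m F x) (fun u : vec => u *m h x) (xi A x)
  gD gC gJ gh Jxi hxi etaxi f1 f2 f3 f4 f5 f6 u v w.
by rewrite !(metV_xi acmA _ Wx).
Qed.

Lemma space_form_at_hol f1 f2 f3 f4 f5 f6 (u : vec) : eta_ x u = 0 ->
  space_form_at x f1 f2 f3 f4 f5 f6 u (u *m F x) (u *m F x) u =
  (f1 + 3 * f2) * g x u u ^+ 2.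
Proof.
move=> u0.
exact: (@space_form_hol _ _ (g x) (fun u : vec => u *m F x) (fun u : vec => u *m h x) (xi A x)
  gD gC gJ gh (linD (F x)) JJ hJ Jxi hxi f1 f2 f3 f4 f5 f6 u (eta0 u0)).
Qed.

Lemma metV_space_form (X Y Z : vec -> vec) f1 f2 f3 f4 f5 f6 (t : vec) :
  smooth_on W X -> smooth_on W Y -> smooth_on W Z ->
  g x (f1 *: R1 A X Y Z x + f2 *: R2 A X Y Z x + f3 *: R3 A X Y Z x
       + f4 *: R4 A X Y Z x + f5 *: R5 A X Y Z x + f6 *: R6 A X Y Z x) t =
  space_form_at x f1 f2 f3 f4 f5 f6 (X x) (Y x) (Z x) t.
Proof.
move=> sX sY sZ.
have hX := hFE Wo acmA sX Wx; have hY := hFE Wo acmA sY Wx.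
have e1 : g x (R1 A X Y Z x) t = g x (Y x) (Z x) * g x (X x) t - g x (X x) (Z x) * g x (Y x) t.
  by rewrite /R1 metVDl metVNl !metVZl.
have e2 : g x (R2 A X Y Z x) t = g x (X x) (Z x *m F x) * g x (Y x *m F x) t
    - g x (Y x) (Z x *m F x) * g x (X x *m F x) t
    + 2 * g x (X x) (Y x *m F x) * g x (Z x *m F x) t.
  by rewrite /R2 /phiF !metVDl metVNl !metVZl.
have e3 : g x (R3 A X Y Z x) t = g x (X x) (xi A x) * g x (Z x) (xi A x) * g x (Y x) t
    - g x (Y x) (xi A x) * g x (Z x) (xi A x) * g x (X x) t
    + g x (X x) (Z x) * g x (Y x) (xi A x) * g x t (xi A x)
    - g x (Y x) (Z x) * g x (X x) (xi A x) * g x t (xi A x).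
  by rewrite /R3 !metVDl !metVNl !metVZl !(metV_xi acmA _ Wx) (gC (xi A x)) !(metV_xi acmA _ Wx).
have e4 : g x (R4 A X Y Z x) t = g x (Y x) (Z x) * g x (X x *m h x) t
    - g x (X x) (Z x) * g x (Y x *m h x) t
    + g x (Y x *m h x) (Z x) * g x (X x) t - g x (X x *m h x) (Z x) * g x (Y x) t.
  by rewrite /R4 hX hY !metVDl !metVNl !metVZl.
have e5 : g x (R5 A X Y Z x) t = g x (Y x *m h x) (Z x) * g x (X x *m h x) t
    - g x (X x *m h x) (Z x) * g x (Y x *m h x) t
    + g x (X x *m h x *m F x) (Z x) * g x (Y x *m h x *m F x) t
    - g x (Y x *m h x *m F x) (Z x) * g x (X x *m h x *m F x) t.
  by rewrite /R5 /phiF hX hY !metVDl !metVNl !metVZl.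
have e6 : g x (R6 A X Y Z x) t = g x (X x) (xi A x) * g x (Z x) (xi A x) * g x (Y x *m h x) t
    - g x (Y x) (xi A x) * g x (Z x) (xi A x) * g x (X x *m h x) t
    + g x (X x *m h x) (Z x) * g x (Y x) (xi A x) * g x t (xi A x)
    - g x (Y x *m h x) (Z x) * g x (X x) (xi A x) * g x t (xi A x).
  rewrite /R6 hX hY !metVDl !metVNl !metVZl !(metV_xi acmA _ Wx) (gC (xi A x)).
  by rewrite !(metV_xi acmA _ Wx).
by rewrite !metVDl !metVZl e1 e2 e3 e4 e5 e6.
Qed.

(** Constant fields suffice in one direction; in the other both sides depend only on the values of
    the fields at [x]. *)
Lemma Riem_space_form f1 f2 f3 f4 f5 f6 :
  (forall X Y Z : vec -> vec, smooth_on W X -> smooth_on W Y -> smooth_on W Z ->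
   curv G X Y Z x = f1 *: R1 A X Y Z x + f2 *: R2 A X Y Z x + f3 *: R3 A X Y Z x
     + f4 *: R4 A X Y Z x + f5 *: R5 A X Y Z x + f6 *: R6 A X Y Z x) <->
  (forall u v w t : vec, g x (w *m Riem G x u v) t = space_form_at x f1 f2 f3 f4 f5 f6 u v w t).
Proof.
split=> [E u v w t|E X Y Z sX sY sZ].
  have sc z : smooth_on W (fun=> z : vec) by exact: (smooth_cst Wo).
  have := E (fun=> u) (fun=> v) (fun=> w) (sc u) (sc v) (sc w).
  rewrite (curvE Wo sG symG uG (sc u) (sc v) (sc w) Wx) => ->.
  exact: (metV_space_form f1 f2 f3 f4 f5 f6 t (sc u) (sc v) (sc w)).
apply: (metV_inj acmA Wx) => t.
by rewrite (curvE Wo sG symG uG sX sY sZ Wx) E metV_space_form.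
Qed.

End AtPoint.

End ChartSpaceForm.

Section RiemLinear.
Variables (R : realType) (m : nat) (W : set 'rV[R]_m.+1).
Hypothesis Wo : open W.
Local Notation vec := 'rV[R]_m.+1.
Variable G : vec -> 'M[R]_m.+1.
Hypothesis sG : smooth_on W G.
Hypothesis symG : forall x, W x -> (G x)^T = G x.
Hypothesis uG : forall x, W x -> G x \in unitmx.

Lemma Riem_swap (x u v : vec) : Riem G x u v = - Riem G x v u.
Proof.
have aux (a b c d : 'M[R]_m.+1) : a - b + c - d = - (b - a + d - c) by mx_ring.
by rewrite !RiemE; exact: aux.
Qed.

Lemma Riem_linear (x u u' v : vec) (a : R) (Wx : W x) :
  Riem G x (a *: u + u') v = a *: Riem G x u v + Riem G x u' v.
Proof.
have sC w := smooth_conn Wo sG uG w.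
have D : 'D_v (fun y => conn G y (a *: u + u')) x =
    a *: 'D_v (fun y => conn G y u) x + 'D_v (fun y => conn G y u') x.
  rewrite -(deriveZ_on a v (sC u) Wx).
  rewrite -(deriveD_on v (smoothZ Wo (smooth_cst Wo (a : R^o)) (sC u)) (sC u') Wx).
  by apply: (derive_eq_on Wo) => // y /[!inE] Wy; rewrite (conn_linear Wo sG symG).
rewrite !RiemE D (derive_linear a u u' (sC v) Wx) (conn_linear Wo sG symG _ _ _ Wx).
have aux (p p' q q' c d e : 'M[R]_m.+1) :
    a *: p + p' - (a *: q + q') + c *m (a *: d + e) - (a *: d + e) *m c =
    a *: (p - q + c *m d - d *m c) + (p' - q' + c *m e - e *m c) by mx_ring.
exact: aux.
Qed.

End RiemLinear.

(** * The Ricci identities in terms of h, and eigenvectors of h *)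

Section KappaMuChart.
Variables (R : realType) (m : nat) (W : set 'rV[R]_m.+1).
Hypothesis Wo : open W.
Local Notation vec := 'rV[R]_m.+1.
Local Notation mat := 'M[R]_m.+1.
Variable A : acm_components R m.
Hypothesis acmA : acm_axioms A W.
Hypothesis contactA : forall u v x, W x ->
  deta A (fun=> u) (fun=> v) x = metV A x u (v *m phi A x).
Local Notation G := (met A).
Local Notation g := (metV A).
Local Notation eta_ := (etaV A).
Local Notation B := (nabla_xi A).
Local Notation S := (S_mx A).
Local Notation F := (phi A).
Local Notation h := (h_mx A).
Variables (kappa mu : vec -> R).
Hypothesis skappa : smooth_on W (kappa : vec -> R^o).
Hypothesis kmA : forall x u v, W x -> xi A x *m Riem G x u v =
  kappa x *: (eta_ x v *: u - eta_ x u *: v)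
  + mu x *: (eta_ x v *: (u *m h_mx A x) - eta_ x u *: (v *m h_mx A x)).

Let hE x : W x -> h x = S x *m F x.
Proof. by move=> Wx; exact: (h_mxE Wo acmA contactA Wx). Qed.
Let SFF x (u : vec) : W x -> u *m S x *m F x *m F x = - (u *m S x).
Proof.
by move=> Wx; rewrite (phi_phi acmA _ Wx) (eta_S Wo acmA contactA _ Wx) scale0r addr0.
Qed.

Lemma h_phi_S (x u : vec) : W x -> u *m h x *m F x = - (u *m S x).
Proof. by move=> Wx; rewrite hE// mulmxA SFF. Qed.

Lemma nabla_xi_h (x u : vec) : W x -> u *m B x = - ((u + u *m h x) *m F x).
Proof.
move=> Wx; rewrite (nabla_xiE A x) mulmxDl h_phi_S// mulmxDr mulmxN.
by rewrite opprD opprK addrC.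
Qed.

Lemma nabla_xi_S_h (x u : vec) : W x -> u *m (B x *m S x) = u *m h x + u *m h x *m h x.
Proof.
move=> Wx; rewrite mulmxA nabla_xi_h// mulNmx (hor_phi_S Wo acmA contactA _ Wx) opprK.
by rewrite hE// !mulmxDl !mulmxA.
Qed.

Lemma hor_h_h (x u : vec) : W x -> eta_ x u = 0 -> u *m h x *m h x = (1 - kappa x) *: u.
Proof.
move=> Wx hu; rewrite hE// !mulmxA (hor_phi_S Wo acmA contactA _ Wx) mulNmx.
rewrite (hor_S_S Wo acmA contactA kmA Wx hu) -!scalemxAl (hor_phi_phi acmA Wx hu).
by rewrite scalerN opprK.
Qed.

Lemma metV_h (x u v : vec) : W x -> g x (u *m h x) v = g x u (v *m h x).
Proof.
move=> Wx; rewrite hE// !mulmxA (metV_phi_skew acmA _ _ Wx) (metV_S Wo acmA contactA _ _ Wx).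
by rewrite (hor_phi_S Wo acmA contactA _ Wx) metVNr opprK.
Qed.

Lemma hor_phi_h (x u : vec) : W x -> u *m F x *m h x = - (u *m h x *m F x).
Proof. by move=> Wx; rewrite hE// !mulmxA (hor_phi_S Wo acmA contactA _ Wx) !mulNmx. Qed.

Section NonSasakian.
Hypothesis kappa_neq1 : forall y, W y -> kappa y != 1.

(** Testing [ricci_phi] against phi t turns its second term into g(R(w, u) z, t), as phi is an
    isometry modulo eta. *)
Lemma Riem_phi_defect (x w u z t : vec) : W x -> eta_ x z = 0 -> eta_ x t = 0 ->
  g x (z *m F x *m Riem G x w u) (t *m F x) - g x (z *m Riem G x w u) t =
  phi_defect (g x) (fun v : vec => v *m F x) (fun v : vec => v *m h x) w u z (t *m F x).
Proof.
move=> Wx hz ht.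
have := ricci_phi Wo acmA contactA kmA kappa_neq1 u w Wx hz (eta_phi acmA t Wx).
rewrite (met_phi acmA _ _ Wx) ht mulr0 subr0 => ->.
by rewrite /phi_defect !(nabla_xi_h _ Wx) !(mulmxDr, mulmx1).
Qed.

Hypothesis smu : smooth_on W (mu : vec -> R^o).
Hypothesis kappa_cst : forall y z, W y -> 'D_z (kappa : _ -> R^o) y = 0 :> R.

Lemma Riem_h_phi (x w u z t : vec) : W x ->
  eta_ x w = 0 -> eta_ x u = 0 -> eta_ x z = 0 -> eta_ x t = 0 ->
  - g x (z *m h x *m F x *m Riem G x w u) t + g x (z *m Riem G x w u) (t *m h x *m F x) =
  - (g x z (- ((w + w *m h x) *m F x)) * g x (u *m h x + u *m h x *m h x) t)
  - g x z (u *m h x + u *m h x *m h x) * g x (- ((w + w *m h x) *m F x)) t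
  + g x z (- ((u + u *m h x) *m F x)) * g x (w *m h x + w *m h x *m h x) t
  + g x z (w *m h x + w *m h x *m h x) * g x (- ((u + u *m h x) *m F x)) t
  - 2 * mu x * g x w (u *m F x) * g x (z *m h x) t.
Proof.
move=> Wx hw hu hz ht.
have := ricci_S Wo acmA contactA skappa kmA kappa_neq1 smu kappa_cst Wx hu hw hz ht.
rewrite (metV_S Wo acmA contactA _ _ Wx) !(nabla_xi_S_h _ Wx) !(nabla_xi_h _ Wx) => <-.
by rewrite !(h_phi_S _ Wx) mulNmx metVNl metVNr opprK.
Qed.

End NonSasakian.

(** With l^2 = 1 - kappa and h^2 = l^2 on horizontal vectors, l y + h y is an eigenvector unless it
    is zero; then h y = - l y and phi y has eigenvalue l. The last clause lets a second eigenvector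
    inherit orthogonality to a first one and to its image under phi. *)
Lemma eigenvector_h (x y : vec) : W x -> kappa x < 1 -> y != 0 -> eta_ x y = 0 ->
  exists e : vec, [/\ e != 0, eta_ x e = 0, e *m h x = Num.sqrt (1 - kappa x) *: e &
    forall f : vec, f *m h x = Num.sqrt (1 - kappa x) *: f ->
      g x f y = 0 -> g x f (y *m F x) = 0 -> g x f e = 0 /\ g x f (e *m F x) = 0].
Proof.
move=> Wx k1 y0 hy; set l := Num.sqrt _.
have l2 : l * l = 1 - kappa x by rewrite -expr2 sqr_sqrtr// subr_ge0 ltW.
have hh := hor_h_h Wx hy; rewrite -l2 in hh.
have [e0|e0] := eqVneq (l *: y + y *m h x) 0; last first.
  exists (l *: y + y *m h x); split=> //.
  - by rewrite etaVD etaVZ hy mulr0 (eta_h Wo acmA contactA _ Wx) addr0.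
  - by rewrite mulmxDl -scalemxAl hh scalerDr scalerA addrC.
  move=> f fh f1 f2; split.
    by rewrite metVDr metVZr f1 mulr0 -metV_h// fh metVZl f1 mulr0 addr0.
  rewrite mulmxDl -scalemxAl metVDr metVZr f2 mulr0 add0r -[y *m h x *m F x]opprK.
  by rewrite -hor_phi_h// metVNr -metV_h// fh metVZl f2 mulr0 oppr0.
have yh : y *m h x = - (l *: y) by apply/eqP; rewrite -addr_eq0 addrC e0.
exists (y *m F x); split.
- apply: contraNneq y0 => yF0.
  by have := hor_phi_phi acmA Wx hy; rewrite yF0 mul0mx => /esym/eqP; rewrite oppr_eq0.
- exact: (eta_phi acmA _ Wx).
- by rewrite hor_phi_h// yh mulNmx opprK -scalemxAl.
move=> f fh f1 f2; split=> //.
by rewrite (hor_phi_phi acmA Wx hy) metVNr f1 oppr0.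
Qed.

End KappaMuChart.

(** * Both implications in one chart *)

Section SpaceFormChart.
Variables (R : realType) (m : nat) (W : set 'rV[R]_m.+1).
Hypothesis Wo : open W.
Local Notation vec := 'rV[R]_m.+1.
Local Notation mat := 'M[R]_m.+1.
Variable A : acm_components R m.
Hypothesis acmA : acm_axioms A W.
Hypothesis contactA : forall u v x, W x ->
  deta A (fun=> u) (fun=> v) x = metV A x u (v *m phi A x).
Local Notation G := (met A).
Local Notation g := (metV A).
Local Notation eta_ := (etaV A).
Local Notation F := (phi A).
Local Notation h := (h_mx A).

Let sG : smooth_on W G. Proof. exact: met_smooth acmA. Qed.
Let symG x : W x -> (G x)^T = G x.
Proof. by move=> Wx; exact: (met_symmx acmA Wx). Qed.
Let uG x : W x -> G x \in unitmx.
Proof. by move=> Wx; exact: (met_unit acmA Wx). Qed.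
Let gC x u v : W x -> g x u v = g x v u.
Proof. by move=> Wx; exact: (met_sym acmA _ _ Wx). Qed.

Lemma Riem_metV_skew (x u v w t : vec) : W x ->
  g x (w *m Riem G x u v) t = - g x (t *m Riem G x u v) w.
Proof.
move=> Wx; rewrite [in RHS]gC// -mulN1r; apply: metV_adjoint.
by rewrite (Riem_skew Wo sG symG uG u v Wx) scaleN1r.
Qed.

Lemma space_form_kappa_mu (x : vec) f1 f2 f3 f4 f5 f6 : W x ->
  (forall u v w t : vec, g x (w *m Riem G x u v) t =
     space_form_at A x f1 f2 f3 f4 f5 f6 u v w t) ->
  forall u v, xi A x *m Riem G x u v =
  (f1 - f3) *: (eta_ x v *: u - eta_ x u *: v)
  + (f4 - f6) *: (eta_ x v *: (u *m h x) - eta_ x u *: (v *m h x)).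
Proof.
move=> Wx E u v; apply: (metV_inj acmA Wx) => t.
rewrite E (space_form_at_xi Wo acmA contactA Wx).
by rewrite metVDl !metVZl !metVDl !metVNl !metVZl.
Qed.

Lemma direct_coefficients (f1 f2 f3 f4 f5 f6 : vec -> R) (x : vec) :
  (3 < m.+1)%N -> W x ->
  smooth_on W (fun y => f1 y - f3 y : R^o) -> smooth_on W (fun y => f4 y - f6 y : R^o) ->
  (forall (y u v w t : vec), W y -> g y (w *m Riem G y u v) t =
     space_form_at A y (f1 y) (f2 y) (f3 y) (f4 y) (f5 y) (f6 y) u v w t) ->
  (forall y, W y -> f1 y - f3 y < 1) ->
  (forall y z, W y -> 'D_z (fun y => f1 y - f3 y : R^o) y = 0 :> R) ->
  [/\ f4 x = 1, f5 x = 1 / 2, f2 x = (f6 x - 1) / 2, f1 x = (f6 x + 1) / 2 &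
      f3 x = (3 * f6 x + 1) / 2].
Proof.
have aux (a1 a2 a3 a4 a5 a6 l2 : R) : l2 = 1 - (a1 - a3) ->
    [/\ a4 = 1, a5 = 1 / 2, a2 = a1 - 1, 4 * a1 - 3 = - (1 - l2) - (a4 - a6)
      & 2 * a2 = - (a4 - a6)] ->
    [/\ a4 = 1, a5 = 1 / 2, a2 = (a6 - 1) / 2, a1 = (a6 + 1) / 2 & a3 = (3 * a6 + 1) / 2].
  by move=> -> [? ? ? ? ?]; split => //; lra.
move=> m3 Wx sk sm E k1 dk.
have kn1 y : W y -> f1 y - f3 y != 1 by move=> Wy; rewrite lt_eqF// k1.
have kmA y u v (Wy : W y) := space_form_kappa_mu Wy (fun u v w t => E y u v w t Wy) u v.
have [y [y0 hy _ _]] := exists_hor_perp acmA 0 Wx m3.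
have [e [e0 he eh _]] := eigenvector_h Wo acmA contactA kmA Wx (k1 _ Wx) y0 hy.
have [y1 [y10 hy1 g1 g2]] := exists_hor_perp acmA e Wx m3.
have [e1 [e10 he1 e1h /(_ e eh g1 g2)[g3 g4]]] :=
  eigenvector_h Wo acmA contactA kmA Wx (k1 _ Wx) y10 hy1.
set l := Num.sqrt _ in eh e1h.
have l2 : l ^+ 2 = 1 - (f1 x - f3 x) by rewrite sqr_sqrtr// subr_ge0 ltW// k1.
have l0 : l != 0 by rewrite lt0r_neq0// sqrtr_gt0 subr_gt0 k1.
have eE v : g x v (xi A x) = eta_ x v by exact: (metV_xi acmA).
apply: (aux _ _ _ _ _ _ _ l2).
apply: (@space_form_determined _ _ (g x) (fun u : vec => u *m F x) (fun u : vec => u *m h x)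
  (xi A x) _ _ _ _ _ _ _ _ (f1 x) (f2 x) (f3 x) (f4 x) (f5 x) (f6 x) l (f4 x - f6 x) e e1 l0).
- by move=> a u u' v; rewrite metVDl metVZl.
- by move=> u v; exact: gC.
- by move=> u v; exact: (metV_phi_skew acmA).
- by move=> a u v; rewrite mulmxDl scalemxAl.
- by move=> a u v; rewrite mulmxDl scalemxAl.
- by move=> u; rewrite (phi_phi acmA _ Wx) eE.
- by move=> u; exact: (hor_phi_h Wo acmA contactA).
- exact: (xi_phi acmA).
- exact: (metV_neq0 acmA).
- exact: (metV_neq0 acmA).
- by rewrite eE.
- by rewrite eE.
- exact: eh.
- exact: e1h.
- exact: g3.
- exact: g4.
- move=> w u z t; rewrite !eE => hw hu hz ht.
  have := Riem_phi_defect Wo acmA contactA kmA kn1 w u Wx hz ht.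
  by rewrite !(E _ _ _ _ _ Wx).
move=> w u z t; rewrite !eE => hw hu hz ht.
have := Riem_h_phi Wo acmA contactA sk kmA kn1 sm dk Wx hw hu hz ht.
by rewrite !(E _ _ _ _ _ Wx).
Qed.

Lemma converse_curvature (c : R) (x : vec) : W x -> -1 < c ->
  (forall y u v, W y -> xi A y *m Riem G y u v =
    (- c) *: (eta_ y v *: u - eta_ y u *: v)
    + (1 - c) *: (eta_ y v *: (u *m h y) - eta_ y u *: (v *m h y))) ->
  (forall u : vec, g x u u = 1 -> eta_ x u = 0 ->
    g x (u *m F x *m Riem G x u (u *m F x)) u = 2 * c - 1) ->
  forall u v w t : vec, g x (w *m Riem G x u v) t =
    space_form_at A x ((c + 1) / 2) ((c - 1) / 2) ((3 * c + 1) / 2) 1 (1 / 2) c u v w t.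
Proof.
have auxQJ (a b p q d : R) : a - b = d -> p - q = d -> a - p = b - q by lra.
have auxL (a p p' q q' : R) : a * p + p' - (a * q + q') = a * (p - q) + (p' - q') by ring.
have auxN (p q : R) : - p - - q = - (p - q) by ring.
have auxB (p q r p' q' r' : R) : p + q + r = 0 -> p' + q' + r' = 0 ->
  p - p' + (q - q') + (r - r') = 0 by lra.
have aux13 : (c + 1) / 2 - (3 * c + 1) / 2 = - c by lra.
have auxhol : (c + 1) / 2 + 3 * ((c - 1) / 2) = 2 * c - 1 by lra.
have auxz (q : R) : q = 1 * q + q -> q = 0 by lra.
have auxs (k l b : R) : k = b -> l = b -> k - l = 0 by move=> -> ->; rewrite subrr.
move=> Wx c1 kmA hol u v w t; apply/eqP; rewrite -subr_eq0; apply/eqP.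
have sk : smooth_on W ((fun=> - c) : vec -> R^o) by exact: (smooth_cst Wo).
have kn1 (y : vec) : W y -> - c != 1.
  by move=> _; rewrite lt_eqF// ltrNl.
have gD a u1 u2 u3 : g x (a *: u1 + u2) u3 = a * g x u1 u3 + g x u2 u3.
  by rewrite metVDl metVZl.
have gC' u1 u2 : g x u1 u2 = g x u2 u1 by exact: gC.
have gJ (u1 u2 : vec) : g x (u1 *m F x) u2 = - g x u1 (u2 *m F x).
  exact: (metV_phi_skew acmA).
have gh (u1 u2 : vec) : g x (u1 *m h x) u2 = g x u1 (u2 *m h x).
  exact: (metV_h Wo acmA contactA).
have lin (N : mat) a (u1 u2 : vec) : (a *: u1 + u2) *m N = a *: (u1 *m N) + u2 *m N.
  by rewrite mulmxDl scalemxAl.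
have JJ (u1 : vec) : u1 *m F x *m F x = - u1 + g x u1 (xi A x) *: xi A x.
  by rewrite (phi_phi acmA _ Wx) (metV_xi acmA _ Wx).
have hJ (u1 : vec) : u1 *m F x *m h x = - (u1 *m h x *m F x).
  exact: (hor_phi_h Wo acmA contactA).
have Jxi : xi A x *m F x = 0 by exact: (xi_phi acmA).
have hxi : xi A x *m h x = 0 by exact: (xi_h Wo acmA contactA).
pose J := fun u1 : vec => u1 *m F x; pose H := fun u1 : vec => u1 *m h x.
(* The deviation of the curvature from the model; the goal is that this curvature-like tensor is
   zero. *)
pose Q u1 u2 u3 u4 := g x (u3 *m Riem G x u1 u2) u4 -
  space_form_at A x ((c + 1) / 2) ((c - 1) / 2) ((3 * c + 1) / 2) 1 (1 / 2) c u1 u2 u3 u4.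
have Q1 a u1 u1' u2 u3 u4 : Q (a *: u1 + u1') u2 u3 u4 = a * Q u1 u2 u3 u4 + Q u1' u2 u3 u4.
  rewrite /Q (Riem_linear Wo sG symG uG _ _ _ _ Wx) mulmxDr -scalemxAr metVDl metVZl.
  rewrite /space_form_at (@space_form_linear1 _ _ (g x) J H (xi A x) gD (lin _) (lin _)).
  exact: auxL.
have Q3 a u1 u2 u3 u3' u4 : Q u1 u2 (a *: u3 + u3') u4 = a * Q u1 u2 u3 u4 + Q u1 u2 u3' u4.
  rewrite /Q lin gD.
  rewrite /space_form_at (@space_form_linear3 _ _ (g x) J H (xi A x) gD gC' (lin _)).
  exact: auxL.
have Q12 u1 u2 u3 u4 : Q u1 u2 u3 u4 = - Q u2 u1 u3 u4.
  rewrite /Q (Riem_swap _ _ u1) mulmxN metVNl.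
  rewrite /space_form_at (@space_form_skew12 _ _ (g x) J H (xi A x) gC' gJ).
  exact: auxN.
have Q34 u1 u2 u3 u4 : Q u1 u2 u3 u4 = - Q u1 u2 u4 u3.
  rewrite /Q (Riem_metV_skew _ _ _ _ Wx).
  rewrite /space_form_at (@space_form_skew34 _ _ (g x) J H (xi A x) gC' gJ).
  exact: auxN.
have Qb u1 u2 u3 u4 : Q u1 u2 u3 u4 + Q u2 u3 u1 u4 + Q u3 u1 u2 u4 = 0.
  apply: auxB.
    by rewrite -!metVDl (bianchi Wo sG symG uG _ _ _ Wx) metV0l.
  exact: (@space_form_bianchi _ _ (g x) J H (xi A x) gD gC' gJ gh hJ).
have Qxi u1 u2 u4 : Q u1 u2 (xi A x) u4 = 0.
  apply: auxs (esym _); last first.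
    exact: esym (space_form_at_xi Wo acmA contactA Wx _ _ _ _ _ _ _ _ _).
  by rewrite (kmA _ _ _ Wx) metVDl !metVZl !metVDl !metVNl !metVZl aux13.
apply: (@curvature_like_eq0 _ _ Q Q1 Q3 Q12 Q34 Qb (xi A x) (eta_ x)) => // [y1 y2 y3 y4|y].
  apply: (@kaehler_hol_eq0 _ _ Q Q1 Q3 Q12 Q34 Qb (fun y => eta_ x y = 0) J).
  - by move=> a z z' hz hz'; rewrite etaVD etaVZ hz hz' mulr0 addr0.
  - by move=> z _; exact: (eta_phi acmA).
  - by move=> z hz; rewrite addr0 scaleN1r; exact: (hor_phi_phi acmA Wx hz).
  - by move=> a z z'; exact: lin.
  (* Curvature and model have the same [phi_defect], so their difference commutes with phi. *)
  - move=> z1 z2 z3 z4 h1 h2 h3 h4; apply: auxQJ.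
      exact: (Riem_phi_defect Wo acmA contactA kmA kn1 z1 z2 Wx h3 h4).
    by apply: (@space_form_phi_defect _ _ (g x) J H (xi A x) gD gC' gJ gh JJ hxi);
      rewrite (metV_xi acmA _ Wx).
  (* The curvature hypothesis concerns unit vectors, hence the case z = 0 and the rescaling by the
     length [l]. *)
  - move=> z hz; have [->|z0] := eqVneq z 0.
      by apply: auxz; rewrite -Q1 scale1r addr0.
    have zz := met_pos acmA Wx z0; set l := Num.sqrt (g x z z).
    have l2 : l * l = g x z z by rewrite -expr2 sqr_sqrtr// ltW.
    have l0 : l != 0 by rewrite lt0r_neq0// sqrtr_gt0.
    have zE : z = l *: (l^-1 *: z) by rewrite scalerA mulfV// scale1r.
    have JZ a (y : vec) : J (a *: y) = a *: J y by rewrite /J -scalemxAl.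
    rewrite zE JZ (curvature_like_scale Q1 Q3 Q12 Q34).
    have e0 : eta_ x (l^-1 *: z) = 0 by rewrite etaVZ hz mulr0.
    have e1 : g x (l^-1 *: z) (l^-1 *: z) = 1.
      by rewrite metVZl metVZr -l2 mulKf// mulVf.
    rewrite [Q _ _ _ _](_ : _ = 0) ?mulr0//; apply: auxs (hol _ e1 e0) _.
    by rewrite (space_form_at_hol Wo acmA contactA Wx _ _ _ _ _ _ e0) e1 expr1n mulr1.
by rewrite etaVD etaVZ (eta_xi acmA Wx) mulr1 addNr.
Qed.

End SpaceFormChart.

(** * The case kappa = 1, and local constancy of kappa elsewhere *)

Section SasakianChart.
Variables (R : realType) (m : nat) (W : set 'rV[R]_m.+1).
Hypothesis Wo : open W.
Local Notation vec := 'rV[R]_m.+1.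
Local Notation mat := 'M[R]_m.+1.
Variable A : acm_components R m.
Hypothesis acmA : acm_axioms A W.
Hypothesis contactA : forall u v x, W x ->
  deta A (fun=> u) (fun=> v) x = metV A x u (v *m phi A x).
Local Notation G := (met A).
Local Notation g := (metV A).
Local Notation eta_ := (etaV A).
Local Notation B := (nabla_xi A).
Local Notation S := (S_mx A).
Local Notation F := (phi A).
Local Notation h := (h_mx A).
Local Notation dF := (cov_mx G F).
Local Notation dS := (cov_mx G S).

Let sG : smooth_on W G. Proof. exact: met_smooth acmA. Qed.

Lemma nabla_phiF (X Y : vec -> vec) (x : vec) : smooth_on W Y -> W x ->
  nabla G X (phiF A Y) x - phiF A (nabla G X Y) x = Y x *m dF x (X x).
Proof.
have aux (a b c : vec) : a = b + c -> a - b = c by move=> ->; rewrite addrC addKr.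
move=> sY Wx; apply: aux; rewrite /phiF !(nablaE sG _ _ Wx).
exact: (cov_row_mul G _ Wx sY (phi_smooth acmA)).
Qed.

Variables (kappa mu : vec -> R).
Hypothesis kmA : forall x u v, W x -> xi A x *m Riem G x u v =
  kappa x *: (eta_ x v *: u - eta_ x u *: v)
  + mu x *: (eta_ x v *: (u *m h_mx A x) - eta_ x u *: (v *m h_mx A x)).

(** The Sasakian formula applied to xi forces S = 0 on horizontal vectors, where S^2 = 1 - kappa. *)
Lemma sasakian_kappa (x : vec) : W x -> (3 < m.+1)%N ->
  (forall u v : vec, v *m dF x u = g x u v *: xi A x - eta_ x v *: u) -> kappa x = 1.
Proof.
move=> Wx m3 sas; have [y [y0 hy _ _]] := exists_hor_perp acmA 0 Wx m3.
have aux (a b : vec) : - (b - - a) = - a -> b = 0.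
  by rewrite opprK opprD addrC => /eqP; rewrite -subr_eq0 addrAC subrr sub0r oppr_eq0 => /eqP.
have yS : y *m S x = 0.
  have := xi_cov_phi Wo acmA y Wx.
  rewrite (nabla_xiE A x) mulmxBr mulmxBl (hor_phi_phi acmA Wx hy).
  rewrite sas (eta_xi acmA Wx) (metV_xi acmA _ Wx) hy scale0r sub0r scale1r => /esym/aux E.
  have := phi_phi acmA (y *m S x) Wx.
  rewrite E mul0mx (eta_S Wo acmA contactA _ Wx) scale0r addr0 => /esym/eqP.
  by rewrite oppr_eq0 => /eqP.
have := hor_S_S Wo acmA contactA kmA Wx hy.
rewrite yS mul0mx => /esym/eqP; rewrite scaler_eq0 (negbTE y0) orbF subr_eq0 => /eqP.
by [].
Qed.

Lemma kappa1_S (x : vec) : W x -> kappa x = 1 -> S x = 0.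
Proof.
move=> Wx k1; apply: mulmx_row_inj => u; rewrite mulmx0.
apply: contraTeq (lexx (0 : R)) => uS0; rewrite -ltNge.
have := met_pos acmA Wx uS0; rewrite (metV_S Wo acmA contactA _ _ Wx).
by rewrite -mulmxA (S_sq Wo acmA contactA kmA Wx) k1 subrr scale0r mulmx0 metV0r.
Qed.

(** Here S = 0, so the curvature condition makes the difference of the two sides symmetric in u and
    v. Paired with w it is also skew in v and w, hence zero. *)
Lemma kappa1_cov_phi (x u v : vec) : (forall y, W y -> kappa y = 1) -> W x ->
  v *m dF x u = g x u v *: xi A x - eta_ x v *: u.
Proof.
have auxT (t : vec -> vec -> vec -> R) :
    (forall u v w, t u v w = t v u w) -> (forall u v w, t u v w = - t u w v) ->
    forall u v w, t u v w = 0.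
  move=> s12 s23 a b c; have := s12 a b c; have := s23 b a c; have := s12 b c a.
  have := s23 c b a; have := s12 c a b; have := s23 a c b; lra.
have auxs (a b c d k : vec) : a - b = d - c -> b - (k - d) = a - (k - c).
  by move/eqP; rewrite subr_eq => /eqP ->; rewrite !opprB; mx_ring.
have auxX (X a b : vec) (N M : mat) (c d l : R) :
    X = 1 *: (c *: a - d *: b) + l *: (c *: (a *m (0 : mat)) - d *: (b *m (0 : mat))) ->
    X = b *m (0 - N) - a *m (0 - M) -> a *m M - b *m N = c *: a - d *: b.
  rewrite !mulmx0 !scaler0 subrr scaler0 addr0 scale1r => ->.
  by rewrite !sub0r !mulmxN opprK [- _ + _]addrC => ->.
have auxk (a b c d e f : R) : a = - b -> a - (c * d - e * f) = - (b - (f * e - d * c)).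
  by move=> ->; ring.
move=> k1 Wx.
have dS0 w : dS x w = 0.
  have S0 y : W y -> S y = (0 : R)%:M.
    by move=> Wy; rewrite raddf0; exact: kappa1_S Wy (k1 _ Wy).
  by rewrite (cov_mx_eq_on Wo _ w S0 Wx) (cov_mx_cst_scalar A).
have h0 : h x = 0 by rewrite (h_mxE Wo acmA contactA Wx) (kappa1_S Wx (k1 _ Wx)) mul0mx.
apply/eqP; rewrite -subr_eq0; apply/eqP/(metV_inj acmA Wx) => w; rewrite metV0l.
apply: (auxT (fun u v w => g x (v *m dF x u - (g x u v *: xi A x - eta_ x v *: u)) w)).
  move=> {}u {}v {}w; congr (g x _ w); rewrite (met_sym acmA v u Wx); apply: auxs.
  have := xi_Riem Wo acmA u v Wx; rewrite !dS0; apply: auxX (mu x) _.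
  by rewrite (kmA _ _ Wx) (k1 _ Wx) h0.
move=> {}u {}v {}w; rewrite !metVDl !metVNl !metVDl !metVNl !metVZl.
rewrite (met_sym acmA (xi A x) w Wx) (met_sym acmA (xi A x) v Wx) !(metV_xi acmA _ Wx).
apply: auxk.
exact: etrans (metV_cov_phi Wo acmA u v w Wx) (congr1 _ (met_sym acmA v (w *m dF x u) Wx)).
Qed.

Hypothesis skappa : smooth_on W (kappa : vec -> R^o).

Lemma kappa_near_constant (x : vec) : W x -> (3 < m.+1)%N -> kappa x != 1 ->
  \forall y \near x, kappa y = kappa x.
Proof.
(* The derivative of kappa is known to vanish only where kappa differs from 1, so the local argument
   runs in that open subset. *)
move=> Wx m3 kx; pose W' := [set y | W y /\ kappa y != 1].
have W'o : open W'.
  rewrite openE => y [Wy ky]; rewrite /interior; near=> z; split.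
    near: z; exact: open_nbhs_nbhs.
  near: z.
  have ck := differentiable_continuous (smooth_differentiable skappa Wy).
  exact: (ck [set r | r != 1] (open_nbhs_nbhs (conj (@open_neq _ _) ky))).
apply: (near_constant W'o) => //.
  by move=> vs y [Wy _]; exact: skappa.
move=> y u [Wy ky]; exact: (derive_kappa_eq0 Wo acmA contactA skappa kmA _ Wy m3 ky).
Unshelve. all: by end_near.
Qed.

End SasakianChart.

(** * From charts to the manifold *)

Section ManifoldTopology.
Variables (R : realType) (m : nat) (M : manifold R m).

Lemma near_chart i (p : M) (Q : M -> Prop) : dom (charts i) p ->
  (\forall y \near Defs.coord (charts i) p, Q (param (charts i) y)) -> \forall q \near p, Q q.
Proof.
move=> dp nQ; have dO := dom_open (charts i).
have cc : {for p, continuous (Defs.coord (charts i))}.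
  have := @coord_cont _ _ _ (charts i).
  by rewrite continuous_open_subspace// => /(_ p (mem_set dp)).
have nQ' : \forall q \near p, Q (param (charts i) (Defs.coord (charts i) q)) := cc _ nQ.
near=> q; rewrite -(@coordK _ _ _ (charts i) q) ?inE; first by near: q.
near: q; exact: open_nbhs_nbhs.
Unshelve. all: by end_near.
Qed.

Lemma smooth_function_continuous (f : M -> R) : smooth_function f -> continuous f.
Proof.
move=> sf p; have [i dp] := charts_cover p; move=> U Uf; apply: (near_chart dp).
have cp : cod (charts i) (Defs.coord (charts i) p) by exists p.
have := differentiable_continuous (smooth_differentiable (sf i) cp).
by apply; rewrite /= coordK ?inE.
Qed.

(** The level set of f(p0) is closed by continuity, and open because f is locally constant wherever
    its value is not [c]. *)
Lemma connected_constant (f : M -> R) (c : R) (p0 : M) : continuous f ->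
  (forall p, f p != c -> \forall q \near p, f q = f p) -> f p0 != c ->
  forall p, f p = f p0.
Proof.
move=> cf lc fp0 p; pose P := [set q | f q = f p0].
suff PT : P = setT by have : P p by rewrite PT.
have cM := @points_connected _ _ M; apply: cM.
- by exists p0.
- exists P; last by rewrite setTI.
  rewrite openE => q Pq; rewrite /interior.
  have fq : f q != c by rewrite Pq.
  by apply: filterS (lc q fq) => r; rewrite /P /= Pq.
exists P; last by rewrite setTI.
have -> : P = f @^-1` [set f p0] by [].
apply: preimage_closed; first by move=> q _; exact: cf.
exact: closed_eq.
Qed.

End ManifoldTopology.

Section ManifoldTensors.
Variables (R : realType) (m : nat) (M : manifold R m) (A : acm_structure M).
Local Notation vec := 'rV[R]_m.+1.
Local Notation W i := (cod (@charts R m M i)).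

Lemma cod_openP i : open (W i). Proof. exact: cod_open. Qed.

Lemma contact_metric_cst i u v x : contact_metric A -> W i x ->
  deta (A i) (fun=> u) (fun=> v) x = metV (A i) x u (v *m phi (A i) x).
Proof.
move=> cA Wx.
exact: (cA i _ _ _ (smooth_cst (@cod_openP i) u) (smooth_cst (@cod_openP i) v)).
Qed.

Let sG i : smooth_on (W i) (met (A i)). Proof. exact: met_smooth (comps_acm A i). Qed.
Let symG i x : W i x -> (met (A i) x)^T = met (A i) x.
Proof. by move=> Wx; exact: (met_symmx (comps_acm A i) Wx). Qed.
Let uG i x : W i x -> met (A i) x \in unitmx.
Proof. by move=> Wx; exact: (met_unit (comps_acm A i) Wx). Qed.
Let sc i (u : vec) : smooth_on (W i) (fun=> u). Proof. exact: (smooth_cst (@cod_openP i)). Qed.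

Lemma km_space_Riem (kappa mu : R) : km_space A kappa mu <-> contact_metric A /\
  forall i x (u v : vec), W i x -> xi (A i) x *m Riem (met (A i)) x u v =
    kappa *: (etaV (A i) x v *: u - etaV (A i) x u *: v)
    + mu *: (etaV (A i) x v *: (u *m h_mx (A i) x) - etaV (A i) x u *: (v *m h_mx (A i) x)).
Proof.
split=> -[cA km]; split=> // i.
  move=> x u v Wx; have := km i _ _ x (@sc i u) (@sc i v) Wx.
  rewrite (curvE (@cod_openP i) (@sG i) (@symG i) (@uG i) (@sc i u) (@sc i v)
             (xi_smooth (comps_acm A i)) Wx) => ->.
  by rewrite !(hFE (@cod_openP i) (comps_acm A i) (@sc i _) Wx).
move=> X Y x sX sY Wx.
rewrite (curvE (@cod_openP i) (@sG i) (@symG i) (@uG i) sX sY (xi_smooth (comps_acm A i)) Wx).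
rewrite (hFE (@cod_openP i) (comps_acm A i) sX Wx) (hFE (@cod_openP i) (comps_acm A i) sY Wx).
exact: km.
Qed.

Lemma phi_sectional_Riem (c : R) : constant_phi_sectional_curvature A c <->
  forall i x (u : vec), W i x -> metV (A i) x u u = 1 -> etaV (A i) x u = 0 ->
    metV (A i) x (u *m phi (A i) x *m Riem (met (A i)) x u (u *m phi (A i) x)) u = c.
Proof.
have sphi i X : smooth_on (W i) X -> smooth_on (W i) (phiF (A i) X).
  by move=> sX; exact: (smooth_mulmx (@cod_openP i) sX (phi_smooth (comps_acm A i))).
split=> hol i.
  move=> x u Wx u1 u0; have := hol i _ x (@sc i u) Wx u1.
  rewrite (metV_xi (comps_acm A i) _ Wx) => /(_ u0).
  by rewrite (curvE (@cod_openP i) (@sG i) (@symG i) (@uG i) (@sc i u) (sphi _ _ (@sc i u))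
                   (sphi _ _ (@sc i u)) Wx).
move=> X x sX Wx u1; rewrite (metV_xi (comps_acm A i) _ Wx) => u0.
rewrite (curvE (@cod_openP i) (@sG i) (@symG i) (@uG i) sX (sphi _ _ sX) (sphi _ _ sX) Wx).
exact: hol.
Qed.

Lemma sasakian_cov_phi : sasakian A <-> forall i x (u v : vec), W i x ->
  v *m cov_mx (met (A i)) (phi (A i)) x u =
  metV (A i) x u v *: xi (A i) x - etaV (A i) x v *: u.
Proof.
split=> sas i.
  move=> x u v Wx; have := sas i _ _ x (@sc i u) (@sc i v) Wx.
  by rewrite (nabla_phiF (comps_acm A i) _ (@sc i v) Wx).
move=> X Y x sX sY Wx; rewrite (nabla_phiF (comps_acm A i) _ sY Wx).
exact: sas.
Qed.

Lemma space_form_Riem (f1 f2 f3 f4 f5 f6 : M -> R) :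
  generalized_km_space_form A f1 f2 f3 f4 f5 f6 <->
  [/\ smooth_function f1, smooth_function f2 & smooth_function f3] /\
  [/\ smooth_function f4, smooth_function f5 & smooth_function f6] /\
  forall i x (u v w t : vec), W i x ->
    let p := param (charts i) x in
    metV (A i) x (w *m Riem (met (A i)) x u v) t =
    space_form_at (A i) x (f1 p) (f2 p) (f3 p) (f4 p) (f5 p) (f6 p) u v w t.
Proof.
split=> -[s1 [s2 E]]; do 2 split=> //.
  move=> i x u v w t Wx p.
  have [+ _] := Riem_space_form (@cod_openP i) (comps_acm A i) Wx
    (f1 p) (f2 p) (f3 p) (f4 p) (f5 p) (f6 p).
  by apply=> X Y Z sX sY sZ; exact: E.
move=> i X Y Z x sX sY sZ Wx p.
have [_ +] := Riem_space_form (@cod_openP i) (comps_acm A i) Wx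
  (f1 p) (f2 p) (f3 p) (f4 p) (f5 p) (f6 p).
by apply=> // u v w t; exact: E.
Qed.

End ManifoldTensors.

(** * Globalization of the direct part *)

Section DirectPart.
Variables (R : realType) (m : nat) (M : manifold R m) (A : acm_structure M).
Hypothesis m3 : (3 < m.+1)%N.
Local Notation vec := 'rV[R]_m.+1.
Local Notation W i := (cod (@charts R m M i)).
Variables f1 f2 f3 f4 f5 f6 : M -> R.
Hypothesis cA : contact_metric A.
Hypothesis sfA : generalized_km_space_form A f1 f2 f3 f4 f5 f6.

Let kappa i (y : vec) : R := f1 (param (@charts R m M i) y) - f3 (param (charts i) y).
Let mu i (y : vec) : R := f4 (param (@charts R m M i) y) - f6 (param (charts i) y).
Let acmA i := comps_acm A i.
Let Wo i : open (W i). Proof. exact: cod_open. Qed.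
Let contactA i u v x : W i x ->
  deta (A i) (fun=> u) (fun=> v) x = metV (A i) x u (v *m phi (A i) x).
Proof. exact: contact_metric_cst. Qed.

Let smooth_diff (a b : M -> R) i : smooth_function a -> smooth_function b ->
  smooth_on (W i) (fun y => a (param (charts i) y) - b (param (charts i) y) : R^o).
Proof.
move=> sa sb.
apply: (smooth_on_eq (@Wo i)) (smoothD (@Wo i) (sa i)
  (smoothM (@Wo i) (smooth_cst (@Wo i) (-1 : R^o)) (sb i))) => y _.
by rewrite mulN1r.
Qed.

Let skappa i : smooth_on (W i) (@kappa i : _ -> R^o).
Proof. by case: sfA => -[s1 _ s3] _; exact: smooth_diff. Qed.
Let smu i : smooth_on (W i) (@mu i : _ -> R^o).
Proof. by case: sfA => _ [[s4 _ s6] _]; exact: smooth_diff. Qed.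

Let RiemA i x (u v w t : vec) (Wx : W i x) :
    let p := param (charts i) x in
    metV (A i) x (w *m Riem (met (A i)) x u v) t =
    space_form_at (A i) x (f1 p) (f2 p) (f3 p) (f4 p) (f5 p) (f6 p) u v w t.
Proof. by move: sfA => /space_form_Riem[_ [_ E]]; exact: E. Qed.

Lemma space_form_xi_Riem i x (u v : vec) : W i x ->
  xi (A i) x *m Riem (met (A i)) x u v =
    kappa i x *: (etaV (A i) x v *: u - etaV (A i) x u *: v)
    + mu i x *: (etaV (A i) x v *: (u *m h_mx (A i) x) - etaV (A i) x u *: (v *m h_mx (A i) x)).
Proof.
move=> Wx; exact: (space_form_kappa_mu (@Wo i) (acmA i) (@contactA i) Wx
  (fun u v w t => RiemA u v w t Wx)).
Qed.

Lemma chart_at (p : M) : exists2 i, dom (charts i) p &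
  W i (Defs.coord (charts i) p) /\ param (charts i) (Defs.coord (charts i) p) = p.
Proof.
by have [i dp] := charts_cover p; exists i => //; split; [exists p | rewrite coordK ?inE].
Qed.

(** Pointwise kappa = 1 would not suffice for the converse implication: the identity S = 0 is
    differentiated, so kappa = 1 is needed on an open set. *)
Lemma sasakian_space_form : sasakian A <-> forall p, f1 p - f3 p = 1.
Proof.
split=> [/sasakian_cov_phi sas p|k1].
  have [i dp [Wp pE]] := chart_at p.
  have := sasakian_kappa (@Wo i) (acmA i) (@contactA i) (@space_form_xi_Riem i) Wp m3
    (fun u v => sas i _ u v Wp).
  by rewrite /kappa pE.
apply/sasakian_cov_phi => i x u v Wx.
exact: (kappa1_cov_phi (@Wo i) (acmA i) (@contactA i) (@space_form_xi_Riem i) u v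
  (fun y _ => k1 _) Wx).
Qed.

Lemma kappa_constant (p0 : M) : f1 p0 - f3 p0 != 1 -> forall p, f1 p - f3 p = f1 p0 - f3 p0.
Proof.
case: sfA => -[s1 _ s3] _; pose k p : R := f1 p - f3 p.
apply: (@connected_constant _ _ M k 1) => [p|p kp].
  apply: (@continuousB _ R^o); exact: smooth_function_continuous.
have [i dp [Wp pE]] := chart_at p.
apply: (near_chart dp).
have := kappa_near_constant (@Wo i) (acmA i) (@contactA i) (@space_form_xi_Riem i) (@skappa i)
  Wp m3; rewrite /kappa pE; exact.
Qed.

Lemma kappa_lt1 (p : M) : f1 p - f3 p != 1 -> f1 p - f3 p < 1.
Proof.
move=> k1; rewrite lt_neqAle k1 /=; have [i dp [Wp pE]] := chart_at p.
have := kappa_le1 (@Wo i) (acmA i) (@contactA i) (@space_form_xi_Riem i) Wp m3.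
by rewrite /kappa pE.
Qed.

Lemma space_form_functions : ~ sasakian A -> exists c6 : R, -1 < c6 /\
  forall p, [/\ f1 p = (c6 + 1) / 2, f2 p = (c6 - 1) / 2 & f3 p = (3 * c6 + 1) / 2] /\
            [/\ f4 p = 1, f5 p = 1 / 2 & f6 p = c6].
Proof.
have aux (a1 a2 a3 a4 a5 a6 k : R) : a1 - a3 = k ->
    [/\ a4 = 1, a5 = 1 / 2, a2 = (a6 - 1) / 2, a1 = (a6 + 1) / 2 & a3 = (3 * a6 + 1) / 2] ->
    [/\ a1 = (- k + 1) / 2, a2 = (- k - 1) / 2 & a3 = (3 * - k + 1) / 2] /\
    [/\ a4 = 1, a5 = 1 / 2 & a6 = - k].
  by move=> <- [-> -> -> -> ->]; split; split=> //; lra.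
move=> nsas; have [p0 k0] : exists p0, f1 p0 - f3 p0 != 1.
  apply: contrapT => k1; apply/nsas/sasakian_space_form => p.
  by apply/eqP; apply: contrapT => kp; apply: k1; exists p; apply/negP.
have kE := kappa_constant k0; have k01 := kappa_lt1 k0.
(* The linear system gives f1 - f3 = - f6, so f6 inherits the constancy of kappa and its bound. *)
exists (- (f1 p0 - f3 p0)); split; first by rewrite ltrN2.
move=> p; apply: aux; first exact: kE.
have [i dp [Wp pE]] := chart_at p.
have := direct_coefficients (@Wo i) (acmA i) (@contactA i) m3 Wp (@skappa i) (@smu i)
  (fun y u v w t Wy => RiemA u v w t Wy).
rewrite pE; apply=> y.
  by rewrite kE.
move=> z Wy; have ky : kappa i y != 1 by rewrite /kappa kE.
exact: (derive_kappa_eq0 (@Wo i) (acmA i) (@contactA i) (@skappa i) (@space_form_xi_Riem i)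
  z Wy m3 ky).
Qed.

Lemma space_form_km_space (c : R) :
  (forall p, f1 p - f3 p = - c) -> (forall p, f4 p - f6 p = 1 - c) -> km_space A (- c) (1 - c).
Proof.
move=> kE muE; apply/km_space_Riem; split=> // i x u v Wx.
by rewrite space_form_xi_Riem// /kappa /mu kE muE.
Qed.

Lemma space_form_phi_sectional (c : R) :
  (forall p, f1 p + 3 * f2 p = c) -> constant_phi_sectional_curvature A c.
Proof.
move=> fE; apply/phi_sectional_Riem => i x u Wx u1 u0.
rewrite RiemA// (space_form_at_hol (@Wo i) (acmA i) (@contactA i) Wx _ _ _ _ _ _ u0).
by rewrite u1 expr1n mulr1.
Qed.

End DirectPart.

(** * Globalization of the converse part *)

Section ConversePart.
Variables (R : realType) (m : nat) (M : manifold R m) (A : acm_structure M).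
Hypothesis m3 : (3 < m.+1)%N.
Local Notation vec := 'rV[R]_m.+1.
Local Notation W i := (cod (@charts R m M i)).
Variable c : R.
Hypothesis c1 : -1 < c.
Hypothesis kmA : km_space A (- c) (1 - c).

Let Wo i : open (W i). Proof. exact: cod_open. Qed.
Let contactA i u v x : W i x ->
  deta (A i) (fun=> u) (fun=> v) x = metV (A i) x u (v *m phi (A i) x).
Proof. by apply: contact_metric_cst; case: kmA. Qed.

(** A Sasakian structure forces kappa = 1, while here kappa = - c < 1. *)
Lemma km_space_not_sasakian : ~ sasakian A.
Proof.
move=> /sasakian_cov_phi sas; have [p _] := points_nonempty M.
have [i dp [Wp pE]] := chart_at p.
move: kmA => /km_space_Riem[_ km].
have := sasakian_kappa (@Wo i) (comps_acm A i) (@contactA i) (km i) Wp m3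
    (fun u v => sas i _ u v Wp).
by move=> k1; move: c1; rewrite -ltrN2 k1 opprK ltxx.
Qed.

Lemma km_space_form : constant_phi_sectional_curvature A (2 * c - 1) ->
  generalized_km_space_form A (fun=> (c + 1) / 2) (fun=> (c - 1) / 2) (fun=> (3 * c + 1) / 2)
    (fun=> 1) (fun=> 1 / 2) (fun=> c).
Proof.
have sc (a : R) : smooth_function ((fun=> a) : M -> R) by move=> i; exact: (smooth_cst (@Wo i)).
move=> /phi_sectional_Riem hol; apply/space_form_Riem; do 2 split=> //.
move=> i x u v w t Wx p; move: kmA => /km_space_Riem[_ km].
exact: (converse_curvature (@Wo i) (comps_acm A i) (@contactA i) Wx c1 (km i)
  (fun u => hol i x u Wx)).
Qed.

End ConversePart.

Theorem theorem4p8 (R : realType) (n : nat) (M : manifold R n.*2)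
    (A : acm_structure M) (dim_ge5 : (5 <= n.*2.+1)%N) :
  (forall f1 f2 f3 f4 f5 f6 : M -> R,
     contact_metric A ->
     generalized_km_space_form A f1 f2 f3 f4 f5 f6 ->
     (~ sasakian A <-> exists p, f1 p - f3 p <> 1) /\
     (~ sasakian A ->
      exists c6 : R,
        [/\ forall p, f1 p = (c6 + 1) / 2,
            forall p, f2 p = (c6 - 1) / 2,
            forall p, f3 p = (3 * c6 + 1) / 2 &
            forall p, f4 p = 1] /\
        [/\ forall p, f5 p = 1 / 2,
            forall p, f6 p = c6 & -1 < c6] /\
        [/\ forall p, f1 p - f3 p = - c6, - c6 < 1,
            forall p, f4 p - f6 p = 1 - c6 & 1 - c6 < 2] /\
        [/\ km_space A (- c6) (1 - c6),
            constant_phi_sectional_curvature A (2 * c6 - 1) &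
            -3 < 2 * c6 - 1])) /\
  (forall f6 : R,
     km_space A (- f6) (1 - f6) ->
     constant_phi_sectional_curvature A (2 * f6 - 1) ->
     -3 < 2 * f6 - 1 ->
     ~ sasakian A /\ contact_metric A /\
     exists f1 f2 f3 f4 f5 : R,
       generalized_km_space_form A (fun=> f1) (fun=> f2) (fun=> f3)
                                   (fun=> f4) (fun=> f5) (fun=> f6) /\
       [/\ f1 = (f6 + 1) / 2, f2 = (f6 - 1) / 2 & f3 = (3 * f6 + 1) / 2] /\
       [/\ f4 = 1, f5 = 1 / 2 & -1 < f6] /\
       [/\ f1 - f3 = - f6, - f6 < 1, f4 - f6 = 1 - f6 & 1 - f6 < 2]).
Proof.
have arith (c : R) : -1 < c -> [/\ - c < 1, 1 - c < 2 & -3 < 2 * c - 1].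
  by move=> c1; split; lra.
have kE (c : R) : (c + 1) / 2 - (3 * c + 1) / 2 = - c by lra.
(* The left side is the phi-sectional curvature f1 + 3 f2 of the model. *)
have holE (c : R) : (c + 1) / 2 + 3 * ((c - 1) / 2) = 2 * c - 1 by lra.
have c1E (c : R) : -3 < 2 * c - 1 -> -1 < c by lra.
have m3 : (3 < n.*2.+1)%N by exact: ltnW.
split=> [f1 f2 f3 f4 f5 f6 cA sfA|f6 km hol /c1E c1].
  split.
    split=> [nsas|[p kp] /(sasakian_space_form m3 cA sfA)k1]; last exact: kp (k1 p).
    apply: contrapT => k1; apply/nsas/(sasakian_space_form m3 cA sfA) => p.
    by apply: contrapT => kp; apply: k1; exists p.
  move=> /(space_form_functions m3 cA sfA)[c [c1 E]].
  have E1 p : f1 p = (c + 1) / 2 by have [[]] := E p.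
  have E2 p : f2 p = (c - 1) / 2 by have [[]] := E p.
  have E3 p : f3 p = (3 * c + 1) / 2 by have [[]] := E p.
  have E4 p : f4 p = 1 by have [_ []] := E p.
  have E5 p : f5 p = 1 / 2 by have [_ []] := E p.
  have E6 p : f6 p = c by have [_ []] := E p.
  have [a1 a2 a3] := arith c c1.
  have k p : f1 p - f3 p = - c by rewrite E1 E3 kE.
  have mu p : f4 p - f6 p = 1 - c by rewrite E4 E6.
  exists c; split; first exact: And4 E1 E2 E3 E4.
  split; first exact: And3 E5 E6 c1.
  split; first exact: And4 k a1 mu a2.
  split; last exact: a3.
    exact: (@space_form_km_space R _ M A f1 f2 f3 f4 f5 f6 cA sfA c k mu).
  by apply: (space_form_phi_sectional cA sfA) => p; rewrite E1 E2 holE.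
have [a1 a2 a3] := arith f6 c1.
split; first exact: (@km_space_not_sasakian R _ M A m3 f6 c1 km).
split; first by case: km.
exists ((f6 + 1) / 2), ((f6 - 1) / 2), ((3 * f6 + 1) / 2), 1, (1 / 2).
split; first exact: (@km_space_form R _ M A f6 c1 km hol).
split; first by split.
split; first exact: And3 erefl erefl c1.
exact: And4 (kE f6) a1 erefl a2.
Qed.
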